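(* Let $\Omega\subset\mathbb{R}^2$ be an interior or exterior domain with smooth boundary $\partial\Omega$, let $f$ be a compactly supported function on $\overline\Omega$ that is smooth up to the boundary, and let $\delta>0$. For $\boldsymbol{x}\in\Omega$ let $\boldsymbol{b}$ denote the closest point to $\boldsymbol{x}$ on $\partial\Omega$, let $r=\|\boldsymbol{b}-\boldsymbol{x}\|$, $c=r/\sqrt\delta$, and let $\kappa_b$ be the curvature of $\partial\Omega$ at $\boldsymbol{b}$. Rotate and translate $\Omega$ so that the $\xi$-direction lies along the tangent line at $\boldsymbol{b}$, the $\eta$-direction is the inward normal at $\boldsymbol{b}$, and $\boldsymbol{x}$ lies at the origin. In this coordinate system let the Taylor series of the source distribution be $$f+f_\xi\,\xi+f_\eta\,\eta+\tfrac12 f_{\xi\xi}\,\xi^2+f_{\xi\eta}\,\xi\eta+\tfrac12 f_{\eta\eta}\,\eta^2+\dots,$$ where $f,f_\xi,f_\eta,\dots$ denote the values of $f$ and of its partial derivatives at $\boldsymbol{x}$. Let $$\mathcal{V}_L[f](\boldsymbol{x})=\int_0^{\delta}\int_\Omega\frac{e^{-\|\boldsymbol{x}-\boldsymbol{x}'\|^2/4t}}{4\pi t}\,f(\boldsymbol{x}')\,d\boldsymbol{x}'\,dt .$$ Then, as $\delta\to0^+$ with $c=O(1)$, $$\begin{aligned} \mathcal{V}_L[f](\boldsymbol{x})&=\frac{\delta}{4}\left(2\,\mathrm{erf}\left(\tfrac c2\right)+\frac{2c\,e^{-c^2/4}}{\sqrt\pi}-c^2\mathrm{erfc}\left(\tfrac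 c2\right)+2\right)f\\ &+\delta^{3/2}\,\frac{\left((4-2c^2)e^{-c^2/4}+\sqrt\pi\,c^3\,\mathrm{erfc}\left(\tfrac c2\right)\right)\left(2f_\eta-\kappa_b f\right)}{12\sqrt\pi}\\ &+\frac{\delta^2}{48}\Bigg(\mathrm{erfc}\left(\tfrac c2\right)\left(4c^4\kappa_b f_\eta-3(c^4+4)f_{\eta\eta}+(c^4-12)f_{\xi\xi}-3c^4\kappa_b^2 f\right)\\ &\qquad+\frac{2c(c^2-2)e^{-c^2/4}\left(-4\kappa_b f_\eta+3f_{\eta\eta}-f_{\xi\xi}+3\kappa_b^2 f\right)}{\sqrt\pi}+24\left(f_{\xi\xi}+f_{\eta\eta}\right)\Bigg)+O\left(\delta^{5/2}\right). \end{aligned}$$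
   Context: $\mathrm{erf}$ and $\mathrm{erfc}$ are the error function and complementary error function. It is assumed that $\boldsymbol{x}$ has a unique closest point $\boldsymbol{b}$ on $\partial\Omega$, so that $\boldsymbol{x}=\boldsymbol{b}-r\boldsymbol{\nu}_b$ with $\boldsymbol{\nu}_b$ the unit normal at $\boldsymbol{b}$ pointing out of $\Omega$; the expansion is as $\delta\to0^+$ with $r=c\sqrt\delta$ and $c$ bounded. In the rotated and translated coordinates, $\boldsymbol{b}=(0,-r)$ and near $\boldsymbol{b}$ the domain is $\{\eta>\gamma(\xi)\}$ where the boundary is the graph $\eta=\gamma(\xi)$ with $\gamma(0)=-r$, $\gamma'(0)=0$; the signed curvature is $\kappa_b=\gamma''(0)$. *)

(* Defs.v *)
From HB Require Import structures.
From mathcomp Require Import all_boot all_order all_algebra.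
From mathcomp Require Import all_classical all_reals all_analysis.

Set Implicit Arguments.
Unset Strict Implicit.
Unset Printing Implicit Defensive.

Import Order.TTheory GRing.Theory Num.Theory.
Import numFieldNormedType.Exports.

Local Open Scope classical_set_scope.
Local Open Scope ring_scope.

Section error_function.
Variable R : realType.
Local Notation mu := (@lebesgue_measure R).

(* The difference of the two integrals is the oriented integral from 0 to z:
   one of the two intervals is empty or a point. *)
Definition erf (z : R) : R :=
  2 / Num.sqrt pi *
  (\int[mu]_(t in `[0, z]) gauss_fun t - \int[mu]_(t in `[z, 0]) gauss_fun t).

Definition erfc (z : R) : R := 1 - erf z.

End error_function.

Section plane.
Variable R : realType.
Implicit Types (x b n o p : R * R) (Omega : set (R * R)) (f : R * R -> R).

(* The library norm on [R * R] is the sup norm. *)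
Definition enorm p : R := Num.sqrt (p.1 ^+ 2 + p.2 ^+ 2).

Definition frontier Omega : set (R * R) := closure Omega `\` interior Omega.

(* The point with coordinates [p = (xi, eta)] in the frame with origin [o]
   whose eta-axis is the unit vector [n] and whose xi-axis is [n] turned
   clockwise by a right angle, so that [frame o n] is a rotation followed by
   a translation. *)
Definition frame o n p : R * R :=
  (o.1 + p.1 * n.2 + p.2 * n.1, o.2 - p.1 * n.1 + p.2 * n.2).

Definition smooth_on (A : set R) (gamma : R -> R) : Prop :=
  forall (k : nat) (s : R), A s -> derivable (derive1n k gamma) s 1.

(* In the coordinates of [frame o n], the set [Omega] is
   [eta > gamma xi] near the point [(0, gamma 0)], with [gamma] smooth. *)
Definition local_epigraph Omega o n (gamma : R -> R) : Prop :=
  exists2 eps : R, 0 < eps &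
    smooth_on `]- eps, eps[ gamma /\
    forall p, enorm (p - (0, gamma 0)) < eps ->
      (Omega (frame o n p) <-> gamma p.1 < p.2).

Definition smooth_boundary Omega : Prop :=
  forall b, frontier Omega b ->
    exists (n : R * R) (gamma : R -> R),
      [/\ enorm n = 1, gamma 0 = 0 & local_epigraph Omega b n gamma].

(* An interior domain is bounded; an exterior domain has a bounded
   complement. *)
Definition interior_or_exterior_domain Omega : Prop :=
  [/\ open Omega, connected Omega, Omega !=set0 &
      bounded_set Omega \/ bounded_set (~` Omega)].

Definition partial1 f : R * R -> R := 'D_((1, 0) : R * R) f.
Definition partial2 f : R * R -> R := 'D_((0, 1) : R * R) f.

(* Iterated partial derivative; [true] and [false] stand for the first and
   the second variable. *)
Definition pderiv (w : seq bool) f : R * R -> R :=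
  foldr (fun i : bool => if i then partial1 else partial2) f w.

(* All iterated partial derivatives exist in the open set [Omega] and extend
   continuously to its closure; the extension of [f] is [f] itself. *)
Definition smooth_up_to_boundary Omega f : Prop :=
  [/\ {within closure Omega, continuous f},
      forall (w : seq bool) x, Omega x ->
        derivable (pderiv w f) x ((1, 0) : R * R) /\
        derivable (pderiv w f) x ((0, 1) : R * R)
    & forall w : seq bool, exists2 g : R * R -> R,
        {within closure Omega, continuous g} &
        forall x, Omega x -> g x = pderiv w f x].

Definition compactly_supported Omega f : Prop :=
  compact (closure (closure Omega `&` [set x | f x != 0])).

Definition unique_closest_point Omega x b : Prop :=
  frontier Omega b /\
  forall b', frontier Omega b' -> b' != b -> enorm (b - x) < enorm (b' - x).

(* [frame x n] is the coordinate system adapted to [x] and its closest point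
   [b]: the origin is [x], the unit vector [n] is the inward normal at [b],
   and the boundary near [b] is the graph of [gamma].  The signed curvature
   at [b] is the second derivative of [gamma] at 0; it is positive for a
   disc. *)
Definition adapted_coordinates Omega x b n (gamma : R -> R) : Prop :=
  [/\ enorm n = 1,
      frame x n (0, - enorm (b - x)) = b,
      gamma 0 = - enorm (b - x),
      derive1 gamma 0 = 0
    & local_epigraph Omega x n gamma].

Definition heat_kernel (t : R) (p : R * R) : R :=
  expR (- (enorm p ^+ 2 / (4 * t))) / (4 * pi * t).

Definition VL Omega f (delta : R) x : R :=
  \int[@lebesgue_measure R]_(t in `]0, delta[)
    (\int[(@lebesgue_measure R \x @lebesgue_measure R)%E]_(y in Omega)
      (heat_kernel t (x - y) * f y)).

End plane.

(* Main.v *)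
Require Import Defs.
From HB Require Import structures.
From mathcomp Require Import all_boot all_order all_algebra.
From mathcomp Require Import all_classical all_reals all_analysis.
From mathcomp Require Import measurable_realfun.
From mathcomp Require Import ring lra.

Set Implicit Arguments.
Unset Strict Implicit.
Unset Printing Implicit Defensive.

Import Order.TTheory GRing.Theory Num.Theory.
Import numFieldNormedType.Exports.

Local Open Scope classical_set_scope.
Local Open Scope ring_scope.

(** In the coordinates of [frame x n] the domain near [x] is the region above a
    graph [eta = gamma xi] with [gamma xi = - r + kappa xi^2 / 2 + be xi^3] up to
    fourth order, and the heat kernel at time [t = u^2] is a product of two
    Gaussian weights [gs u] in [xi] and in [eta], of width [u].  On the column
    over [xi] the integral of a quadratic polynomial above the graph is a
    combination of moments of [gs u] over the half-line cut at [gamma xi]; these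
    are expanded in powers of [gamma xi + r] around the cut [- r].  Since [xi] has
    size [u], the displacement [gamma xi + r] has size [u^2], and each derivative
    of a moment costs a factor [1 / u]: all terms kept in [column] are of order
    at most two in [u], or odd in [xi], and the rest is of order three.
    Integrating over [xi] gives [plane_main], with an error [K u^3]
    ([region_expansion]).  The points near which the domain differs from the
    region above the cubic graph form a layer of thickness [xi^4], which costs
    [u^4 / u]; points at a fixed distance from [x] cost less than any power of
    [u].

    The formula to be proved is, as a function [Psi] of [u], a primitive of
    [2 u plane_main] that tends to [0] with [u] ([is_derive_Psi], [cvg_Psi0]).
    Hence integrating over times in [0, delta] turns the error [K t^(3/2)] into
    [K delta^(5/2)] ([time_integral]).

    The constant has to be the same for all [x].  A closest point [b] ranges over
    the frontier, which is compact; near each frontier point one graph [phi],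
    in one fixed frame, describes the boundary.  For another frontier point the
    adapted frame is rotated with respect to the fixed one, and the rotated graph
    is squeezed between quartic perturbations of an explicit cubic graph, with
    constants that depend on the derivatives of [phi] only ([sandwich]).  The
    function [gamma] that comes with the frame has no uniform bounds; it is only
    used to identify the angle of the rotation and the curvature ([identify]).
    Compactness then gives [regular_boundary].

    The Taylor expansion of [f] at [x] also needs a uniform remainder.  The
    derivatives of [f] are bounded because they vanish away from a compact set
    ([bounded_pderiv]), but a segment from [x] to a nearby point of [Omega] may
    leave [Omega].  It is replaced by a path that goes up, across and down in a
    chart of the boundary, whose length is comparable to the distance
    ([local_linked], [linked_taylor]). *)

(** * The error function *)

Section gauss.
Variable R : realType.
Implicit Types (a s z u : R).
Local Notation mu := (@lebesgue_measure R).

Lemma integrable_gauss_itv a b :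
  mu.-integrable `[a, b] (EFin \o (@gauss_fun R)).
Proof.
apply: continuous_compact_integrable; first exact: segment_compact.
by apply: continuous_subspaceT; exact: continuous_gauss_fun.
Qed.

(** Moving the base point of the oriented integral far to the left makes [erf] an
    integral with a variable upper bound, to which the fundamental theorem of
    calculus applies. *)
Lemma erf_base a z : a <= 0 -> a <= z ->
  erf z = 2 / Num.sqrt pi *
    (\int[mu]_(t in `[a, z]) gauss_fun t - \int[mu]_(t in `[a, 0]) gauss_fun t).
Proof.
move=> a0 az; rewrite /erf; congr (_ * _).
have one x : \int[mu]_(t in `[x, x]) gauss_fun t = 0.
  by rewrite set_itv1 Rintegral_set1.
have half b y : a <= b -> b <= y ->
  \int[mu]_(t in `[a, y]) gauss_fun t - \int[mu]_(t in `[a, b]) gauss_fun t =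
  \int[mu]_(t in `[b, y]) gauss_fun t.
  move=> ab b_y; rewrite (Rintegral_itvB (integrable_gauss_itv a y)) ?bnd_simp//.
  rewrite Rintegral_itv_obnd_cbnd//.
  apply: (integrableS _ _ _ (integrable_gauss_itv a y)) => //.
  by apply: subset_itvr; rewrite bnd_simp.
have [z0|/ltW z0] := leP 0 z.
  rewrite (half 0 z a0 z0).
  have [->|zN0] := eqVneq z 0; first by rewrite subrr one.
  rewrite [X in _ - X](_ : _ = 0) ?subr0//.
  by rewrite set_itv_ge ?Rintegral_set0// bnd_simp -ltNge lt_neqAle eq_sym zN0.
rewrite -(half z 0)//; have [->|zN0] := eqVneq z 0; first by rewrite one !subrr.
rewrite [X in X - _](_ : _ = 0).
  by rewrite opprB add0r.
by rewrite set_itv_ge ?Rintegral_set0// bnd_simp -ltNge lt_neqAle zN0.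
Qed.

Global Instance is_derive_erf z :
  is_derive z 1 (@erf R) (2 / Num.sqrt pi * expR (- z ^+ 2)).
Proof.
pose a := - (`|z| + 1).
have a0 : a < 0 by rewrite /a oppr_lt0 ltr_wpDl.
have az : a < z.
  by rewrite /a; have := ler_norm (- z); rewrite normrN => ?; lra.
pose F x := \int[mu]_(t in `[a, x]) gauss_fun t.
have [dF F'] : derivable F z 1 /\ derive1 F z = gauss_fun z.
  apply: (@continuous_FTC1 _ (@gauss_fun R) (BLeft a) z (z + 1)).
  - by rewrite ltrDl.
  - exact: integrable_gauss_itv.
  - by rewrite lte_fin || rewrite bnd_simp || exact: az.
  - exact: continuous_gauss_fun.
have iF : is_derive z 1 F (gauss_fun z) by rewrite -F' derive1E; exact: derivableP.
pose G x := 2 / Num.sqrt pi * (F x - F 0).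
have iG : is_derive z 1 G (2 / Num.sqrt pi * expR (- z ^+ 2)).
  by rewrite /G; apply: is_derive_eq; rewrite /GRing.scale/= subr0.
apply: near_eq_is_derive iG.
near=> x; rewrite /G -(@erf_base a)//; first exact: ltW.
apply: ltW.
by near: x; exact: lt_nbhsr.
Unshelve. all: by end_near. Qed.

Lemma erf0 : erf (0 : R) = 0.
Proof. by rewrite /erf subrr mulr0. Qed.

Lemma cvg_erf : @erf R x @[x --> +oo] --> (1 : R).
Proof.
have sp0 : (0 : R) < Num.sqrt pi by rewrite sqrtr_gt0 pi_gt0.
have cvg_Ig : \int[mu]_(t in `[0, x]) @gauss_fun R t @[x --> +oo]
    --> (Num.sqrt pi / 2 : R).
  have : Num.sqrt (@gauss_integral_proof.integral0_gauss R x ^+ 2) @[x --> +oo]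
      --> (Num.sqrt (pi / 4) : R).
    apply: continuous_cvg => //; first exact: sqrt_continuous.
    exact: gauss_integral_proof.cvg_integral0_gauss_sqr.
  rewrite sqrtrM ?pi_ge0// sqrtrV// (_ : 4 = 2 ^+ 2); last by ring.
  rewrite sqrtr_sqr ger0_norm// => H; apply: cvg_trans H.
  apply: near_eq_cvg; near=> x.
  rewrite sqrtr_sqr// ger0_norm//; exact: gauss_integral_proof.integral0_gauss_ge0.
have -> : (1 : R) = 2 / Num.sqrt pi * (Num.sqrt pi / 2).
  by field; rewrite gt_eqF.
have H : 2 / Num.sqrt pi * (\int[mu]_(t in `[0, x]) gauss_fun t) @[x --> +oo] -->
   (2 / Num.sqrt pi * (Num.sqrt pi / 2) : R) by apply: cvgMr.
apply: cvg_trans H; apply: near_eq_cvg; near=> x.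
rewrite (@erf_base 0)// set_itv1 Rintegral_set1 subr0//.
Unshelve. all: by end_near. Qed.

End gauss.

(** * The Gaussian weight and its moments *)
Section weight.
Variable R : realType.
Implicit Types (a s z u : R).
Local Notation mu := (@lebesgue_measure R).
Local Notation spi := (Num.sqrt (pi : R)).

(** Heat kernel on the line at time [u ^+ 2]; using the length scale [u] as
    parameter keeps square roots out of the computations. *)
Definition gs u s : R := expR (- (s ^+ 2 / (4 * u ^+ 2))) / (2 * u * spi).

(** Closed forms of the moments of order 0, 1, 2 and 4 of [gs u] over the
    half-line to the right of [a]. *)
Definition tail0 u a : R := (1 - erf (a / (2 * u))) / 2.
Definition tail1 u a : R := 2 * u ^+ 2 * gs u a.
Definition tail2 u a : R := 2 * u ^+ 2 * tail0 u a + 2 * u ^+ 2 * (a * gs u a).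
Definition tail4 u a : R :=
  2 * u ^+ 2 * (a ^+ 3 * gs u a) + 6 * u ^+ 2 * tail2 u a.

Lemma spi_gt0 : 0 < spi. Proof. by rewrite sqrtr_gt0 pi_gt0. Qed.
Hint Resolve spi_gt0 : core.
Let spi_neq0 : spi != 0. Proof. by rewrite gt_eqF. Qed.

Lemma gs_gt0 u s : 0 < u -> 0 < gs u s.
Proof. by move=> u0; rewrite divr_gt0 ?expR_gt0// !mulr_gt0. Qed.

Lemma gs_ge0 u s : 0 < u -> 0 <= gs u s.
Proof. by move=> u0; exact/ltW/gs_gt0. Qed.

Lemma gsN u s : gs u (- s) = gs u s.
Proof. by rewrite /gs sqrrN. Qed.

Lemma is_derive_gs u s : 0 < u ->
  is_derive s 1 (gs u) (- (s / (2 * u ^+ 2)) * gs u s).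
Proof.
move=> u0; have uN0 : u != 0 by rewrite gt_eqF.
rewrite /gs; apply: is_derive_eq; rewrite /GRing.scale/=.
by field; rewrite spi_neq0 uN0.
Qed.

Lemma is_derive_tail0 u a : 0 < u -> is_derive a 1 (tail0 u) (- gs u a).
Proof.
move=> u0; have uN0 : u != 0 by rewrite gt_eqF.
rewrite /tail0 /gs; apply: is_derive_eq; rewrite /GRing.scale/=.
have -> : (a / (2 * u)) ^+ 2 = a ^+ 2 / (4 * u ^+ 2) by field.
by field; rewrite spi_neq0 uN0.
Qed.

Lemma is_derive_tail1 u a : 0 < u -> is_derive a 1 (tail1 u) (- (a * gs u a)).
Proof.
move=> u0; have uN0 : u != 0 by rewrite gt_eqF.
have dg := @is_derive_gs u a u0.
rewrite /tail1; apply: is_derive_eq; rewrite /GRing.scale/=.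
by field.
Qed.

Lemma is_derive_tail2 u a : 0 < u ->
  is_derive a 1 (tail2 u) (- (a ^+ 2 * gs u a)).
Proof.
move=> u0; have uN0 : u != 0 by rewrite gt_eqF.
have dg := @is_derive_gs u a u0; have d0 := @is_derive_tail0 u a u0.
rewrite /tail2; apply: is_derive_eq; rewrite /GRing.scale/=.
by field.
Qed.

Lemma is_derive_tail4 u a : 0 < u ->
  is_derive a 1 (tail4 u) (- (a ^+ 4 * gs u a)).
Proof.
move=> u0; have uN0 : u != 0 by rewrite gt_eqF.
have dg := @is_derive_gs u a u0; have d2 := @is_derive_tail2 u a u0.
rewrite /tail4; apply: is_derive_eq; rewrite /GRing.scale/=.
by field.
Qed.

Lemma continuous_gs u : 0 < u -> continuous (gs u).
Proof.
move=> u0 s; have [/derivable1_diffP/differentiable_continuous//] :=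
  @is_derive_gs u s u0.
Qed.

(** The envelope [env u s] dominates all powers of [s / u] that occur, while
    [gs u s * env u s] is still a Gaussian weight, of twice the variance. *)
Definition env u s : R := expR (s ^+ 2 / (8 * u ^+ 2)).

Definition cenv : R := 1 + 48 ^+ 6.

Lemma env_ge1 u s : 1 <= env u s.
Proof.
by rewrite /env -[leLHS]expR0 ler_expR divr_ge0 ?sqr_ge0// mulr_ge0// sqr_ge0.
Qed.

Lemma cenv_gt0 : 0 < cenv. Proof. by rewrite /cenv; lra. Qed.

(** Powers up to twelve are enough for the expansions below; bounding all of them
    by [1 + z ^+ 12] gives one constant [cenv], and [z ^+ 12] is compared with
    [expR (z ^+ 2 / 8)] through [1 + y <= expR y]. *)
Lemma pow_le_env (k : nat) u s : (k <= 12)%N -> 0 < u ->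
  `|s| ^+ k <= cenv * u ^+ k * env u s.
Proof.
move=> k12 u0; have uN0 : u != 0 by rewrite gt_eqF.
pose z := `|s| / u.
have z0 : 0 <= z by rewrite divr_ge0// ltW.
have -> : `|s| = z * u by rewrite /z divfK.
have -> : env u s = expR (z ^+ 2 / 8).
  rewrite /env /z; congr expR; rewrite expr_div_n real_normK ?num_real//.
  by field.
rewrite exprMn mulrAC; apply: ler_wpM2r; first by rewrite exprn_ge0 ?ltW.
have zk : z ^+ k <= 1 + z ^+ 12.
  have [z1|z1] := leP z 1.
    by apply: (le_trans (exprn_ile1 k z0 z1)); rewrite lerDl exprn_ge0.
  by rewrite (le_trans (ler_weXn2l (ltW z1) k12))// lerDr.
apply: (le_trans zk); rewrite /cenv mulrDl mul1r lerD//.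
  by rewrite -[leLHS]expR0 ler_expR divr_ge0 ?sqr_ge0.
have -> : z ^+ 12 = 48 ^+ 6 * (z ^+ 2 / 48) ^+ 6 by field.
apply: ler_wpM2l; first by lra.
have -> : z ^+ 2 / 8 = 6%:R * (z ^+ 2 / 48) by field.
rewrite expRM_natl.
rewrite lerXn2r ?nnegrE ?expR_ge0 ?divr_ge0 ?sqr_ge0//.
by apply: (le_trans _ (expR_ge1Dx _)); rewrite lerDr.
Qed.

(** The envelope halves the decay rate, which doubles the variance. *)
Lemma gs_env u s : 0 < u -> gs u s * env u s = Num.sqrt 2 * gs (Num.sqrt 2 * u) s.
Proof.
move=> u0; have uN0 : u != 0 by rewrite gt_eqF.
have s20 : Num.sqrt (2 : R) != 0 by rewrite gt_eqF// sqrtr_gt0.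
rewrite /gs /env exprMn sqr_sqrtr// mulrAC -expRD.
have -> : - (s ^+ 2 / (4 * u ^+ 2)) + s ^+ 2 / (8 * u ^+ 2) =
   - (s ^+ 2 / (4 * (2 * u ^+ 2))) by field.
by field; rewrite s20 spi_neq0 uN0.
Qed.

Lemma pow_gs_le (k : nat) u s : (k <= 12)%N -> 0 < u ->
  `|s| ^+ k * gs u s <= cenv * u ^+ k / (2 * u * spi).
Proof.
move=> k12 u0; have uN0 : u != 0 by rewrite gt_eqF.
apply: (@le_trans _ _ (cenv * u ^+ k * (env u s * gs u s))).
  by rewrite mulrA ler_wpM2r ?gs_ge0// pow_le_env.
apply: ler_wpM2l; first by rewrite mulr_ge0 ?exprn_ge0 ?ltW// cenv_gt0.
rewrite /env /gs mulrA -expRD ler_pdivrMr ?mulVf ?mulf_neq0// ?mulr_gt0//.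
rewrite -[leRHS]expR0 ler_expR -subr_ge0.
have -> : 0 - (s ^+ 2 / (8 * u ^+ 2) - s ^+ 2 / (4 * u ^+ 2)) =
  s ^+ 2 / (8 * u ^+ 2) by field.
by rewrite divr_ge0 ?sqr_ge0// mulr_ge0// sqr_ge0.
Qed.

Lemma cvg_pow_gs (k : nat) u : (k < 12)%N -> 0 < u ->
  s ^+ k * gs u s @[s --> +oo] --> (0 : R).
Proof.
move=> k12 u0; set C := cenv * u ^+ k.+1 / (2 * u * spi).
have C0 : C * s^-1 @[s --> +oo] --> (0 : R).
  rewrite -[X in _ --> X](mulr0 C); apply: cvgMr.
  by apply/gtr0_cvgV0; [near=> x; near: x; exact: nbhs_pinfty_gt|exact: cvg_id].
apply: (@squeeze_cvgr _ _ _ _ (cst 0) (fun s => C * s^-1)) => //; last exact: cvg_cst.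
near=> s; have s0 : 0 < s by [].
apply/andP; split; first by rewrite mulr_ge0 ?exprn_ge0 ?gs_ge0// ltW.
rewrite ler_pdivlMr// mulrAC -exprSr.
by have := @pow_gs_le k.+1 u s k12 u0; rewrite gtr0_norm.
Unshelve. all: by end_near. Qed.

End weight.

Section invariant.
Variables (R : realType) (d : measure_display) (T : measurableType d).
Variables (m : {measure set T -> \bar R}) (phi : T -> T).
Hypothesis mphi : measurable_fun setT phi.
Hypothesis inv : forall A, measurable A -> pushforward m phi A = m A.

Lemma Rintegral_invariant (f : T -> R) : m.-integrable setT (EFin \o f) ->
  m.-integrable setT (EFin \o (f \o phi)) /\
  \int[m]_x f (phi x) = \int[m]_x f x.
Proof.
move=> If; have /integrableP[mf foo] := If.
have /measurable_EFinP mf' := mf.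
have mfphi : measurable_fun setT (f \o phi) by exact: measurableT_comp.
have E (g : T -> \bar R) :
    (\int[pushforward m phi]_x g x = \int[m]_x g x)%E.
  by apply: eq_measure_integral => A mA _; exact: inv.
have Ip : m.-integrable setT (EFin \o (f \o phi)).
  apply/integrableP; split; first exact/measurable_EFinP.
  rewrite -E in foo.
  rewrite ge0_integral_pushforward//= in foo.
  by apply: measurableT_comp => //; exact: measurableT_comp.
split => //; rewrite /Rintegral -[in RHS]E.
by rewrite integral_pushforward// preimage_setT.
Qed.

End invariant.

Section moments.
Variable R : realType.
Implicit Types (a s z u : R).
Local Notation mu := (@lebesgue_measure R).
Local Notation spi := (Num.sqrt (pi : R)).

(** The function [G] is minus a primitive of [f], and vanishes at infinity. *)
Lemma integral_tail (f G : R -> R) a :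
  (forall x, a <= x -> 0 <= f x) -> continuous f ->
  (forall x : R, is_derive x (1 : R) G (- f x)) -> G x @[x --> +oo] --> (0 : R) ->
  \int[mu]_(x in `[a, +oo[) f x = G a.
Proof.
move=> f0 cf dG G0.
have dF (x : R) : is_derive x (1 : R) (fun y => - G y) (f x).
  by rewrite -[f x]opprK; apply: is_deriveN.
rewrite (@Rintegral_ge0_continuous_FTC2y _ f (fun y => - G y) a 0)//.
- by rewrite sub0r opprK.
- by apply: continuous_subspaceT.
- by rewrite -oppr0; apply: cvgN.
- apply: cvg_at_right_filter.
  by have [/derivable1_diffP/differentiable_continuous] := dF a.
- by move=> x _; rewrite derive1E; have [_ ->] := dF x.
Qed.

Lemma measurable_gs u : measurable_fun setT (gs u).
Proof.
rewrite /gs; apply: measurable_funM => //.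
apply: measurableT_comp => //; apply: measurableT_comp => //.
by apply: measurable_funM => //; exact: measurable_funX.
Qed.

Lemma measurable_env u : measurable_fun setT (env u).
Proof.
rewrite /env; apply: measurableT_comp => //.
by apply: measurable_funM => //; exact: measurable_funX.
Qed.

(** The weight is the density of a centred normal law of variance [2 u^2], which
    gives its integrability and its total mass. *)
Lemma gs_normal_pdf u : 0 < u -> gs u = normal_pdf 0 (Num.sqrt 2 * u).
Proof.
move=> u0; have uN0 : u != 0 by rewrite gt_eqF.
have s20 : Num.sqrt (2 : R) != 0 by rewrite gt_eqF// sqrtr_gt0.
rewrite normal_pdfE ?mulf_neq0//; apply/funext => s.
rewrite /gs /normal_peak /normal_fun exprMn sqr_sqrtr// subr0 mulrC; congr (_^-1 * expR _).
  rewrite (_ : (2 * u ^+ 2 * pi) *+ 2 = (2 * u) ^+ 2 * pi); last by ring.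
  by rewrite sqrtrM ?sqr_ge0// sqrtr_sqr gtr0_norm// mulr_gt0.
by rewrite -[_ *+ 2]mulr_natr; field.
Qed.

Lemma integrable_gs u : 0 < u -> mu.-integrable setT (EFin \o gs u).
Proof.
by move=> u0; rewrite gs_normal_pdf//; exact: integrable_normal_pdf.
Qed.

Lemma Rintegral_gs u : 0 < u -> \int[mu]_s gs u s = 1.
Proof.
by move=> u0; rewrite gs_normal_pdf// /Rintegral integral_normal_pdf.
Qed.

Lemma integrable_gs_env u (h : R -> R) C : 0 < u -> measurable_fun setT h ->
  (forall s, `|h s| <= C * env u s) ->
  mu.-integrable setT (EFin \o (fun s => gs u s * h s)).
Proof.
move=> u0 mh hC.
have u20 : 0 < Num.sqrt 2 * u by rewrite mulr_gt0// sqrtr_gt0.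
have Ig := @integrableZl _ _ _ mu setT measurableT (C * Num.sqrt 2) _
  (integrable_gs u20).
apply: le_integrable Ig => //.
  apply/measurable_EFinP; apply: measurable_funM => //; exact: measurable_gs.
move=> s _ /=; rewrite lee_fin normrM (ger0_norm (gs_ge0 _ u0)).
apply: (@le_trans _ _ (gs u s * (C * env u s))); first by rewrite ler_wpM2l ?gs_ge0.
rewrite mulrCA gs_env// mulrA; exact: ler_norm.
Qed.

Lemma integrable_gs_envelope u : 0 < u ->
  mu.-integrable setT (EFin \o (fun s => gs u s * env u s)).
Proof.
move=> u0; apply: (@integrable_gs_env _ _ 1) => //; first exact: measurable_env.
by move=> y; rewrite mul1r ger0_norm// expR_ge0.
Qed.

Lemma integrable_gs_pow u (k : nat) : (k <= 12)%N -> 0 < u ->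
  mu.-integrable setT (EFin \o (fun s => gs u s * s ^+ k)).
Proof.
move=> k12 u0; apply: (@integrable_gs_env _ _ (cenv R * u ^+ k)) => //.
by move=> s; rewrite normrX; exact: pow_le_env.
Qed.

Lemma Rintegral_gs_env u : 0 < u -> \int[mu]_s (gs u s * env u s) = Num.sqrt 2.
Proof.
move=> u0; under eq_Rintegral do rewrite gs_env//.
have u20 : 0 < Num.sqrt 2 * u by rewrite mulr_gt0// sqrtr_gt0.
rewrite RintegralZl//; last exact: integrable_gs.
by rewrite Rintegral_gs// mulr1.
Qed.

Lemma cvg_tail0 u : 0 < u -> tail0 u a @[a --> +oo] --> (0 : R).
Proof.
move=> u0.
have H : erf (a / (2 * u)) @[a --> +oo] --> (1 : R).
  apply: (cvg_comp _ _ _ (@cvg_erf R)).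
  by apply: gt0_cvgMly; [rewrite invr_gt0 mulr_gt0|exact: cvg_id].
rewrite (_ : 0 = (1 - 1) / 2 :> R); last by rewrite subrr mul0r.
by apply: cvgMl; apply: cvgB => //; exact: cvg_cst.
Qed.

Lemma cvg_tail1 u : 0 < u -> tail1 u a @[a --> +oo] --> (0 : R).
Proof.
move=> u0; rewrite -(mulr0 (2 * u ^+ 2)); apply: cvgMr.
have := @cvg_pow_gs R 0 u isT u0.
by under eq_fun do rewrite expr0 mul1r.
Qed.

Lemma cvg_tail2 u : 0 < u -> tail2 u a @[a --> +oo] --> (0 : R).
Proof.
move=> u0; rewrite (_ : 0 = 2 * u ^+ 2 * 0 + 2 * u ^+ 2 * 0 :> R); last by ring.
apply: cvgD; apply: cvgMr; first exact: cvg_tail0.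
exact: (@cvg_pow_gs R 1 u isT u0).
Qed.

Lemma cvg_tail4 u : 0 < u -> tail4 u a @[a --> +oo] --> (0 : R).
Proof.
move=> u0; rewrite (_ : 0 = 2 * u ^+ 2 * 0 + 6 * u ^+ 2 * 0 :> R); last by ring.
apply: cvgD; apply: cvgMr; last exact: cvg_tail2.
exact: (@cvg_pow_gs R 3 u isT u0).
Qed.

Lemma continuous_gs_pow u k : 0 < u -> continuous (fun s => gs u s * s ^+ k).
Proof.
move=> u0 s; apply: cvgM; first exact: continuous_gs.
exact: exprn_continuous.
Qed.

Lemma Rintegral_tail0 u a : 0 < u -> \int[mu]_(s in `[a, +oo[) gs u s = tail0 u a.
Proof.
move=> u0; apply: integral_tail.
- by move=> x _; exact: gs_ge0.
- exact: continuous_gs.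
- by move=> x; exact: is_derive_tail0.
- exact: cvg_tail0.
Qed.

(** The integrand [(s - a) * gs u s] has a sign on the half-line, [s * gs u s]
    does not. *)
Lemma Rintegral_tail1 u a : 0 < u ->
  \int[mu]_(s in `[a, +oo[) (gs u s * s) = tail1 u a.
Proof.
move=> u0.
have E : \int[mu]_(s in `[a, +oo[) (gs u s * (s - a)) = tail1 u a - a * tail0 u a.
  apply: (@integral_tail _ (fun x => tail1 u x - a * tail0 u x)).
  - by move=> x ax; rewrite mulr_ge0 ?gs_ge0// subr_ge0.
  - move=> x; apply: cvgM; first exact: continuous_gs.
    by apply: cvgB; [exact: cvg_id|exact: cvg_cst].
  - move=> x; have d1 := @is_derive_tail1 R u x u0.
    have d0 := @is_derive_tail0 R u x u0.
    by apply: is_derive_eq; rewrite /GRing.scale/=; ring.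
  - rewrite (_ : 0 = 0 - a * 0 :> R); last by ring.
    by apply: cvgB; [exact: cvg_tail1|apply: cvgMr; exact: cvg_tail0].
have I0 : mu.-integrable `[a, +oo[ (EFin \o gs u).
  by apply: integrableS (integrable_gs u0).
have I1 : mu.-integrable `[a, +oo[ (EFin \o (fun s => gs u s * s)).
  by apply: integrableS (@integrable_gs_pow u 1 isT u0).
have Ia : mu.-integrable `[a, +oo[ (EFin \o (fun s => a * gs u s)).
  by apply: (@integrableZl _ _ _ mu _ _ a _ I0).
have : \int[mu]_(s in `[a, +oo[) (gs u s * s - a * gs u s) =
       tail1 u a - a * tail0 u a.
  by rewrite -E; apply: eq_Rintegral => s _; ring.
by rewrite RintegralB// RintegralZl// Rintegral_tail0// => /addIr.
Qed.

Lemma Rintegral_tail2 u a : 0 < u ->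
  \int[mu]_(s in `[a, +oo[) (gs u s * s ^+ 2) = tail2 u a.
Proof.
move=> u0; apply: integral_tail.
- by move=> x _; rewrite mulr_ge0 ?gs_ge0// sqr_ge0.
- exact: continuous_gs_pow.
- by move=> x; rewrite mulrC; exact: is_derive_tail2.
- exact: cvg_tail2.
Qed.

Lemma Rintegral_tail4 u a : 0 < u ->
  \int[mu]_(s in `[a, +oo[) (gs u s * s ^+ 4) = tail4 u a.
Proof.
move=> u0; apply: integral_tail.
- by move=> x _; rewrite mulr_ge0 ?gs_ge0// exprn_even_ge0.
- exact: continuous_gs_pow.
- by move=> x; rewrite mulrC; exact: is_derive_tail4.
- exact: cvg_tail4.
Qed.

Lemma Rintegral_even (f : R -> R) : (forall x, 0 <= f x) -> continuous f ->
  (forall x, f (- x) = f x) -> mu.-integrable setT (EFin \o f) ->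
  \int[mu]_x f x = 2 * \int[mu]_(x in `[0, +oo[) f x.
Proof.
move=> f0 cf fN If; rewrite /Rintegral ge0_symfun_integralT//; last first.
  by move=> x /=; rewrite fN.
rewrite (_ : [set x | _] = `[0, +oo[%classic); last first.
  by apply/seteqP; split => x/=; rewrite in_itv/= andbT.
rewrite fineM//; apply: integrable_fin_num => //.
exact: integrableS If.
Qed.

Lemma Rintegral_opp (f : R -> R) : mu.-integrable setT (EFin \o f) ->
  \int[mu]_x f (- x) = \int[mu]_x f x.
Proof.
move=> If; apply: (Rintegral_invariant (phi := (-%R : measurableTypeR R -> measurableTypeR R)) _ _ If).2 => //.
exact: lebesgue_measureN.
Qed.

Lemma Rintegral_odd (f : R -> R) : mu.-integrable setT (EFin \o f) ->
  (forall x, f (- x) = - f x) -> \int[mu]_x f x = 0.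
Proof.
move=> If fN; have := Rintegral_opp If.
rewrite (_ : \int[mu]_x f (- x) = \int[mu]_x (-1 * f x)); last first.
  by apply: eq_Rintegral => x _; rewrite fN mulN1r.
rewrite RintegralZl//; lra.
Qed.

Lemma moment2 u : 0 < u -> \int[mu]_s (gs u s * s ^+ 2) = 2 * u ^+ 2.
Proof.
move=> u0; rewrite Rintegral_even//.
- rewrite Rintegral_tail2// /tail2 /tail0 mul0r erf0; by field.
- by move=> x; rewrite mulr_ge0 ?gs_ge0// sqr_ge0.
- exact: continuous_gs_pow.
- by move=> x; rewrite gsN sqrrN.
- exact: integrable_gs_pow.
Qed.

Lemma moment4 u : 0 < u -> \int[mu]_s (gs u s * s ^+ 4) = 12 * u ^+ 4.
Proof.
move=> u0; rewrite Rintegral_even//.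
- rewrite Rintegral_tail4// /tail4 /tail2 /tail0 mul0r erf0; by field.
- by move=> x; rewrite mulr_ge0 ?gs_ge0// exprn_even_ge0.
- exact: continuous_gs_pow.
- by move=> x; rewrite gsN; congr (_ * _); ring.
- exact: integrable_gs_pow.
Qed.

Lemma moment_odd u (k : nat) : (k <= 12)%N -> odd k -> 0 < u ->
  \int[mu]_s (gs u s * s ^+ k) = 0.
Proof.
move=> k12 ok u0; apply: Rintegral_odd; first exact: integrable_gs_pow.
by move=> x; rewrite gsN exprNn -signr_odd ok expr1; ring.
Qed.

End moments.

(** * Rigid motions preserve the measure of the plane *)
Section planar.
Variable R : realType.
Local Notation mu := (@lebesgue_measure R).
Local Notation mm := (@lebesgue_measure R \x @lebesgue_measure R)%E.
Local Notation mR := (measurableTypeR R).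

Definition preserves d (T : measurableType d) (m : set T -> \bar R) (phi : T -> T) :=
  measurable_fun setT phi /\
  forall A, measurable A -> m (phi @^-1` A) = m A.

Lemma preserves_comp d (T : measurableType d) (m : set T -> \bar R) (phi psi : T -> T) :
  preserves m phi -> preserves m psi -> preserves m (phi \o psi).
Proof.
move=> [mphi iphi] [mpsi ipsi]; split; first exact: measurableT_comp.
move=> A mA; rewrite comp_preimage ipsi ?iphi//.
by rewrite -[X in measurable X]setTI; exact: mphi.
Qed.

(** Lebesgue measure is determined by its values on half-open intervals. *)
Lemma preserves_shift (c : R) : preserves mu (fun y : mR => y + c : mR).
Proof.
have ms : measurable_fun setT (fun y : mR => y + c : mR).
  by apply: measurable_funD.
split => // A mA.
apply/esym/(lebesgue_measure_unique (mu := pushforward mu (fun y : mR => y + c : mR))) => //.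
move=> _ [[a b]] _ <-; rewrite /pushforward.
transitivity (mu `]a - c, b - c]%classic); last first.
  congr (mu _); apply/seteqP; split => x /=; rewrite !in_itv/= => /andP[? ?];
    apply/andP; split; lra.
rewrite !lebesgue_measure_itv/= !lte_fin ltrD2r.
by case: ifP => // _; rewrite -!EFinD; congr EFin; lra.
Qed.

(** A vertical shear translates each vertical section. *)
Lemma preserves_vshear (c k : R) :
  preserves mm (fun p : mR * mR => (p.1, p.2 + (c * p.1 + k)) : mR * mR).
Proof.
have ms : measurable_fun setT (fun p : mR * mR => (p.1, p.2 + (c * p.1 + k)) : mR * mR).
  apply/measurable_fun_prod => //; apply: measurable_funD => //.
  apply: measurable_funD => //; exact: measurable_funM.
split => // A mA; rewrite /product_measure1; apply: eq_integral => x _ /=.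
have [_ H] := preserves_shift (c * x + k).
rewrite -(H (xsection A x)); last exact: measurable_xsection.
congr (mu _); apply/seteqP; split => y /=; rewrite /xsection/= !inE//=.
Qed.

Lemma product_measure12 (A : set (mR * mR)) : measurable A ->
  mm A = (\int[mu]_y mu (ysection A y))%E.
Proof.
move=> mA; rewrite (@product_measure_unique _ _ _ _ _ _ _ (mu \x^ mu)%E)//.
by move=> B C mB mC/=; rewrite product_measure2E.
Qed.

Lemma preserves_hshear (c k : R) :
  preserves mm (fun p : mR * mR => (p.1 + (c * p.2 + k), p.2) : mR * mR).
Proof.
have ms : measurable_fun setT (fun p : mR * mR => (p.1 + (c * p.2 + k), p.2) : mR * mR).
  apply/measurable_fun_prod => //; apply: measurable_funD => //.
  apply: measurable_funD => //; exact: measurable_funM.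
split => // A mA; rewrite !product_measure12//; last first.
  by rewrite -[X in measurable X]setTI; exact: ms.
apply: eq_integral => y _ /=.
have [_ H] := preserves_shift (c * y + k).
rewrite -(H (ysection A y)); last exact: measurable_ysection.
congr (mu _); apply/seteqP; split => x /=; rewrite /ysection/= !inE//=.
Qed.

(** A rotation whose matrix is not diagonal is a product of three shears. *)
Lemma preserves_rot (n : R * R) : n.1 ^+ 2 + n.2 ^+ 2 = 1 -> n.1 != 0 ->
  preserves mm (frame (0, 0) n : mR * mR -> mR * mR).
Proof.
move=> n1 n0; pose a := (1 - n.2) / n.1.
have := preserves_comp (preserves_hshear a 0)
  (preserves_comp (preserves_vshear (- n.1) 0) (preserves_hshear a 0)).
rewrite (_ : _ \o _ = frame (0, 0) n)//; apply/funext => -[x y] /=.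
rewrite /frame/= /a !addr0 !add0r; congr (_, _); last by field.
transitivity (x * n.2 + y * ((1 - n.2 ^+ 2) / n.1)); first by field.
by rewrite -n1; field.
Qed.

Lemma preserves_frame (o n : R * R) : n.1 ^+ 2 + n.2 ^+ 2 = 1 ->
  preserves mm (frame o n : mR * mR -> mR * mR).
Proof.
move=> n1.
suff rot : preserves mm (frame (0, 0) n : mR * mR -> mR * mR).
  have := preserves_comp (preserves_comp (preserves_hshear 0 o.1)
     (preserves_vshear 0 o.2)) rot.
  rewrite (_ : _ \o _ = frame o n)//; apply/funext => -[x y] /=.
  by rewrite /frame/=; congr (_, _); ring.
have [n10|] := eqVneq n.1 0; last exact: preserves_rot.
have e1 : ((1 : R), (0 : R)).1 ^+ 2 + ((1 : R), (0 : R)).2 ^+ 2 = 1.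
  by rewrite /=; ring.
(* The half-turn is the square of the quarter-turn, which has three shears. *)
have rot2 := preserves_rot e1 (oner_neq0 R).
move: n1; rewrite n10 expr0n/= add0r => /eqP.
rewrite -(expr1n R 2) eqf_sqr => /orP[|] /eqP n2.
  rewrite (_ : frame _ _ = id); first by split.
  by apply/funext => -[x y]; rewrite /frame/= n10 n2; congr (_, _); ring.
have := preserves_comp rot2 rot2.
rewrite (_ : _ \o _ = frame (0, 0) n)//; apply/funext => -[x y] /=.
by rewrite /frame/= n10 n2; congr (_, _); ring.
Qed.

End planar.

(** * Expansion of the half-line moments around a cut *)
Section growth.
Variable R : realType.

(** The condition on [y] covers both orders of [a] and [b], which avoids a case
    distinction wherever a sign is unknown. *)
Lemma mvt_bound (f f' : R -> R) (B a b : R) :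
  (forall y, a <= y <= b \/ b <= y <= a -> is_derive y (1 : R) f (f' y)) ->
  (forall y, a <= y <= b \/ b <= y <= a -> `|f' y| <= B) ->
  `|f b - f a| <= B * `|b - a|.
Proof.
wlog ab : a b / a <= b.
  move=> H df bf; have [ab|/ltW ba] := leP a b; first exact: H.
  by rewrite distrC [`|b - a|]distrC; apply: H => // y /or_comm; [exact: df|exact: bf].
move=> df bf.
have [y yab ->] : exists2 c, c \in `[a, b] & f b - f a = f' c * (b - a).
  apply: MVT_segment => // [y yab|].
    by apply: df; left; rewrite !(itvP yab).
  apply: derivable_within_continuous => y yab.
  have yab' : a <= y <= b by move: yab; rewrite in_itv.
  by have [] := df y (or_introl yab').
rewrite normrM ler_wpM2r//; apply: bf; left.
by move: yab; rewrite in_itv.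
Qed.

Lemma le_norm_between (h1 h2 y : R) : h2 <= y <= h1 \/ h1 <= y <= h2 ->
  `|y| <= `|h1| + `|h2| /\ forall e, `|h1| <= e -> `|h2| <= e -> `|y| <= e.
Proof.
move=> yh; have key e : `|h1| <= e -> `|h2| <= e -> `|y| <= e.
  rewrite !ler_norml => /andP[? ?] /andP[? ?].
  by case: yh => /andP[? ?]; apply/andP; split; lra.
by split => //; apply: key; rewrite ?lerDl ?lerDr.
Qed.

(** Integrates a remainder estimate: applied repeatedly, starting from a bound
    on the last derivative, it yields Taylor's formula. *)
Lemma growth (f f' : R -> R) (B : R) (k : nat) (x : R) :
  f 0 = 0 -> (forall y : R, `|y| <= `|x| -> is_derive y (1 : R) f (f' y)) ->
  (forall y, `|y| <= `|x| -> `|f' y| <= B * `|y| ^+ k) ->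
  `|f x| <= B * `|x| ^+ k.+1.
Proof.
move=> f0 df bf.
have B0 : 0 <= B * `|x| ^+ k by apply: le_trans (bf _ (lexx _)).
have yx y : 0 <= y <= x \/ x <= y <= 0 -> `|y| <= `|x|.
  by move=> /le_norm_between[]; rewrite normr0 addr0.
have := @mvt_bound f f' (B * `|x| ^+ k) 0 x.
rewrite f0 !subr0 -mulrA -exprSr; apply => y /yx yle; first exact: df.
apply: (le_trans (bf y yle)); have [->|yN0] := eqVneq y 0.
  by rewrite normr0; case: k {bf} B0 => [|k] //; rewrite expr0n/= mulr0.
have B0' : 0 <= B.
  have := le_trans (normr_ge0 _) (bf y yle).
  by rewrite pmulr_lge0// exprn_gt0// normr_gt0.
by rewrite ler_wpM2l// lerXn2r ?nnegrE.
Qed.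

End growth.

Section expansion.
Variable R : realType.
Implicit Types (a s z u r : R).
Local Notation mu := (@lebesgue_measure R).
Local Notation spi := (Num.sqrt (pi : R)).
Local Notation c := (cenv R).

Lemma spi_ge1 : 1 <= spi.
Proof.
rewrite -[leLHS]sqrtr1 ler_sqrt ?pi_gt0//; have := @pi_ge2 R; lra.
Qed.

Lemma pow_gs_bound k u s : (k <= 12)%N -> 0 < u ->
  `|s| ^+ k * gs u s <= c * u ^+ k / u.
Proof.
move=> k12 u0; apply: (le_trans (pow_gs_le s k12 u0)).
apply: ler_wpM2l; first by rewrite mulr_ge0 ?exprn_ge0 ?ltW// cenv_gt0.
rewrite lef_pV2 ?posrE// ?mulr_gt0// ?spi_gt0//.
have := spi_ge1; have : 0 <= u * (spi - 1) by rewrite mulr_ge0 ?subr_ge0 ?spi_ge1// ltW.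
by nra.
Qed.

Lemma gs_bound0 u s : 0 < u -> `|gs u s| <= c / u.
Proof.
move=> u0; rewrite ger0_norm ?gs_ge0//.
by have := @pow_gs_bound 0 u s isT u0; rewrite !expr0 mul1r mulr1.
Qed.

Lemma gs_bound1 u s : 0 < u -> `|s * gs u s| <= c.
Proof.
move=> u0; rewrite normrM (ger0_norm (gs_ge0 _ u0)).
by have := @pow_gs_bound 1 u s isT u0; rewrite !expr1 mulfK ?gt_eqF.
Qed.

Lemma gs_bound2 u s : 0 < u -> `|s ^+ 2 * gs u s| <= c * u.
Proof.
move=> u0; rewrite normrM (ger0_norm (gs_ge0 _ u0)) normrX.
have := @pow_gs_bound 2 u s isT u0; rewrite [u ^+ 2]expr2 mulrA mulfK//.
by rewrite gt_eqF.
Qed.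

Lemma is_derive_shift (f : R -> R) (r s l : R) : is_derive (r + s) (1 : R) f l ->
  is_derive s (1 : R) (fun y => f (r + y)) l.
Proof.
move=> df; rewrite -[l]mulr1; apply: is_derive1_comp.
by apply: is_derive_eq; rewrite add0r.
Qed.

Section at_point.
Variables (u r : R).
Hypothesis u0 : 0 < u.
Let uN0 : u != 0. Proof. by rewrite gt_eqF. Qed.

(** The estimates below all follow the same pattern: the derivative of a moment is
    a power times [gs u], which is bounded by a power of [u], and [growth] is
    applied once per order.  The constants record the scaling: one factor [1 / u]
    for each derivative. *)
Lemma tail0_exp1 s : `|tail0 u (- r + s) - tail0 u (- r)| <= c / u * `|s|.
Proof.
rewrite -[`|s|]expr1.
apply: (@growth _ (fun s => tail0 u (- r + s) - tail0 u (- r))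
  (fun s => - gs u (- r + s))).
- by rewrite addr0 subrr.
- move=> y _; have d := is_derive_shift (is_derive_tail0 (- r + y) u0).
  by apply: is_derive_eq; rewrite subr0.
- by move=> y _; rewrite expr0 mulr1 normrN gs_bound0.
Qed.

Lemma tail1_exp1 s : `|tail1 u (- r + s) - tail1 u (- r)| <= c * `|s|.
Proof.
rewrite -[`|s|]expr1.
apply: (@growth _ (fun s => tail1 u (- r + s) - tail1 u (- r))
  (fun s => - ((- r + s) * gs u (- r + s)))).
- by rewrite addr0 subrr.
- move=> y _; have d := is_derive_shift (is_derive_tail1 (- r + y) u0).
  by apply: is_derive_eq; rewrite subr0.
- by move=> y _; rewrite expr0 mulr1 normrN gs_bound1.
Qed.

Lemma tail2_exp1 s : `|tail2 u (- r + s) - tail2 u (- r)| <= c * u * `|s|.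
Proof.
rewrite -[`|s|]expr1.
apply: (@growth _ (fun s => tail2 u (- r + s) - tail2 u (- r))
  (fun s => - ((- r + s) ^+ 2 * gs u (- r + s)))).
- by rewrite addr0 subrr.
- move=> y _; have d := is_derive_shift (is_derive_tail2 (- r + y) u0).
  by apply: is_derive_eq; rewrite subr0.
- by move=> y _; rewrite expr0 mulr1 normrN gs_bound2.
Qed.

Lemma gs_exp1 s : `|gs u (- r + s) - gs u r| <= c / u ^+ 2 * `|s|.
Proof.
rewrite -[`|s|]expr1.
apply: (@growth _ (fun s => gs u (- r + s) - gs u r)
  (fun s => - ((- r + s) / (2 * u ^+ 2)) * gs u (- r + s))).
- by rewrite addr0 gsN subrr.
- move=> y _; have d := is_derive_shift (is_derive_gs (- r + y) u0).
  by apply: is_derive_eq; rewrite subr0.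
- move=> y _; rewrite expr0 mulr1 mulNr normrN mulrAC normrM.
  rewrite [X in _ * X]ger0_norm; last by rewrite invr_ge0 mulr_ge0// sqr_ge0.
  apply: (@le_trans _ _ (c / (2 * u ^+ 2))).
    by apply: ler_wpM2r; [rewrite invr_ge0 mulr_ge0// sqr_ge0|exact: gs_bound1].
  apply: ler_wpM2l; first exact/ltW/cenv_gt0.
  rewrite lef_pV2 ?posrE ?mulr_gt0 ?exprn_gt0//.
  by have u2 : 0 < u ^+ 2; [rewrite exprn_gt0|lra].
Qed.

Lemma tail0_exp2 s :
  `|tail0 u (- r + s) - (tail0 u (- r) - gs u r * s)| <= c / u ^+ 2 * s ^+ 2.
Proof.
rewrite -[s ^+ 2]real_normK ?num_real//.
apply: (@growth _ (fun s => tail0 u (- r + s) - (tail0 u (- r) - gs u r * s))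
  (fun s => - (gs u (- r + s) - gs u r))).
- by rewrite addr0 mulr0 subr0 subrr.
- move=> y _; have d := is_derive_shift (is_derive_tail0 (- r + y) u0).
  by apply: is_derive_eq; rewrite /GRing.scale/=; ring.
- by move=> y _; rewrite expr1 normrN gs_exp1.
Qed.

Lemma dgs_exp1 s :
  `|- ((- r + s) / (2 * u ^+ 2)) * gs u (- r + s) - r / (2 * u ^+ 2) * gs u r|
    <= c / u ^+ 3 * `|s|.
Proof.
rewrite -[`|s|]expr1.
apply: (@growth _ (fun s => - ((- r + s) / (2 * u ^+ 2)) * gs u (- r + s)
    - r / (2 * u ^+ 2) * gs u r)
  (fun s => ((- r + s) ^+ 2 / (4 * u ^+ 4) - (2 * u ^+ 2)^-1) * gs u (- r + s))).
- by rewrite addr0 gsN !mulNr opprK subrr.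
- move=> y _; have d := is_derive_shift (is_derive_gs (- r + y) u0).
  by apply: is_derive_eq; rewrite /GRing.scale/=; field.
- move=> y _; rewrite expr0 mulr1 mulrBl.
  apply: (le_trans (ler_normB _ _)).
  have A0 : 0 <= (4 * u ^+ 4)^-1 by rewrite invr_ge0 mulr_ge0// exprn_ge0// ltW.
  have B0 : 0 <= (2 * u ^+ 2)^-1 by rewrite invr_ge0 mulr_ge0// exprn_ge0// ltW.
  have -> : (- r + y) ^+ 2 / (4 * u ^+ 4) * gs u (- r + y) =
    ((- r + y) ^+ 2 * gs u (- r + y)) * (4 * u ^+ 4)^-1 by ring.
  rewrite (normrM _ (4 * u ^+ 4)^-1) (ger0_norm A0).
  rewrite (normrM (2 * u ^+ 2)^-1) (ger0_norm B0).
  have -> : c / u ^+ 3 = c * u * (4 * u ^+ 4)^-1 + (2 * u ^+ 2)^-1 * (c / u) +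
     c / (4 * u ^+ 3) by field.
  rewrite -[leLHS]addr0; apply: lerD; last first.
    by rewrite divr_ge0 ?ltW ?cenv_gt0// mulr_gt0// exprn_gt0.
  apply: lerD; first by apply: ler_wpM2r => //; exact: gs_bound2.
  by apply: ler_wpM2l => //; exact: gs_bound0.
Qed.

Lemma gs_exp2 s :
  `|gs u (- r + s) - gs u r - r / (2 * u ^+ 2) * gs u r * s|
    <= c / u ^+ 3 * s ^+ 2.
Proof.
rewrite -[s ^+ 2]real_normK ?num_real//.
apply: (@growth _ (fun s => gs u (- r + s) - gs u r - r / (2 * u ^+ 2) * gs u r * s)
  (fun s => - ((- r + s) / (2 * u ^+ 2)) * gs u (- r + s) - r / (2 * u ^+ 2) * gs u r)).
- by rewrite addr0 mulr0 subr0 gsN subrr.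
- move=> y _; have d := is_derive_shift (is_derive_gs (- r + y) u0).
  by apply: is_derive_eq; rewrite /GRing.scale/=; ring.
- by move=> y _; rewrite expr1 dgs_exp1.
Qed.

Lemma tail0_exp3 s :
  `|tail0 u (- r + s) -
    (tail0 u (- r) - gs u r * s - r / (4 * u ^+ 2) * gs u r * s ^+ 2)|
    <= c / u ^+ 3 * `|s| ^+ 3.
Proof.
apply: (@growth _ (fun s => tail0 u (- r + s) -
    (tail0 u (- r) - gs u r * s - r / (4 * u ^+ 2) * gs u r * s ^+ 2))
  (fun s => - (gs u (- r + s) - gs u r - r / (2 * u ^+ 2) * gs u r * s))).
- by rewrite addr0 expr0n/= !mulr0 !subr0 subrr.
- move=> y _; have d := is_derive_shift (is_derive_tail0 (- r + y) u0).
  by apply: is_derive_eq; rewrite /GRing.scale/=; field.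
- by move=> y _; rewrite normrN real_normK ?num_real// gs_exp2.
Qed.

Lemma sgs_exp1 s :
  `|(- r + s) * gs u (- r + s) + r * gs u r| <= 2 * c / u * `|s|.
Proof.
rewrite -[`|s|]expr1.
apply: (@growth _ (fun s => (- r + s) * gs u (- r + s) + r * gs u r)
  (fun s => gs u (- r + s) - (- r + s) ^+ 2 * gs u (- r + s) * (2 * u ^+ 2)^-1)).
- by rewrite addr0 gsN mulNr addNr.
- move=> y _; have d := is_derive_shift (is_derive_gs (- r + y) u0).
  by apply: is_derive_eq; rewrite /GRing.scale/=; field.
- move=> y _; rewrite expr0 mulr1; apply: (le_trans (ler_normB _ _)).
  have -> : 2 * c / u = c / u + c * u * (2 * u ^+ 2)^-1 + c / (2 * u) by field.
  rewrite -[leLHS]addr0; apply: lerD; last first.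
    by rewrite divr_ge0 ?ltW ?cenv_gt0// mulr_gt0.
  apply: lerD; first exact: gs_bound0.
  have B0 : 0 <= (2 * u ^+ 2)^-1 by rewrite invr_ge0 mulr_ge0// exprn_ge0// ltW.
  rewrite normrM (ger0_norm B0).
  by apply: ler_wpM2r => //; exact: gs_bound2.
Qed.

Lemma tail1_exp2 s :
  `|tail1 u (- r + s) - (tail1 u (- r) + r * gs u r * s)| <= 2 * c / u * s ^+ 2.
Proof.
rewrite -[s ^+ 2]real_normK ?num_real//.
apply: (@growth _ (fun s => tail1 u (- r + s) - (tail1 u (- r) + r * gs u r * s))
  (fun s => - ((- r + s) * gs u (- r + s) + r * gs u r))).
- by rewrite addr0 mulr0 addr0 subrr.
- move=> y _; have d := is_derive_shift (is_derive_tail1 (- r + y) u0).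
  by apply: is_derive_eq; rewrite /GRing.scale/=; ring.
- by move=> y _; rewrite expr1 normrN sgs_exp1.
Qed.

End at_point.
End expansion.

(** Bounds the norm of a sum term by term, leaving one goal for each term. *)
Ltac split_norm_sum :=
  first [ apply: (le_trans (ler_normD _ _)); apply: lerD; [split_norm_sum|]
        | idtac ].

(** * One column above a cubic graph *)
Section column.
Variable R : realType.
Implicit Types (a s u r : R).
Local Notation c := (cenv R).

Lemma le_normM (x y X Y : R) : `|x| <= X -> `|y| <= Y -> `|x * y| <= X * Y.
Proof. by move=> hx hy; rewrite normrM ler_pM. Qed.

Section powers.
Variables (u x0 : R).
Hypothesis u01 : 0 < u <= 1.
Let u0 : 0 < u. Proof. by case/andP: u01. Qed.
Let uN0 : u != 0. Proof. by rewrite gt_eqF. Qed.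
Let x := `|x0|.

(** As [u <= 1], higher powers of [x] may be charged to a lower power of [u]. *)
Lemma pow_le_env_scale (j k : nat) : (k <= j)%N -> (j <= 12)%N ->
  x ^+ j <= c * u ^+ k * env u x0.
Proof.
move=> kj j12; apply: (le_trans (pow_le_env x0 j12 u0)).
rewrite ler_wpM2r ?(le_trans ler01 (env_ge1 _ _))// ler_wpM2l ?(ltW (cenv_gt0 R))//.
by case/andP: u01 => _ u1; rewrite ler_wiXn2l// ltW.
Qed.

Variables (M s : R).
Hypothesis M0 : 0 <= M.
Hypothesis sM : `|s| <= M * (x ^+ 2 + x ^+ 3).
Let q k : R := c * u ^+ k * env u x0.
Let x_ge0 : 0 <= x. Proof. exact: normr_ge0. Qed.

(** The displacement [s] of the cut is of second order in [x]: each factor [s]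
    counts for two powers of [u]. *)
Lemma cubic1 i : (i <= 2)%N -> x ^+ i * `|s| <= 2 * M * q (2 + i).
Proof.
move=> i2; apply: (@le_trans _ _ (M * (x ^+ (2 + i) + x ^+ (3 + i)))).
  have -> : M * (x ^+ (2 + i) + x ^+ (3 + i)) = x ^+ i * (M * (x ^+ 2 + x ^+ 3)).
    by rewrite !exprD; ring.
  by rewrite ler_wpM2l// exprn_ge0.
have -> : 2 * M * q (2 + i) = M * (q (2 + i) + q (2 + i)) by ring.
rewrite ler_wpM2l// lerD// pow_le_env_scale// ?leq_add2r//.
  by case: i i2 => [|[|[]]].
by case: i i2 => [|[|[]]].
Qed.

Lemma cubic2 i : (i <= 1)%N -> x ^+ i * s ^+ 2 <= 4 * M ^+ 2 * q (4 + i).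
Proof.
move=> i1; rewrite -[s ^+ 2]real_normK ?num_real//.
apply: (@le_trans _ _ (M ^+ 2 * (x ^+ (4 + i) + 2 * x ^+ (5 + i) + x ^+ (6 + i)))).
  have -> : M ^+ 2 * (x ^+ (4 + i) + 2 * x ^+ (5 + i) + x ^+ (6 + i)) =
     x ^+ i * (M * (x ^+ 2 + x ^+ 3)) ^+ 2 by rewrite !exprD; ring.
  rewrite ler_wpM2l ?exprn_ge0// lerXn2r ?nnegrE//.
  by rewrite mulr_ge0// addr_ge0// exprn_ge0.
have -> : 4 * M ^+ 2 * q (4 + i) = M ^+ 2 * (q (4 + i) + 2 * q (4 + i) + q (4 + i)).
  by ring.
rewrite ler_wpM2l ?sqr_ge0//.
by apply: lerD; [apply: lerD|]; rewrite ?ler_wpM2l// pow_le_env_scale//;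
  case: i i1 => [|[]].
Qed.

Lemma cubic3 : `|s| ^+ 3 <= 8 * M ^+ 3 * q 6.
Proof.
apply: (@le_trans _ _ (M ^+ 3 * (x ^+ 6 + 3 * x ^+ 7 + 3 * x ^+ 8 + x ^+ 9))).
  have -> : M ^+ 3 * (x ^+ 6 + 3 * x ^+ 7 + 3 * x ^+ 8 + x ^+ 9) =
     (M * (x ^+ 2 + x ^+ 3)) ^+ 3 by ring.
  rewrite lerXn2r ?nnegrE//.
  by rewrite mulr_ge0// addr_ge0// exprn_ge0.
have -> : 8 * M ^+ 3 * q 6 = M ^+ 3 * (q 6 + 3 * q 6 + 3 * q 6 + q 6) by ring.
rewrite ler_wpM2l ?exprn_ge0//.
by apply: lerD; [apply: lerD; [apply: lerD|]|]; rewrite ?ler_wpM2l// pow_le_env_scale.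
Qed.

End powers.

Definition jet (f0 fx fy fxx fxy fyy x y : R) : R :=
  f0 + fx * x + fy * y + fxx / 2 * x ^+ 2 + fxy * x * y + fyy / 2 * y ^+ 2.

(** The part of the column integral at abscissa [x] that contributes below the
    order of the remainder, as a polynomial in [x]. *)
Definition column (u r al be f0 fx fy fxx fxy fyy x : R) : R :=
  (f0 + fx * x + fxx / 2 * x ^+ 2) * tail0 u (- r) +
  (fy + fxy * x) * tail1 u (- r) + fyy / 2 * tail2 u (- r) -
  gs u r * (f0 * (al * x ^+ 2 + be * x ^+ 3 + r / (4 * u ^+ 2) * al ^+ 2 * x ^+ 4)
            - r * fy * al * x ^+ 2 + fx * al * x ^+ 3).

(** Only [M] enters: this is what makes the final estimate uniform in the point
    of the boundary. *)
Definition Kcol M : R :=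
  M * (8 * M ^+ 3) * c ^+ 2 + 3 / 4 * M ^+ 3 * c ^+ 2 + 4 * M ^+ 3 * c ^+ 2 +
  M ^+ 2 * c ^+ 2 + M ^+ 2 * c ^+ 2 + 8 * M ^+ 3 * c ^+ 2 +
  M ^+ 2 * c ^+ 2 + 2 * M ^+ 2 * c ^+ 2 + M ^+ 2 * c ^+ 2.

(** Expanding each moment to the order at which the discarded terms, multiplied
    by the power of [x] in front of them, become of order [u ^+ 3]. *)
Lemma column_expansion u r al be f0 fx fy fxx fxy fyy M x0 :
  0 < u <= 1 -> `|al| <= M -> `|be| <= M ->
  `|f0| <= M -> `|fx| <= M -> `|fy| <= M -> `|fxx| <= M -> `|fxy| <= M ->
  `|fyy| <= M ->
  let s := al * x0 ^+ 2 + be * x0 ^+ 3 in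
  `| (f0 + fx * x0 + fxx / 2 * x0 ^+ 2) * tail0 u (- r + s) +
     (fy + fxy * x0) * tail1 u (- r + s) + fyy / 2 * tail2 u (- r + s) -
     column u r al be f0 fx fy fxx fxy fyy x0 |
  <= Kcol M * u ^+ 3 * env u x0.
Proof.
move=> u01 alM beM f0M fxM fyM fxxM fxyM fyyM.
cbv zeta; set s := al * x0 ^+ 2 + be * x0 ^+ 3.
have u0 : 0 < u by case/andP: u01.
have uN0 : u != 0 by rewrite gt_eqF.
have M0 : 0 <= M by exact: le_trans alM.
have sM : `|s| <= M * (`|x0| ^+ 2 + `|x0| ^+ 3).
  rewrite mulrDr; apply: (le_trans (ler_normD _ _)).
  by apply: lerD; apply: le_normM => //; rewrite normrX.
have s1 := cubic1 u01 M0 sM; have s2 := cubic2 u01 M0 sM.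
have s3 := cubic3 u01 M0 sM.
set E := env u x0 in s1 s2 s3 *.
have c0 : 0 < c := cenv_gt0 R.
have xk := pow_le_env_scale x0 u01.
have half (y : R) : `|y| <= M -> `|y / 2| <= M / 2.
  by move=> yM; rewrite normrM [`|2^-1|]ger0_norm// ler_wpM2r.
pose e0 := tail0 u (- r + s) -
    (tail0 u (- r) - gs u r * s - r / (4 * u ^+ 2) * gs u r * s ^+ 2).
pose e0' := tail0 u (- r + s) - (tail0 u (- r) - gs u r * s).
pose e0'' := tail0 u (- r + s) - tail0 u (- r).
pose e1 := tail1 u (- r + s) - (tail1 u (- r) + r * gs u r * s).
pose e1' := tail1 u (- r + s) - tail1 u (- r).
pose e2 := tail2 u (- r + s) - tail2 u (- r).
(* The nine terms are the remainders of the moments and the products of the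
   quadratic and cubic parts of [s] that exceed the third order. *)
have -> : (f0 + fx * x0 + fxx / 2 * x0 ^+ 2) * tail0 u (- r + s) +
     (fy + fxy * x0) * tail1 u (- r + s) + fyy / 2 * tail2 u (- r + s) -
     column u r al be f0 fx fy fxx fxy fyy x0 =
  f0 * e0 + (- f0 * ((r * gs u r) * ((2 * al * be * x0 ^+ 5 + be ^+ 2 * x0 ^+ 6) / (4 * u ^+ 2))))
  + fx * (x0 * e0') + (- fx * (gs u r * (be * x0 ^+ 4)))
  + fxx / 2 * (x0 ^+ 2 * e0'') + fy * e1 + fy * ((r * gs u r) * (be * x0 ^+ 3))
  + fxy * (x0 * e1') + fyy / 2 * e2.
  by rewrite /e0 /e0' /e0'' /e1 /e1' /e2 /column /s; field.
have -> : Kcol M * u ^+ 3 * E =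
   M * (c / u ^+ 3 * (8 * M ^+ 3 * (c * u ^+ 6 * E))) +
   M * (c * (3 * M ^+ 2 * (c * u ^+ 5 * E) / (4 * u ^+ 2))) +
   M * (c / u ^+ 2 * (4 * M ^+ 2 * (c * u ^+ 5 * E))) +
   M * (c / u * (M * (c * u ^+ 4 * E))) +
   M / 2 * (c / u * (2 * M * (c * u ^+ 4 * E))) +
   M * (2 * c / u * (4 * M ^+ 2 * (c * u ^+ 4 * E))) +
   M * (c * (M * (c * u ^+ 3 * E))) +
   M * (c * (2 * M * (c * u ^+ 3 * E))) +
   M / 2 * (c * u * (2 * M * (c * u ^+ 2 * E))).
  by rewrite /Kcol; field.
have cu k : 0 <= c / u ^+ k by rewrite divr_ge0 ?exprn_ge0// ltW.
split_norm_sum.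
- apply: le_normM => //; apply: (le_trans (tail0_exp3 r u0 s)).
  by rewrite ler_wpM2l.
- rewrite mulNr normrN; apply: le_normM => //; apply: le_normM; first exact: gs_bound1.
  have v0 : 0 <= (4 * u ^+ 2)^-1 by rewrite invr_ge0 mulr_ge0// sqr_ge0.
  rewrite normrM (ger0_norm v0) ler_wpM2r//.
  apply: (le_trans (ler_normD _ _)).
  have -> : 3 * M ^+ 2 * (c * u ^+ 5 * E) = 2 * M * M * (c * u ^+ 5 * E)
     + M ^+ 2 * (c * u ^+ 5 * E) by ring.
  apply: lerD; apply: le_normM; rewrite ?normrX ?xk//.
    by apply: le_normM => //; apply: le_normM => //; rewrite ger0_norm.
  by rewrite lerXn2r ?nnegrE.
- apply: le_normM => //; rewrite normrM.
  apply: (@le_trans _ _ (`|x0| * (c / u ^+ 2 * s ^+ 2))).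
    by rewrite ler_wpM2l// tail0_exp2.
  by rewrite mulrCA ler_wpM2l//; have := s2 1%N isT; rewrite expr1.
- rewrite mulNr normrN; apply: le_normM => //; apply: le_normM; first exact: gs_bound0.
  by apply: le_normM => //; rewrite normrX xk.
- apply: le_normM; first exact: half.
  rewrite normrM normrX.
  apply: (@le_trans _ _ (`|x0| ^+ 2 * (c / u * `|s|))).
    by rewrite ler_wpM2l ?exprn_ge0// tail0_exp1.
  by rewrite mulrCA ler_wpM2l ?s1//; have := cu 1%N.
- apply: le_normM => //; apply: (le_trans (tail1_exp2 r u0 s)).
  apply: ler_wpM2l; first by rewrite divr_ge0 ?mulr_ge0// ltW.
  by have := s2 0%N isT; rewrite mul1r.
- apply: le_normM => //; apply: le_normM; first exact: gs_bound1.
  by apply: le_normM => //; rewrite normrX xk.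
- apply: le_normM => //; rewrite normrM.
  apply: (@le_trans _ _ (`|x0| * (c * `|s|))).
    by rewrite ler_wpM2l// tail1_exp1.
  rewrite mulrCA ler_wpM2l ?(ltW c0)//.
  by have := s1 1%N isT; rewrite expr1.
- apply: le_normM; first exact: half.
  apply: (le_trans (tail2_exp1 r u0 s)).
  apply: ler_wpM2l; first by rewrite mulr_ge0// ltW.
  by have := s1 0%N isT; rewrite mul1r.
Qed.

End column.

Section plane_integral.
Variable R : realType.
Implicit Types (a s u r : R).
Local Notation c := (cenv R).
Local Notation mu := (@lebesgue_measure R).
Local Notation mm := (@lebesgue_measure R \x @lebesgue_measure R)%E.
Local Notation mR := (measurableTypeR R).

(** The integrability of every section, and not only of almost every one, keeps
    the iterated integral free of infinite values. *)
Lemma Rintegral_Fubini (h : mR * mR -> R) :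
  mm.-integrable setT (EFin \o h) ->
  (forall x, mu.-integrable setT (EFin \o (fun y => h (x, y)))) ->
  mu.-integrable setT (EFin \o (fun x => \int[mu]_y h (x, y))) /\
  \int[mm]_p h p = \int[mu]_x \int[mu]_y h (x, y).
Proof.
move=> Ih Ix.
have E : EFin \o (fun x => \int[mu]_y h (x, y)) = fubini_F mu (EFin \o h).
  apply/funext => x; rewrite /= /fubini_F /Rintegral fineK//.
  exact: (integrable_fin_num _ (Ix x)).
split; first by rewrite E; exact: integrable_fubini_F.
rewrite /Rintegral -(integral12_prod_meas1 Ih); congr fine.
by apply: eq_integral => x _; rewrite -E.
Qed.

Lemma integrable_gs2 u (h : mR * mR -> R) C : 0 < u -> measurable_fun setT h ->
  (forall p, `|h p| <= C * env u p.1 * env u p.2) ->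
  mm.-integrable setT (EFin \o (fun p => gs u p.1 * gs u p.2 * h p)).
Proof.
move=> u0 mh hC.
pose k (p : mR * mR) := gs u p.1 * gs u p.2 * h p.
have mg : measurable_fun setT k.
  apply: measurable_funM => //; apply: measurable_funM.
    by apply: (measurableT_comp (@measurable_gs R u)).
  by apply: (measurableT_comp (@measurable_gs R u)).
apply/integrable12ltyP; first exact/measurable_EFinP.
have B x : (\int[mu]_y `|(EFin \o k) (x, y)| <=
    (gs u x * env u x * (C * Num.sqrt 2))%R%:E)%E.
  have Ie := integrable_gs_envelope u0.
  have <- : (\int[mu]_y ((gs u x * env u x * C)%R%:E * (gs u y * env u y)%R%:E) =
      (gs u x * env u x * (C * Num.sqrt 2))%R%:E)%E.
    rewrite integralZl// mulrA [in RHS]EFinM; congr (_ * _)%E.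
    rewrite -(@Rintegral_gs_env R u u0) /Rintegral fineK//.
    exact: integrable_fin_num.
  apply: ge0_le_integral => //.
  - apply/measurable_EFinP; apply: measurableT_comp => //.
    by apply: (measurableT_comp mg).
  - apply/measurable_EFinP; apply: measurable_funM => //.
    by apply: measurable_funM; [exact: measurable_gs|exact: measurable_env].
  - move=> y _; rewrite -EFinM /= lee_fin /k /= normrM (ger0_norm (mulr_ge0 (gs_ge0 x u0) (gs_ge0 y u0))).
    have -> : gs u x * env u x * C * (gs u y * env u y) =
      gs u x * gs u y * (C * env u x * env u y) by ring.
    by apply: ler_wpM2l; [rewrite mulr_ge0 ?gs_ge0|exact: (hC (x, y))].
have Ie := integrable_gs_envelope u0.
apply: (@le_lt_trans _ _ (\int[mu]_x (gs u x * env u x * (C * Num.sqrt 2))%R%:E)%E).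
  apply: ge0_le_integral => //.
  - by move=> x _; exact: integral_ge0.
  - apply: (measurable_fun_fubini_tonelli_F (fun p : mR * mR => `|(EFin \o k) p|)%E) => //.
    by apply: measurableT_comp => //; exact/measurable_EFinP.
  - apply/measurable_EFinP; apply: measurable_funM => //.
    by apply: measurable_funM; [exact: measurable_gs|exact: measurable_env].
under eq_integral do rewrite EFinM.
rewrite integralZr//; set I := (\int[mu]_x _)%E.
have -> : I = (fine I)%:E by rewrite fineK//; exact: integrable_fin_num Ie.
by rewrite -EFinM ltry.
Qed.

Lemma Rintegral_gs_itv u a b : 0 < u -> a <= b ->
  \int[mu]_(s in `[a, b]) gs u s <= c / u * (b - a).
Proof.
move=> u0 ab.
have -> : c / u * (b - a) = \int[mu]_(s in `[a, b]) (c / u).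
  rewrite Rintegral_cst//= lebesgue_measure_itv/= lte_fin.
  move: ab; rewrite le_eqVlt => /predU1P[->|->]//.
  by rewrite ltxx subrr.
apply: le_Rintegral => //.
- by apply: integrableS (integrable_gs u0).
- by apply: continuous_compact_integrable; [exact: segment_compact|
    apply: continuous_subspaceT => x; exact: cvg_cst].
- by move=> x _; rewrite -[leLHS]ger0_norm ?gs_ge0// gs_bound0.
Qed.

(** The layer of half-width [w] around the cut is where the column is not known to
    be inside or outside of the domain; its weight is at most its length times
    the maximum of [gs u]. *)
Lemma column_comparison u P w A B t0 t1 t2 (g : R -> R) : 0 < u ->
  0 <= w -> 0 <= A -> 0 <= B ->
  measurable_fun setT g ->
  (forall s, `|g s - (if P <= s then t0 + t1 * s + t2 * s ^+ 2 else 0)| <=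
     A * env u s + B * (if P - w <= s <= P + w then 1 else 0)) ->
  `|\int[mu]_s (gs u s * g s) -
    (t0 * tail0 u P + t1 * tail1 u P + t2 * tail2 u P)| <=
  A * Num.sqrt 2 + B * (c / u * (2 * w)).
Proof.
move=> u0 w0 A0 B0 mg H.
pose T s := t0 + t1 * s + t2 * s ^+ 2.
pose T1 s := if P <= s then T s else 0.
pose Z s : R := if P - w <= s <= P + w then 1 else 0.
have TE : T1 = T \_ `[P, +oo[.
  by apply/funext => s; rewrite /T1 patchE mem_setE in_itv/= andbT.
have ZE : Z = (fun _ : R => 1 : R) \_ `[P - w, P + w].
  by apply/funext => s; rewrite /Z patchE mem_setE in_itv/=.
have mT : measurable_fun setT T.
  by apply: measurable_funD; [apply: measurable_funD|]; repeat (apply: measurable_funM => //).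
have mT1 : measurable_fun setT T1.
  by rewrite TE; apply/(measurable_restrictT _ _).1 => //; exact: measurable_funTS.
have mZ : measurable_fun setT Z.
  by rewrite ZE; apply/(measurable_restrictT _ _).1.
pose CT := `|t0| * c + `|t1| * (c * u) + `|t2| * (c * u ^+ 2).
have TC s : `|T1 s| <= CT * env u s.
  have E0 : 0 <= env u s by exact: expR_ge0.
  have CT0 : 0 <= CT.
    have c0 := ltW (cenv_gt0 R); have u0' := ltW u0.
    by apply: addr_ge0; [apply: addr_ge0|]; repeat (apply: mulr_ge0 => //); rewrite exprn_ge0.
  rewrite /T1; case: ifP => _; last by rewrite normr0 mulr_ge0.
  have -> : CT * env u s = `|t0| * (c * env u s) + `|t1| * (c * u * env u s) +
      `|t2| * (c * u ^+ 2 * env u s) by rewrite /CT; ring.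
  rewrite /T; split_norm_sum.
  - rewrite ler_peMr//; have := @pow_le_env R 0 u s isT u0.
    by rewrite !expr0 mulr1.
  - rewrite normrM ler_wpM2l//.
    by have := @pow_le_env R 1 u s isT u0; rewrite !expr1.
  - rewrite normrM ler_wpM2l// normrX.
    exact: pow_le_env.
have IT : mu.-integrable setT (EFin \o (fun s => gs u s * T1 s)).
  exact: integrable_gs_env TC.
have Ienv := integrable_gs_envelope u0.
have IZ : mu.-integrable setT (EFin \o (fun y => gs u y * Z y)).
  apply: (@integrable_gs_env _ _ _ 1) => //.
  move=> y; rewrite mul1r /Z; case: ifP => _; rewrite ?normr1 ?normr0 ?env_ge1//.
  exact: expR_ge0.
have gC s : `|g s| <= (A + B + CT) * env u s.
  have -> : g s = (g s - T1 s) + T1 s by rewrite subrK.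
  apply: (le_trans (ler_normD _ _)); rewrite mulrDl lerD//.
  apply: (le_trans (H s)); rewrite mulrDl lerD//.
  rewrite ler_wpM2l//; case: ifP => _; first exact: env_ge1.
  exact: expR_ge0.
have Ig : mu.-integrable setT (EFin \o (fun s => gs u s * g s)).
  exact: integrable_gs_env gC.
have -> : t0 * tail0 u P + t1 * tail1 u P + t2 * tail2 u P =
    \int[mu]_s (gs u s * T1 s).
  have SI : forall h, mu.-integrable setT (EFin \o h) -> mu.-integrable `[P, +oo[ (EFin \o h).
    by move=> h Ih; apply: integrableS Ih.
  rewrite -(Rintegral_tail0 P u0) -(Rintegral_tail1 P u0) -(Rintegral_tail2 P u0).
  have I0 := SI _ (integrable_gs u0).
  have I1 := SI _ (@integrable_gs_pow R u 1 isT u0).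
  have I2 := SI _ (@integrable_gs_pow R u 2 isT u0).
  have J0 : mu.-integrable `[P, +oo[ (EFin \o (fun s => t0 * gs u s)).
    exact: (@integrableZl _ _ _ mu _ _ t0 _ I0).
  have J1 : mu.-integrable `[P, +oo[ (EFin \o (fun s => t1 * (gs u s * s))).
    exact: (@integrableZl _ _ _ mu _ _ t1 _ I1).
  have J2 : mu.-integrable `[P, +oo[ (EFin \o (fun s => t2 * (gs u s * s ^+ 2))).
    exact: (@integrableZl _ _ _ mu _ _ t2 _ I2).
  rewrite -!RintegralZl// -RintegralD// -RintegralD//; last by apply: (integrableD _ J0 J1).
  rewrite Rintegral_mkcond; apply: eq_Rintegral => s _.
  rewrite TE !patchE; case: ifP => _; first by rewrite /T; ring.
  by rewrite -[point]/(0 : R) mulr0.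
rewrite -RintegralB//.
have Idiff : mu.-integrable setT (EFin \o (fun s => gs u s * g s - gs u s * T1 s)).
  exact: (integrableB _ Ig IT).
have IA : mu.-integrable setT (EFin \o (fun s => A * (gs u s * env u s))).
  exact: (@integrableZl _ _ _ mu _ _ A _ Ienv).
have IB : mu.-integrable setT (EFin \o (fun s => B * (gs u s * Z s))).
  exact: (@integrableZl _ _ _ mu _ _ B _ IZ).
have IAB : mu.-integrable setT
    (EFin \o (fun s => A * (gs u s * env u s) + B * (gs u s * Z s))).
  exact: (integrableD _ IA IB).
apply: (le_trans (le_normr_Rintegral _ Idiff)) => //.
apply: (@le_trans _ _ (\int[mu]_s (A * (gs u s * env u s) + B * (gs u s * Z s)))).
  apply: le_Rintegral => //; first exact: integrable_norm.
  move=> s _; rewrite -mulrBr normrM (ger0_norm (gs_ge0 _ u0)).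
  have -> : A * (gs u s * env u s) + B * (gs u s * Z s) =
    gs u s * (A * env u s + B * Z s) by ring.
  by rewrite ler_wpM2l ?gs_ge0.
rewrite RintegralD// !RintegralZl// Rintegral_gs_env// lerD// ler_wpM2l//.
have -> : \int[mu]_s (gs u s * Z s) = \int[mu]_(s in `[P - w, P + w]) gs u s.
  rewrite [RHS]Rintegral_mkcond; apply: eq_Rintegral => s _.
  by rewrite ZE !patchE; case: ifP => _; rewrite ?mulr1// -[point]/(0 : R) mulr0.
have -> : 2 * w = (P + w) - (P - w) by ring.
by apply: Rintegral_gs_itv => //; lra.
Qed.

End plane_integral.

(** * The heat integral at a fixed time *)
Section region.
Variable R : realType.
Implicit Types (a s u r : R).
Local Notation c := (cenv R).
Local Notation mu := (@lebesgue_measure R).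
Local Notation mm := (@lebesgue_measure R \x @lebesgue_measure R)%E.
Local Notation mR := (measurableTypeR R).

Lemma enorm_ge0 (p : R * R) : 0 <= enorm p.
Proof. exact: sqrtr_ge0. Qed.

Lemma enorm_sqr (p : R * R) : enorm p ^+ 2 = p.1 ^+ 2 + p.2 ^+ 2.
Proof. by rewrite sqr_sqrtr// addr_ge0// sqr_ge0. Qed.

Lemma enorm_le (p : R * R) (a : R) : 0 <= a -> p.1 ^+ 2 + p.2 ^+ 2 <= a ^+ 2 ->
  enorm p <= a.
Proof.
by move=> a0 h; rewrite -(ler_pXn2r (n := 2)) ?nnegrE ?enorm_ge0// enorm_sqr.
Qed.

Lemma enorm_le_sum (p : R * R) : enorm p <= `|p.1| + `|p.2|.
Proof.
apply: enorm_le; first by rewrite addr_ge0.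
rewrite -(real_normK (num_real p.1)) -(real_normK (num_real p.2)).
by have := mulr_ge0 (normr_ge0 p.1) (normr_ge0 p.2); nra.
Qed.

Lemma normr_le_enorm1 (p : R * R) : `|p.1| <= enorm p.
Proof.
rewrite -(ler_pXn2r (n := 2)) ?nnegrE ?enorm_ge0// enorm_sqr.
by rewrite real_normK ?num_real// lerDl sqr_ge0.
Qed.

Lemma normr_le_enorm2 (p : R * R) : `|p.2| <= enorm p.
Proof.
rewrite -(ler_pXn2r (n := 2)) ?nnegrE ?enorm_ge0// enorm_sqr.
by rewrite real_normK ?num_real// lerDr sqr_ge0.
Qed.

Lemma jet_bound (M f0 fx fy fxx fxy fyy x y : R) :
  `|f0| <= M -> `|fx| <= M -> `|fy| <= M -> `|fxx| <= M -> `|fxy| <= M ->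
  `|fyy| <= M ->
  `|jet f0 fx fy fxx fxy fyy x y| <= 2 * M * (1 + (`|x| + `|y|) ^+ 2).
Proof.
move=> f0M fxM fyM fxxM fxyM fyyM.
have M0 : 0 <= M by exact: le_trans f0M.
apply: (@le_trans _ _ (M + M * `|x| + M * `|y| + M / 2 * `|x| ^+ 2 +
   M * `|x| * `|y| + M / 2 * `|y| ^+ 2)).
  rewrite /jet; split_norm_sum => //; repeat apply: le_normM => //;
    by rewrite ?normrX// ger0_norm.
suff H (X Y : R) : 0 <= X -> 0 <= Y ->
    M + M * X + M * Y + M / 2 * X ^+ 2 + M * X * Y + M / 2 * Y ^+ 2 <=
    2 * M * (1 + (X + Y) ^+ 2)  by exact: H.
move=> X0 Y0.
have -> : M + M * X + M * Y + M / 2 * X ^+ 2 + M * X * Y + M / 2 * Y ^+ 2 =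
  M * (1 + (X + Y) + (X + Y) ^+ 2 / 2) by field.
rewrite [2 * M]mulrC -[_ * 2 * _]mulrA ler_wpM2l//.
have := sqr_ge0 (X + Y - 1); nra.
Qed.

Variables (rho M : R).
Hypotheses (rho0 : 0 < rho) (rho1 : rho <= 1) (M0 : 0 <= M).

(** The constants depend on [rho] and [M] only.  The first term of [Alayer] comes
    from the Taylor remainder of [F], the second one from the points at distance
    at least [rho], where [1 <= (enorm p / rho) ^+ 4]. *)
Definition Alayer : R := 16 * M * c + 6 * M * 16 * c / rho ^+ 4.
Definition Kregion : R :=
  (Alayer * Num.sqrt 2 + 24 * M ^+ 2 * c ^+ 2 + Kcol M) * Num.sqrt 2.

Variables (u r al be f0 fx fy fxx fxy fyy : R) (D : set (mR * mR)) (F : mR * mR -> R).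
Hypotheses (u01 : 0 < u <= 1) (alM : `|al| <= M) (beM : `|be| <= M).
Hypotheses (f0M : `|f0| <= M) (fxM : `|fx| <= M) (fyM : `|fy| <= M)
  (fxxM : `|fxx| <= M) (fxyM : `|fxy| <= M) (fyyM : `|fyy| <= M).
Hypotheses (mD : measurable D) (mF : measurable_fun D F).
Let P x := - r + (al * x ^+ 2 + be * x ^+ 3).
Hypothesis DP : forall p : R * R, enorm p < rho ->
  M * p.1 ^+ 4 < `|p.2 - P p.1| -> D p <-> P p.1 < p.2.
Hypothesis FT : forall p : R * R, D p -> enorm p < rho ->
  `|F p - jet f0 fx fy fxx fxy fyy p.1 p.2| <= M * enorm p ^+ 3.
Hypothesis FM : forall p, D p -> `|F p| <= M.

Let u0 : 0 < u. Proof. by case/andP: u01. Qed.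
Let c0 : 0 <= c. Proof. exact/ltW/cenv_gt0. Qed.

Let E p : R := env u p.1 * env u p.2.

Lemma pow_sum_env (p : R * R) k : (k = 3 \/ k = 4)%N ->
  (`|p.1| + `|p.2|) ^+ k <= 16 * c * u ^+ 3 * env u p.1 * env u p.2.
Proof.
move=> k34.
have e1 := env_ge1 u p.1; have e2 := env_ge1 u p.2.
have b1 : `|p.1| ^+ k <= c * u ^+ 3 * (env u p.1 * env u p.2).
  apply: (@le_trans _ _ (c * u ^+ 3 * env u p.1)).
    by apply: (pow_le_env_scale p.1 u01); case: k34 => ->.
  rewrite ler_wpM2l ?mulr_ge0 ?exprn_ge0 ?(ltW u0)//.
  by rewrite ler_peMr// (le_trans ler01).
have b2 : `|p.2| ^+ k <= c * u ^+ 3 * (env u p.1 * env u p.2).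
  apply: (@le_trans _ _ (c * u ^+ 3 * env u p.2)).
    by apply: (pow_le_env_scale p.2 u01); case: k34 => ->.
  rewrite ler_wpM2l ?mulr_ge0 ?exprn_ge0 ?(ltW u0)//.
  by rewrite ler_peMl// (le_trans ler01).
apply: (@le_trans _ _ (8 * (`|p.1| ^+ k + `|p.2| ^+ k))); last first.
  have -> : 16 * c * u ^+ 3 * env u p.1 * env u p.2 =
    8 * (c * u ^+ 3 * (env u p.1 * env u p.2) + c * u ^+ 3 * (env u p.1 * env u p.2)).
    by ring.
  by rewrite ler_wpM2l// lerD.
suff H (X Y : R) : 0 <= X -> 0 <= Y -> (X + Y) ^+ k <= 8 * (X ^+ k + Y ^+ k).
  exact: H.
move=> X0 Y0.
have XY := mulr_ge0 X0 Y0.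
case: k34 => ->.
  have : 0 <= (X + Y) * (X - Y) ^+ 2 by rewrite mulr_ge0 ?addr_ge0// sqr_ge0.
  have : 0 <= X ^+ 3 by rewrite exprn_ge0.
  have : 0 <= Y ^+ 3 by rewrite exprn_ge0.
  nra.
have h1 : (X + Y) ^+ 2 <= 2 * (X ^+ 2 + Y ^+ 2) by have := sqr_ge0 (X - Y); nra.
have h2 : (X ^+ 2 + Y ^+ 2) ^+ 2 <= 2 * (X ^+ 4 + Y ^+ 4).
  by have := sqr_ge0 (X ^+ 2 - Y ^+ 2); nra.
have h3 : ((X + Y) ^+ 2) ^+ 2 <= (2 * (X ^+ 2 + Y ^+ 2)) ^+ 2.
  by rewrite lerXn2r ?nnegrE ?sqr_ge0// mulr_ge0// addr_ge0// sqr_ge0.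
by rewrite (_ : (X + Y) ^+ 4 = ((X + Y) ^+ 2) ^+ 2); [nra|ring].
Qed.

(** Outside the layer the region and the epigraph agree near the origin and the
    jet is accurate; away from the origin a fourth power of the distance is
    available to absorb everything. *)
Lemma region_pointwise (p : R * R) :
  `|(F \_ D) p - (if P p.1 <= p.2 then jet f0 fx fy fxx fxy fyy p.1 p.2 else 0)|
  <= Alayer * u ^+ 3 * env u p.1 * env u p.2 +
     12 * M * (if P p.1 - M * p.1 ^+ 4 <= p.2 <= P p.1 + M * p.1 ^+ 4 then 1 else 0).
Proof.
set T := jet _ _ _ _ _ _ _ _.
have TM : `|T| <= 2 * M * (1 + (`|p.1| + `|p.2|) ^+ 2) by exact: jet_bound.
have q3 := @pow_sum_env p 3 (or_introl erefl).
have q4 := @pow_sum_env p 4 (or_intror erefl).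
have FDM : `|(F \_ D) p| <= M.
  rewrite patchE; case: ifPn => [/set_mem/FM//|_].
  by rewrite -[point]/(0 : R) normr0.
have en := enorm_le_sum p; have en0 := enorm_ge0 p.
set X := `|p.1| + `|p.2| in TM q3 q4 en.
have X0 : 0 <= X by rewrite addr_ge0.
set e := 16 * c * u ^+ 3 * env u p.1 * env u p.2 in q3 q4.
have e0 : 0 <= e by apply: le_trans q3; rewrite exprn_ge0.
have AE : Alayer * u ^+ 3 * env u p.1 * env u p.2 = M * e + 6 * M / rho ^+ 4 * e.
  by rewrite /Alayer /e; field; rewrite gt_eqF.
have r4 : 0 < rho ^+ 4 by rewrite exprn_gt0.
have M6 : 0 <= 6 * M / rho ^+ 4 * e.
  by apply: mulr_ge0 => //; apply: divr_ge0; [exact: mulr_ge0|exact: ltW].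
have Me : 0 <= M * e by rewrite mulr_ge0.
have Z0 : 0 <= 12 * M * (if P p.1 - M * p.1 ^+ 4 <= p.2 <= P p.1 + M * p.1 ^+ 4 then 1 else 0).
  by rewrite mulr_ge0 ?mulr_ge0//; case: ifP.
have Tb : `|(F \_ D) p - (if P p.1 <= p.2 then T else 0)| <= M + 2 * M * (1 + X ^+ 2).
  apply: (le_trans (ler_normB _ _)); apply: lerD => //.
  case: ifP => // _; rewrite normr0.
  by rewrite mulr_ge0 ?mulr_ge0// addr_ge0// exprn_ge0.
rewrite AE.
have [near|far] := ltP (enorm p) rho; last first.
  apply: (@le_trans _ _ (6 * M / rho ^+ 4 * e)); last by lra.
  apply: (le_trans Tb).
  have rX : rho <= X by exact: le_trans far en.
  have X4 : rho ^+ 4 <= X ^+ 4 by rewrite lerXn2r ?nnegrE// ltW.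
  have X2 : rho ^+ 4 * X ^+ 2 <= X ^+ 4.
    rewrite (_ : X ^+ 4 = X ^+ 2 * X ^+ 2); last by ring.
    rewrite ler_wpM2r ?sqr_ge0//; apply: (@le_trans _ _ (rho ^+ 2)).
      by rewrite ler_wiXn2l// ltW.
    by rewrite lerXn2r ?nnegrE// ltW.
  have -> : M + 2 * M * (1 + X ^+ 2) = M / rho ^+ 4 * (3 * rho ^+ 4 + 2 * (rho ^+ 4 * X ^+ 2)).
    by field; rewrite gt_eqF.
  have -> : 6 * M / rho ^+ 4 * e = M / rho ^+ 4 * (6 * e) by ring.
  by rewrite ler_wpM2l ?divr_ge0 ?(ltW r4)//; lra.
have X2 : X <= 2.
  apply: (le_trans (lerD (normr_le_enorm1 p) (normr_le_enorm2 p))).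
  by have := ltW (lt_le_trans near rho1) => h; rewrite -[leRHS]/(1 + 1 : R) lerD.
have [inZ|outZ] := boolP (P p.1 - M * p.1 ^+ 4 <= p.2 <= P p.1 + M * p.1 ^+ 4).
  apply: (@le_trans _ _ (12 * M * 1)); last by lra.
  apply: (le_trans Tb).
  have -> : M + 2 * M * (1 + X ^+ 2) = M * (3 + 2 * X ^+ 2) by ring.
  by rewrite mulr1 [12 * M]mulrC ler_wpM2l//; nra.
rewrite mulr0 addr0.
have far : M * p.1 ^+ 4 < `|p.2 - P p.1|.
  rewrite ltNge; apply: contra outZ; rewrite ler_norml => /andP[? ?].
  by apply/andP; split; lra.
have W0 : 0 <= M * p.1 ^+ 4 by rewrite mulr_ge0// exprn_even_ge0.
have DPp := DP near far.
have [Pp|pP] := leP (P p.1) p.2.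
  have lt : P p.1 < p.2.
    rewrite lt_neqAle Pp andbT; apply/eqP => PE; move: far.
    by rewrite PE subrr normr0 ltNge W0.
  have Dp : D p by apply/DPp.
  rewrite patchE mem_set//; apply: (le_trans (FT Dp near)).
  apply: (@le_trans _ _ (M * e)); last by lra.
  rewrite ler_wpM2l//; apply: le_trans q3.
  by rewrite lerXn2r ?nnegrE.
have nDp : ~ D p by move=> /DPp; rewrite ltNge (ltW pP).
rewrite patchE memNset// -[point]/(0 : R) subr0 normr0; lra.
Qed.

(** The value of the integral of [column] against the Gaussian weight: odd powers
    integrate to zero, [x ^+ 2] to [2 u^2] and [x ^+ 4] to [12 u^4]. *)
Definition plane_main : R :=
  (f0 + fxx * u ^+ 2) * tail0 u (- r) + fy * tail1 u (- r) +
  fyy / 2 * tail2 u (- r) -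
  gs u r * (f0 * (2 * al * u ^+ 2 + 3 * r * al ^+ 2 * u ^+ 2)
            - 2 * r * fy * al * u ^+ 2).

Lemma Rintegral_poly4 (a0 a1 a2 a3 a4 : R) :
  let h x := a0 + a1 * x + a2 * x ^+ 2 + a3 * x ^+ 3 + a4 * x ^+ 4 in
  mu.-integrable setT (EFin \o (fun x => gs u x * h x)) /\
  \int[mu]_x (gs u x * h x) = a0 + a2 * (2 * u ^+ 2) + a4 * (12 * u ^+ 4).
Proof.
move=> h.
pose m k x := gs u x * x ^+ k.
have I k : (k <= 12)%N -> mu.-integrable setT (EFin \o m k).
  by move=> k12; exact: integrable_gs_pow.
have IZ a k : (k <= 12)%N -> mu.-integrable setT (EFin \o (fun x => a * m k x)).
  by move=> k12; apply: (@integrableZl _ _ _ mu _ _ a _ (I k k12)).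
have E0 : \int[mu]_x m 0%N x = 1.
  by rewrite -(Rintegral_gs u0); apply: eq_Rintegral => x _; rewrite /m expr0 mulr1.
have hE : (fun x => gs u x * h x) = (fun x =>
    a0 * m 0%N x + a1 * m 1%N x + a2 * m 2%N x + a3 * m 3%N x + a4 * m 4%N x).
  by apply/funext => x; rewrite /h /m; ring.
have ID (f g : R -> R) : mu.-integrable setT (EFin \o f) ->
    mu.-integrable setT (EFin \o g) ->
    mu.-integrable setT (EFin \o (fun x => f x + g x)).
  by move=> If Ig; exact: (integrableD _ If Ig).
have I1 := ID _ _ (IZ a0 0%N isT) (IZ a1 1%N isT).
have I2 := ID _ _ I1 (IZ a2 2%N isT).
have I3 := ID _ _ I2 (IZ a3 3%N isT).
have I4 := ID _ _ I3 (IZ a4 4%N isT).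
rewrite hE; split; first exact: I4.
rewrite RintegralD//; last exact: IZ.
rewrite RintegralD//; last exact: IZ.
rewrite RintegralD//; last exact: IZ.
rewrite RintegralD//; try exact: IZ.
rewrite !RintegralZl//; try exact: I.
have o1 : \int[mu]_x m 1%N x = 0 by exact: (@moment_odd R u 1 isT isT u0).
have o3 : \int[mu]_x m 3%N x = 0 by exact: (@moment_odd R u 3 isT isT u0).
have e2 : \int[mu]_x m 2%N x = 2 * u ^+ 2 by exact: moment2.
have e4 : \int[mu]_x m 4%N x = 12 * u ^+ 4 by exact: moment4.
by rewrite E0 o1 e2 o3 e4; ring.
Qed.

Lemma Rintegral_column :
  let h := column u r al be f0 fx fy fxx fxy fyy in
  mu.-integrable setT (EFin \o (fun x => gs u x * h x)) /\
  \int[mu]_x (gs u x * h x) = plane_main.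
Proof.
move=> h.
pose a0 := f0 * tail0 u (- r) + fy * tail1 u (- r) + fyy / 2 * tail2 u (- r).
pose a1 := fx * tail0 u (- r) + fxy * tail1 u (- r).
pose a2 := fxx / 2 * tail0 u (- r) - gs u r * (f0 * al - r * fy * al).
pose a3 := - gs u r * (f0 * be + fx * al).
pose a4 := - gs u r * (f0 * (r / (4 * u ^+ 2) * al ^+ 2)).
have [I E4] := Rintegral_poly4 a0 a1 a2 a3 a4.
have hE : h = fun x => a0 + a1 * x + a2 * x ^+ 2 + a3 * x ^+ 3 + a4 * x ^+ 4.
  by apply/funext => x; rewrite /h /column /a0 /a1 /a2 /a3 /a4; ring.
rewrite hE; split; first exact: I.
rewrite E4 /plane_main /a0 /a2 /a4; field.
by rewrite gt_eqF.
Qed.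

(** By Fubini the integral is computed by columns.  A column is first compared with
    a half-line cut at the cubic graph, up to a layer of width [M x^4], and then
    with [column]. *)
Lemma region_expansion :
  `|\int[mm]_(p in D) (gs u p.1 * gs u p.2 * F p) - plane_main| <=
  Kregion * u ^+ 3.
Proof.
pose g := F \_ D.
have mg : measurable_fun setT g by apply/(measurable_restrictT _ _).1.
have gM p : `|g p| <= M.
  rewrite /g patchE; case: ifPn => [/set_mem/FM//|_].
  by rewrite -[point]/(0 : R) normr0.
have gC p : `|g p| <= M * env u p.1 * env u p.2.
  apply: (le_trans (gM p)); have e1 := env_ge1 u p.1; have e2 := env_ge1 u p.2.
  rewrite -mulrA ler_peMr//; apply: (le_trans e1).
  by rewrite ler_peMr// (le_trans ler01).
have -> : \int[mm]_(p in D) (gs u p.1 * gs u p.2 * F p) =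
    \int[mm]_p (gs u p.1 * gs u p.2 * g p).
  rewrite Rintegral_mkcond; apply: eq_Rintegral => p _.
  by rewrite /g !patchE; case: ifP => // _; rewrite -![point]/(0 : R) mulr0.
have mgx x : measurable_fun setT (fun y => g (x, y)).
  exact: (measurableT_comp mg).
have gxC x y : `|g (x, y)| <= M * env u y.
  by apply: (le_trans (gM _)); rewrite ler_peMr// env_ge1.
have Igx x : mu.-integrable setT (EFin \o (fun y => gs u y * g (x, y))).
  exact: (integrable_gs_env u0 (mgx x) (gxC x)).
have Ix x : mu.-integrable setT (EFin \o (fun y => gs u x * gs u y * g (x, y))).
  rewrite (_ : (fun y => _) = fun y => gs u x * (gs u y * g (x, y))).
    by apply: (@integrableZl _ _ _ mu _ _ (gs u x) _ (Igx x)).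
  by apply/funext => y; rewrite mulrA.
have [IH ->] := Rintegral_Fubini (integrable_gs2 u0 mg gC) Ix.
pose H x := \int[mu]_y (gs u y * g (x, y)).
have HE : (fun x => \int[mu]_y (gs u x * gs u y * g (x, y))) = (fun x => gs u x * H x).
  apply/funext => x; rewrite -RintegralZl//.
  by apply: eq_Rintegral => y _; rewrite mulrA.
have -> : \int[mu]_x \int[mu]_y (gs u x * gs u y * g (x, y)) = \int[mu]_x (gs u x * H x).
  by rewrite -HE.
rewrite /= HE in IH.
have [Ic <-] := Rintegral_column.
set h := column _ _ _ _ _ _ _ _ _ _ in Ic *.
pose K' := Alayer * Num.sqrt 2 + 24 * M ^+ 2 * c ^+ 2 + Kcol M.
have Hh x : `|H x - h x| <= K' * u ^+ 3 * env u x.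
  pose t0 := f0 + fx * x + fxx / 2 * x ^+ 2.
  pose t1 := fy + fxy * x.
  pose t2 := fyy / 2.
  have w0 : 0 <= M * x ^+ 4 by rewrite mulr_ge0// exprn_even_ge0.
  have A0 : 0 <= Alayer * u ^+ 3 * env u x.
    rewrite mulr_ge0 ?expR_ge0// mulr_ge0 ?exprn_ge0 ?(ltW u0)//.
    rewrite /Alayer; apply: addr_ge0; first by rewrite !mulr_ge0.
    by apply: divr_ge0; rewrite ?exprn_ge0 ?(ltW rho0)// !mulr_ge0.
  have B0 : 0 <= 12 * M by rewrite mulr_ge0.
  have cc := @column_comparison R u (P x) (M * x ^+ 4) (Alayer * u ^+ 3 * env u x)
    (12 * M) t0 t1 t2 (fun y => g (x, y)) u0 w0 A0 B0 (mgx x).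
  have {}cc := cc _.
  have ce := @column_expansion R u r al be f0 fx fy fxx fxy fyy M x u01 alM beM
    f0M fxM fyM fxxM fxyM fyyM.
  rewrite -(subrKA (t0 * tail0 u (P x) + t1 * tail1 u (P x) + t2 * tail2 u (P x))).
  apply: (le_trans (ler_normD _ _)).
  have -> : K' * u ^+ 3 * env u x =
     (Alayer * u ^+ 3 * env u x * Num.sqrt 2 +
      24 * M ^+ 2 * c * (c * u ^+ 4 * env u x) / u) + Kcol M * u ^+ 3 * env u x.
    by rewrite /K'; field; rewrite gt_eqF.
  apply: lerD; last exact: ce.
  apply: le_trans; first apply: cc.
    move=> s; have := region_pointwise (x, s); rewrite /jet /=.
    rewrite (_ : t0 + t1 * s + t2 * s ^+ 2 = f0 + fx * x + fy * s +
      fxx / 2 * x ^+ 2 + fxy * x * s + fyy / 2 * s ^+ 2)//.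
    by rewrite /t0 /t1 /t2; ring.
  rewrite lerD2l.
  have -> : 12 * M * (c / u * (2 * (M * x ^+ 4))) = 24 * M ^+ 2 * c / u * x ^+ 4.
    by field; rewrite gt_eqF.
  have -> : 24 * M ^+ 2 * c * (c * u ^+ 4 * env u x) / u =
    24 * M ^+ 2 * c / u * (c * u ^+ 4 * env u x) by field; rewrite gt_eqF.
  apply: ler_wpM2l.
    by rewrite divr_ge0 ?(ltW u0)// mulr_ge0// mulr_ge0// sqr_ge0.
  have := pow_le_env_scale x u01 (leqnn 4) isT.
  by rewrite -normrX ger0_norm// exprn_even_ge0.
rewrite -RintegralB//.
have Ienv := integrable_gs_envelope u0.
have IK : mu.-integrable setT (EFin \o (fun x => K' * u ^+ 3 * (gs u x * env u x))).
  by apply: (@integrableZl _ _ _ mu _ _ (K' * u ^+ 3) _ Ienv).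
have Id : mu.-integrable setT (EFin \o (fun x => gs u x * H x - gs u x * h x)).
  exact: (integrableB _ IH Ic).
apply: (le_trans (le_normr_Rintegral _ Id)) => //.
apply: (@le_trans _ _ (\int[mu]_x (K' * u ^+ 3 * (gs u x * env u x)))).
  apply: le_Rintegral => //; first exact: integrable_norm.
  move=> x _; rewrite -mulrBr normrM (ger0_norm (gs_ge0 _ u0)).
  by rewrite mulrCA ler_wpM2l ?gs_ge0.
rewrite RintegralZl// Rintegral_gs_env// /Kregion -/K' le_eqVlt; apply/orP; left.
by apply/eqP; ring.
Qed.

End region.

(** * Integration in time *)
Section time.
Variable R : realType.
Implicit Types (a s u r t : R).
Local Notation c := (cenv R).
Local Notation mu := (@lebesgue_measure R).
Local Notation spi := (Num.sqrt (pi : R)).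

(** The derivative of [erf] is even. *)
Lemma erfN z : erf (- z : R) = - erf z.
Proof.
suff : `|erf (- z) + erf z| <= 0 * `|z| ^+ 1.
  by rewrite mul0r normr_le0 addr_eq0 => /eqP.
apply: (@growth _ (fun x => erf (- x) + erf x) (fun=> 0)).
- by rewrite oppr0 erf0 addr0.
- move=> y _.
  have dN : is_derive y (1 : R) (fun x : R => erf (- x))
      (2 / spi * expR (- (- y) ^+ 2) * -1).
    exact: is_derive1_comp.
  by apply: is_derive_eq; rewrite sqrrN mulrN1 addNr.
- by move=> y _; rewrite normr0 mul0r.
Qed.

Section primitive.
Variables (r ka f0 fy fxx fyy : R).
Hypothesis r0 : 0 < r.
Let e u : R := erf (r / (2 * u)).
Let G u : R := gs u r.

Lemma is_derive_erf_scale u : 0 < u -> is_derive u (1 : R) e (- (2 * r / u * G u)).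
Proof.
move=> u0; have uN0 : u != 0 by rewrite gt_eqF.
have d1 : is_derive u (1 : R) (fun x : R => r / (2 * x)) (- (r / (2 * u ^+ 2))).
  have dV : is_derive u (1 : R) (fun x : R => (2 * x)^-1) (- (2 * u) ^- 2 *: (2 : R)).
    apply: is_deriveV; first by rewrite mulf_neq0.
    by apply: is_derive_eq; rewrite /GRing.scale/=; ring.
  by apply: is_derive_eq; rewrite /GRing.scale/=; field.
apply: (is_derive_eq (is_derive1_comp (is_derive_erf _) d1)).
rewrite /G /gs (_ : (r / (2 * u)) ^+ 2 = r ^+ 2 / (4 * u ^+ 2)); last by field.
by field; rewrite uN0 gt_eqF// spi_gt0.
Qed.

Lemma is_derive_gs_scale u : 0 < u ->
  is_derive u (1 : R) G (G u * (r ^+ 2 / (2 * u ^+ 3) - u^-1)).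
Proof.
move=> u0; have uN0 : u != 0 by rewrite gt_eqF.
have sN0 : spi != 0 by rewrite gt_eqF// spi_gt0.
have dV : is_derive u (1 : R) (fun x : R => x^-1) (- u ^- 2).
  apply: is_derive_eq; first by apply: is_deriveV.
  by rewrite /GRing.scale/= mulr1.
have d2 : is_derive u (1 : R) (fun x : R => - (r ^+ 2 / 4 * x^-1 ^+ 2)) (r ^+ 2 / (2 * u ^+ 3)).
  by apply: is_derive_eq; rewrite /GRing.scale/=; field.
have d3 : is_derive u (1 : R) (fun x : R => expR (- (r ^+ 2 / 4 * x^-1 ^+ 2)))
    (expR (- (r ^+ 2 / 4 * u^-1 ^+ 2)) * (r ^+ 2 / (2 * u ^+ 3))).
  exact: is_derive1_comp.
have -> : G = fun x => expR (- (r ^+ 2 / 4 * x^-1 ^+ 2)) * x^-1 / (2 * spi).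
  apply/funext => x; rewrite /G /gs; have [->|x0] := eqVneq x 0.
    by rewrite !(invr0, mulr0, mul0r).
  rewrite (_ : r ^+ 2 / (4 * x ^+ 2) = r ^+ 2 / 4 * x^-1 ^+ 2); last by field.
  by field; rewrite x0 sN0.
by apply: is_derive_eq; rewrite /GRing.scale/=; field; rewrite uN0.
Qed.

(** The claimed expansion at time [u ^+ 2], as a polynomial in [u], in
    [erf (r / (2 * u))] and in the Gaussian weight at [r]. *)
Definition Psi u : R :=
  (2 * u ^+ 2 * (1 + e u) + 4 * r * u ^+ 2 * G u - r ^+ 2 * (1 - e u)) / 4 * f0 +
  ((4 * u ^+ 3 - 2 * r ^+ 2 * u) * (2 * u * G u) + r ^+ 3 * (1 - e u)) / 12
    * (2 * fy - ka * f0) +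
  ((1 - e u) * (r ^+ 4 * (4 * ka * fy - 3 * fyy + fxx - 3 * ka ^+ 2 * f0)
                - 12 * u ^+ 4 * (fyy + fxx)) +
   2 * (r ^+ 3 * u - 2 * r * u ^+ 3) * (2 * u * G u) *
     (- 4 * ka * fy + 3 * fyy - fxx + 3 * ka ^+ 2 * f0) +
   24 * u ^+ 4 * (fxx + fyy)) / 48.

Let pm u : R := plane_main u r (ka / 2) f0 fy fxx fyy.

Lemma plane_mainE u : 0 < u -> pm u =
  (f0 + fxx * u ^+ 2) * ((1 + e u) / 2) + fy * (2 * u ^+ 2 * G u) +
  fyy / 2 * (u ^+ 2 * (1 + e u) - 2 * u ^+ 2 * r * G u) -
  G u * (f0 * (ka * u ^+ 2 + 3 / 4 * r * ka ^+ 2 * u ^+ 2) - r * fy * ka * u ^+ 2).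
Proof.
move=> u0; rewrite /pm /plane_main /tail2 /tail1 /tail0 gsN mulNr erfN -/(e u) -/(G u).
by field.
Qed.

(** The factor [2 u] is that of the change of variable [t = u^2].  This identity
    is where the coefficients of the expansion are verified. *)
Lemma is_derive_Psi u : 0 < u -> is_derive u (1 : R) Psi (2 * u * pm u).
Proof.
move=> u0; have uN0 : u != 0 by rewrite gt_eqF.
have de := is_derive_erf_scale u0; have dG := is_derive_gs_scale u0.
rewrite plane_mainE// /Psi; apply: is_derive_eq; rewrite /GRing.scale/=.
by field.
Qed.

Lemma is_derive_Psi_sqrt t : 0 < t ->
  is_derive t (1 : R) (fun x => Psi (Num.sqrt x)) (pm (Num.sqrt t)).
Proof.
move=> t0; have s0 : 0 < Num.sqrt t by rewrite sqrtr_gt0.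
apply: (is_derive_eq (is_derive1_comp (is_derive_Psi s0) (is_derive1_sqrt t0))).
by field; rewrite gt_eqF.
Qed.

Lemma continuous_pm_sqrt t : 0 < t -> {for t, continuous (fun x => pm (Num.sqrt x))}.
Proof.
move=> t0; have s0 : 0 < Num.sqrt t by rewrite sqrtr_gt0.
pose g u := (f0 + fxx * u ^+ 2) * ((1 + e u) / 2) + fy * (2 * u ^+ 2 * G u) +
  fyy / 2 * (u ^+ 2 * (1 + e u) - 2 * u ^+ 2 * r * G u) -
  G u * (f0 * (ka * u ^+ 2 + 3 / 4 * r * ka ^+ 2 * u ^+ 2) - r * fy * ka * u ^+ 2).
have cg : {for Num.sqrt t, continuous g}.
  have de := is_derive_erf_scale s0; have dG := is_derive_gs_scale s0.
  have /derivable1_diffP/differentiable_continuous// : derivable g (Num.sqrt t) 1.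
  by rewrite /g; apply: ex_derive.
have cgs : {for t, continuous (g \o Num.sqrt)}.
  by apply: continuous_comp => //; exact: sqrt_continuous.
have E : \forall x \near t, g (Num.sqrt x) = pm (Num.sqrt x).
  near=> x; rewrite plane_mainE// sqrtr_gt0; near: x; exact: lt_nbhsr.
have H : pm (Num.sqrt x) @[x --> t] --> pm (Num.sqrt t).
  by rewrite -(nbhs_singleton E); apply: cvg_trans cgs; exact: near_eq_cvg.
exact: H.
Unshelve. all: by end_near. Qed.

(** For fixed [r > 0] the point is at infinite distance in the scale [u], so that
    [e u] tends to one; every other term carries a positive power of [u], as
    [u * G u] is bounded. *)
Lemma cvg_Psi0 : Psi u @[u --> 0^'+] --> (0 : R).
Proof.
have ue : e u @[u --> 0^'+] --> (1 : R).
  apply: (cvg_comp _ _ _ (@cvg_erf R)).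
  have -> : (fun u => r / (2 * u)) = (fun u => r / 2 * u^-1).
    by apply/funext => u; rewrite invfM mulrA.
  apply: gt0_cvgMry; first by rewrite divr_gt0.
  apply/gtr0_cvgV0.
    by near=> u; rewrite invr_gt0; near: u; exact: nbhs_right_gt.
  rewrite (_ : unstable.inv_fun _ = id); first exact: cvg_at_right_filter.
  by apply/funext => u; rewrite /unstable.inv_fun /= invrK.
have u1 : u @[u --> (0 : R)^'+] --> (0 : R) by apply: cvg_at_right_filter.
have uG : u * (u * G u) @[u --> 0^'+] --> (0 : R).
  apply: (@squeeze_cvgr _ _ _ _ (cst 0) (fun u => c * u)); last 2 first.
  - exact: cvg_cst.
  - by rewrite -[X in _ --> X](mulr0 c); apply: cvgMr.
  near=> u; have u0 : 0 < u by [].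
  apply/andP; split; first by do 2 (apply: mulr_ge0; first exact: ltW); exact: gs_ge0.
  rewrite mulrC ler_wpM2r ?(ltW u0)//.
  have := gs_bound0 r u0; rewrite (ger0_norm (gs_ge0 _ u0)) -/(G u).
  by rewrite ler_pdivlMr// mulrC.
have Z k (f : R -> R) : f u @[u --> 0^'+] --> (0 : R) ->
    k * f u @[u --> 0^'+] --> (0 : R).
  by move=> hf; rewrite -[X in _ --> X](mulr0 k); apply: cvgM; [exact: cvg_cst|exact: hf].
have S (f g : R -> R) : f u @[u --> 0^'+] --> (0 : R) ->
    g u @[u --> 0^'+] --> (0 : R) -> f u + g u @[u --> 0^'+] --> (0 : R).
  by move=> hf hg; rewrite -[X in _ --> X](addr0 (0 : R)); apply: cvgD.
have m1 : 1 - e u @[u --> 0^'+] --> (0 : R).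
  by rewrite -[X in _ --> X](subrr (1 : R)); apply: cvgB => //; exact: cvg_cst.
have v : u * u @[u --> (0 : R)^'+] --> (0 : R).
  by rewrite -[X in _ --> X](mulr0 (0 : R)); apply: cvgM.
have m2 : u * u * (1 + e u) @[u --> 0^'+] --> (0 : R).
  rewrite -[X in _ --> X](mul0r (1 + 1 : R)); apply: cvgM => //.
  by apply: cvgD => //; exact: cvg_cst.
have m4 : u * u * (u * (u * G u)) @[u --> 0^'+] --> (0 : R).
  by rewrite -[X in _ --> X](mulr0 (0 : R)); apply: cvgM.
have m6 : u * u * (u * u) @[u --> (0 : R)^'+] --> (0 : R).
  by rewrite -[X in _ --> X](mulr0 (0 : R)); apply: cvgM.
have m5 : u * u * (u * u) * (1 - e u) @[u --> 0^'+] --> (0 : R).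
  by rewrite -[X in _ --> X](mulr0 (0 : R)); apply: cvgM.
pose X := 4 * ka * fy - 3 * fyy + fxx - 3 * ka ^+ 2 * f0.
pose W := 2 * fy - ka * f0.
pose k1 := - r ^+ 2 / 4 * f0 + r ^+ 3 / 12 * W + r ^+ 4 / 48 * X.
pose k3 := r * f0 - 4 * r ^+ 2 / 12 * W - 4 * r ^+ 3 / 48 * X.
pose k4 := 8 / 12 * W + 8 * r / 48 * X.
pose k5 := - 12 / 48 * (fyy + fxx).
pose k6 := 24 / 48 * (fxx + fyy).
have -> : Psi = fun u => k1 * (1 - e u) + f0 / 2 * (u * u * (1 + e u)) +
    k3 * (u * (u * G u)) + k4 * (u * u * (u * (u * G u))) +
    k5 * (u * u * (u * u) * (1 - e u)) + k6 * (u * u * (u * u)).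
  by apply/funext => u; rewrite /Psi /k1 /k3 /k4 /k5 /k6 /X /W; field.
exact: S (S _ _ (S _ _ (S _ _ (S _ _ (Z _ _ m1) (Z _ _ m2)) (Z _ _ uG))
  (Z _ _ m4)) (Z _ _ m5)) (Z _ _ m6).
Unshelve. all: by end_near. Qed.

End primitive.
End time.

Section time_integration.
Variable R : realType.
Implicit Types (a s u r t : R).
Local Notation c := (cenv R).
Local Notation mu := (@lebesgue_measure R).
Local Notation mm := (@lebesgue_measure R \x @lebesgue_measure R)%E.
Local Notation mR := (measurableTypeR R).
Local Notation spi := (Num.sqrt (pi : R)).

Lemma bounded_integrable_itv (N : R -> R) a b B : measurable_fun `]a, b[ N ->
  (forall t, t \in `]a, b[ -> `|N t| <= B) ->
  mu.-integrable `]a, b[ (EFin \o N).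
Proof.
move=> mN NB.
have IB : mu.-integrable `]a, b[ (EFin \o (fun _ : R => B)).
  apply: (@integrableS _ _ _ mu `[a, b]) => //.
    exact: subset_itv_oo_cc.
  apply: continuous_compact_integrable; first exact: segment_compact.
  by apply: continuous_subspaceT => x; exact: cvg_cst.
apply: le_integrable IB => //; first exact/measurable_EFinP.
move=> t tab /=; rewrite lee_fin; apply: le_trans (NB _ tab) _; exact: ler_norm.
Qed.

Lemma Rintegral_le_itv (N : R -> R) a b B : a <= b -> measurable_fun `]a, b[ N ->
  (forall t, t \in `]a, b[ -> `|N t| <= B) ->
  `|\int[mu]_(t in `]a, b[) N t| <= B * (b - a).
Proof.
move=> ab mN NB; have IN := bounded_integrable_itv mN NB.
apply: (le_trans (le_normr_Rintegral _ IN)) => //.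
have -> : B * (b - a) = \int[mu]_(t in `]a, b[) B.
  rewrite Rintegral_cst//= lebesgue_measure_itv/= lte_fin.
  move: ab; rewrite le_eqVlt => /predU1P[->|->]//.
  by rewrite ltxx subrr.
apply: le_Rintegral => //; first exact: integrable_norm.
by apply: (@bounded_integrable_itv (fun=> B) _ _ `|B|) => //.
Qed.

(** The primitive is only known at positive times: the integral is computed from
    [z > 0], and the boundedness of [N] takes care of the times before [z]. *)
Lemma time_integral (N f F : R -> R) (de K B : R) : 0 < de ->
  measurable_fun `]0, de[ N ->
  (forall t, t \in `]0, de[ -> `|N t - f t| <= K) ->
  (forall t, t \in `]0, de[ -> `|N t| <= B) ->
  (forall t, 0 < t -> is_derive t (1 : R) F (f t)) ->
  (forall t, 0 < t -> {for t, continuous f}) ->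
  F t @[t --> 0^'+] --> (0 : R) ->
  `|\int[mu]_(t in `]0, de[) N t - F de| <= K * de.
Proof.
move=> d0 mN Nf NB dF cf F0.
have IN := bounded_integrable_itv mN NB.
have d2 : de / 2 \in `]0, de[ by rewrite in_itv/=; apply/andP; split; lra.
have K0 : 0 <= K by apply: le_trans (Nf _ d2).
have B0 : 0 <= B by apply: le_trans (NB _ d2).
apply/ler_addgt0Pr => e e0.
have [z [z0 zd zB zF]] : exists z, [/\ 0 < z, z < de, B * z <= e / 2 & `|F z| <= e / 2].
  near (0 : R)^'+ => z; exists z; split.
  - by near: z; exact: nbhs_right_gt.
  - by near: z; exact: nbhs_right_lt.
  - have : z < e / 2 / (B + 1).
      by near: z; apply: nbhs_right_lt; rewrite !divr_gt0// ltr_wpDl.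
    have z0 : 0 < z by near: z; exact: nbhs_right_gt.
    rewrite ltr_pdivlMr ?ltr_wpDl// => h.
    by move: h; rewrite mulrDr mulr1 mulrC => h; lra.
  - near: z; have /cvgrPdist_le/(_ (e / 2)) := F0.
    have e20 : 0 < e / 2 by lra.
    by move=> /(_ e20); apply: filterS => z; rewrite sub0r normrN.
have zde : `]0, de[%classic = `]0, z] `|` `]z, de[.
  by rewrite -itv_bndbnd_setU ?bnd_simp// ltW.
have mN1 : measurable_fun `]0, z[ N.
  apply: measurable_funS mN => //; apply: subset_itvl; rewrite bnd_simp; exact: ltW.
have mN2 : measurable_fun `]z, de[ N.
  apply: measurable_funS mN => //; apply: subset_itvr; rewrite bnd_simp; exact: ltW.
have in1 t : t \in `]0, z[ -> t \in `]0, de[.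
  by rewrite !in_itv/= => /andP[-> /lt_trans]; apply.
have in2 t : t \in `]z, de[ -> t \in `]0, de[.
  by rewrite !in_itv/= => /andP[/(lt_trans z0) -> ->].
have I1 : mu.-integrable `]0, z[ (EFin \o N).
  by apply: (bounded_integrable_itv mN1) => t /in1; exact: NB.
have I2 : mu.-integrable `]z, de[ (EFin \o N).
  by apply: (bounded_integrable_itv mN2) => t /in2; exact: NB.
have -> : \int[mu]_(t in `]0, de[) N t =
    \int[mu]_(t in `]0, z[) N t + \int[mu]_(t in `]z, de[) N t.
  rewrite zde Rintegral_setU//.
  - by rewrite (Rintegral_itv_bndo_bndc I1).
  - by rewrite -zde.
  - rewrite disj_set2E; apply/eqP/seteqP; split => // t [] /=.
    by rewrite !in_itv/= => /andP[_ tz] /andP[/lt_le_trans/(_ tz)]; rewrite ltxx.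
have b1 : `|\int[mu]_(t in `]0, z[) N t| <= B * z.
  rewrite -[X in _ * X]subr0; apply: Rintegral_le_itv => //; first exact: ltW.
  by move=> t /in1; exact: NB.
have wcf : {within `[z, de], continuous f}.
  apply: continuous_in_subspaceT => t; rewrite inE/= in_itv/= => /andP[zt _].
  by apply: cf; exact: lt_le_trans zt.
have Icc : mu.-integrable `[z, de] (EFin \o f).
  by apply: continuous_compact_integrable => //; exact: segment_compact.
have If : mu.-integrable `]z, de[ (EFin \o f).
  by apply: integrableS Icc => //; exact: subset_itv_oo_cc.
have cF t : 0 < t -> {for t, continuous F}.
  by move=> t0; have [/derivable1_diffP/differentiable_continuous] := dF t t0.
have Ef : \int[mu]_(t in `]z, de[) f t = F de - F z.
  rewrite Rintegral_itv_bndo_bndc//; last first.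
  rewrite Rintegral_itv_obnd_cbnd//; last first.
    by apply: integrableS Icc => //; apply: subset_itvr; rewrite bnd_simp.
  rewrite /Rintegral (@continuous_FTC2 _ f F)//.
    split.
    - by move=> t; rewrite in_itv/= => /andP[zt _]; have [] := dF t (lt_trans z0 zt).
    - by apply: cvg_at_right_filter; exact: cF.
    - by apply: cvg_at_left_filter; apply: cF.
  move=> t; rewrite in_itv/= => /andP[zt _]; rewrite derive1E.
  by have [_ ->] := dF t (lt_trans z0 zt).
have b2 : `|\int[mu]_(t in `]z, de[) N t - \int[mu]_(t in `]z, de[) f t| <= K * (de - z).
  rewrite -RintegralB//; apply: Rintegral_le_itv; first exact: ltW.
    apply: measurable_funB => //.
    by have /integrableP[/measurable_EFinP] := If.
  by move=> t /in2; exact: Nf.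
move: b2; rewrite Ef => b2.
set J1 := \int[mu]_(t in _) _ in b1 *; set J2 := \int[mu]_(t in _) _ in b2 *.
have -> : J1 + J2 - F de = J1 + (J2 - (F de - F z)) + - F z by ring.
have Kz : K * (de - z) <= K * de by rewrite ler_wpM2l//; lra.
have : `|J1 + (J2 - (F de - F z)) + - F z| <= B * z + K * (de - z) + e / 2.
  by split_norm_sum => //; rewrite normrN.
by move/le_trans; apply; lra.
Unshelve. all: by end_near. Qed.

Lemma heat_kernelE t (p : R * R) : 0 < t ->
  heat_kernel t p = gs (Num.sqrt t) p.1 * gs (Num.sqrt t) p.2.
Proof.
move=> t0; rewrite /heat_kernel /gs enorm_sqr sqr_sqrtr ?(ltW t0)//.
rewrite mulrACA -expRD.
have -> : - (p.1 ^+ 2 / (4 * t)) + - (p.2 ^+ 2 / (4 * t)) =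
  - ((p.1 ^+ 2 + p.2 ^+ 2) / (4 * t)) by field; rewrite gt_eqF.
congr (_ * _); rewrite -invfM; congr (_^-1).
rewrite [RHS](_ : _ = 4 * (spi ^+ 2) * (Num.sqrt t ^+ 2)); last by ring.
by rewrite !sqr_sqrtr ?pi_ge0// ltW.
Qed.

Section heat_integral.
Variables (D : set (mR * mR)) (F : mR * mR -> R) (M : R).
Hypotheses (mD : measurable D) (mF : measurable_fun D F).
Hypothesis FM : forall p, D p -> `|F p| <= M.
Let N u := \int[mm]_(p in D) (gs u p.1 * gs u p.2 * F p).
Let k u (p : mR * mR) := gs u p.1 * gs u p.2 * F p.

Let mk u : measurable_fun D (k u).
Proof.
apply: measurable_funM => //; apply: measurable_funTS.
by apply: measurable_funM; apply: (measurableT_comp (@measurable_gs R u)).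
Qed.

Lemma Rintegral_gs2 u : 0 < u ->
  mm.-integrable setT (EFin \o (fun p : mR * mR => gs u p.1 * gs u p.2 * 1)) /\
  \int[mm]_p (gs u p.1 * gs u p.2 * 1) = 1.
Proof.
move=> u0.
have I : mm.-integrable setT (EFin \o (fun p : mR * mR => gs u p.1 * gs u p.2 * 1)).
  apply: (@integrable_gs2 _ _ _ 1) => // p; rewrite normr1 mul1r.
  have e1 := env_ge1 u p.1; have e2 := env_ge1 u p.2.
  by apply: (le_trans e1); rewrite ler_peMr// (le_trans ler01).
split => //.
have [|_ ->] := Rintegral_Fubini I.
  move=> x; rewrite (_ : (fun y => _) = fun y => gs u x * gs u y).
    by apply: (@integrableZl _ _ _ mu _ _ (gs u x) _ (integrable_gs u0)).
  by apply/funext => y /=; rewrite mulr1.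
rewrite -[RHS](Rintegral_gs u0); apply: eq_Rintegral => x _ /=.
transitivity (\int[mu]_y (gs u x * gs u y)).
  by apply: eq_Rintegral => y _ /=; ring.
by rewrite RintegralZl ?integrable_gs// Rintegral_gs// mulr1.
Qed.

Lemma integrable_gs2_bounded u : 0 < u -> mm.-integrable D (EFin \o k u).
Proof.
move=> u0; have [I _] := Rintegral_gs2 u0.
have ID : mm.-integrable D (EFin \o (fun p : mR * mR => M * (gs u p.1 * gs u p.2 * 1))).
  have I' : mm.-integrable D (EFin \o (fun p : mR * mR => gs u p.1 * gs u p.2 * 1)).
    by apply: integrableS I.
  by apply: (@integrableZl _ _ _ mm _ _ M _ I').
apply: le_integrable ID => //; first exact/measurable_EFinP.
move=> p Dp /=; rewrite lee_fin /k mulr1.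
have g0 : 0 <= gs u p.1 * gs u p.2 by rewrite mulr_ge0 ?gs_ge0.
apply: le_trans (ler_norm _); rewrite (normrM _ (F p)) (ger0_norm g0).
by rewrite [M * _]mulrC; apply: ler_wpM2l => //; exact: FM.
Qed.

Lemma Rintegral_gs2_bounded u : 0 <= M -> 0 < u -> `|N u| <= M.
Proof.
move=> M0 u0; have [I E] := Rintegral_gs2 u0.
have IM : mm.-integrable setT (EFin \o (fun p : mR * mR => M * (gs u p.1 * gs u p.2 * 1))).
  by apply: (@integrableZl _ _ _ mm _ _ M _ I).
have Ik := integrable_gs2_bounded u0.
have <- : \int[mm]_p (M * (gs u p.1 * gs u p.2 * 1)) = M.
  by rewrite RintegralZl// E mulr1.
apply: (le_trans (le_normr_Rintegral mD Ik)).
rewrite Rintegral_mkcond; apply: le_Rintegral => //.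
  rewrite -restrict_EFin; apply: (integrable_mkcond _ mD).1.
  exact: (integrable_norm Ik).
move=> p _; rewrite patchE; case: ifPn => [/set_mem Dp|_].
  have g0 : 0 <= gs u p.1 * gs u p.2 by rewrite mulr_ge0 ?gs_ge0.
  rewrite /k mulr1 (normrM _ (F p)) (ger0_norm g0).
  by rewrite [M * _]mulrC; apply: ler_wpM2l => //; exact: FM.
by rewrite -[point]/(0 : R) mulr_ge0// mulr1 mulr_ge0 ?gs_ge0.
Qed.

Lemma continuous_gs_sqrt s t : 0 < t -> {for t, continuous (fun x => gs (Num.sqrt x) s)}.
Proof.
move=> t0; have s0 : 0 < Num.sqrt t by rewrite sqrtr_gt0.
have cg : {for Num.sqrt t, continuous (fun u => gs u s)}.
  have [/derivable1_diffP/differentiable_continuous//] := is_derive_gs_scale s s0.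
apply: (@continuous_comp _ _ _ Num.sqrt (fun u => gs u s)) => //.
exact: sqrt_continuous.
Qed.

(** The integral is continuous in time by dominated convergence: on a compact
    interval of positive times the kernel is at most a multiple of the kernel at
    the last time. *)
Lemma measurable_heat_integral (de : R) : measurable_fun `]0, de[ (fun t => N (Num.sqrt t)).
Proof.
apply: open_continuous_measurable_fun; first exact: interval_open.
move=> t; rewrite inE/= in_itv/= => /andP[t0 _].
pose v := t / 2; pose w := 2 * t.
have v0 : 0 < v by rewrite divr_gt0.
have w0 : 0 < w by rewrite mulr_gt0.
have I : t \in `]v, w[%classic by rewrite inE/= in_itv/= /v /w; apply/andP; split; lra.
have M0 : 0 <= M \/ D = set0.
  have [[p Dp]|nD] := pselect (exists p, D p).
    by left; apply: le_trans (FM Dp).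
  by right; apply/seteqP; split => // p Dp; apply: nD; exists p.
have [{}M0|D0] := M0; last first.
  have -> : (fun t => N (Num.sqrt t)) = cst 0.
    by apply/funext => x; rewrite /N D0 Rintegral_set0.
  exact: cst_continuous.
pose sv := Num.sqrt v; pose sw := Num.sqrt w.
have sv0 : 0 < sv by rewrite sqrtr_gt0.
have sw0 : 0 < sw by rewrite sqrtr_gt0.
apply: (@continuity_under_integral _ _ _ mm (fun t p => k (Num.sqrt t) p) D mD v w
  _ _ (fun p => M * (sw / sv) ^+ 2 * (gs sw p.1 * gs sw p.2 * 1))) => //.
- move=> x /=; rewrite in_itv/= => /andP[vx _].
  by apply: integrable_gs2_bounded; rewrite sqrtr_gt0 (lt_trans v0).
- apply/aeW => p Dp x; rewrite inE/= in_itv/= => /andP[vx _].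
  have x0 := lt_trans v0 vx.
  by apply: cvgM; [apply: cvgM; exact: continuous_gs_sqrt|exact: cvg_cst].
- have [I' _] := Rintegral_gs2 sw0.
  have ID : mm.-integrable D (EFin \o (fun p : mR * mR => gs sw p.1 * gs sw p.2 * 1)).
    by apply: integrableS I'.
  by apply: (@integrableZl _ _ _ mm _ _ (M * (sw / sv) ^+ 2) _ ID).
- move=> x /=; rewrite in_itv/= => /andP[vx xw]; apply/aeW => p Dp.
  have x0 := lt_trans v0 vx.
  have sx0 : 0 < Num.sqrt x by rewrite sqrtr_gt0.
  have h s : gs (Num.sqrt x) s <= sw / sv * gs sw s.
    rewrite /gs (_ : sw / sv * (_ / _) = expR (- (s ^+ 2 / (4 * sw ^+ 2))) *
      (sw / sv / (2 * sw * spi))); last by ring.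
    apply: ler_pM; rewrite ?expR_ge0//.
    - rewrite ler_expR lerN2 /sw !sqr_sqrtr ?(ltW w0) ?(ltW x0)//.
      rewrite ler_wpM2l ?sqr_ge0// lef_pV2 ?posrE ?mulr_gt0// ler_pM2l// ltW//.
    - have spN0 : 0 < spi := spi_gt0 R.
      have -> : sw / sv / (2 * sw * spi) = (2 * sv * spi)^-1.
        by field; rewrite !gt_eqF.
      rewrite lef_pV2 ?posrE ?mulr_gt0// ler_pM2r// ler_pM2l//.
      by rewrite ler_sqrt ltW.
  have g0 : 0 <= gs (Num.sqrt x) p.1 * gs (Num.sqrt x) p.2 by rewrite mulr_ge0 ?gs_ge0.
  rewrite /k (normrM _ (F p)) (ger0_norm g0).
  have -> : M * (sw / sv) ^+ 2 * (gs sw p.1 * gs sw p.2 * 1) =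
     (sw / sv * gs sw p.1) * (sw / sv * gs sw p.2) * M by ring.
  by apply: ler_pM; rewrite ?mulr_ge0 ?gs_ge0 ?FM//; apply: ler_pM; rewrite ?gs_ge0.
Qed.

End heat_integral.
End time_integration.

(** * Rotating the graph of the boundary *)
Section taylor1.
Variable R : realType.
Implicit Types (h s : R).

Lemma is_derive_sub_linear (f : R -> R) (k l y : R) : is_derive y (1 : R) f l ->
  is_derive y (1 : R) (fun h => f h - k * h) (l - k).
Proof. by move=> d; apply: is_derive_eq; rewrite /GRing.scale/=; ring. Qed.

Lemma taylor0 (f f1 : R -> R) (B rho : R) :
  (forall h : R, `|h| <= rho -> is_derive h (1 : R) f (f1 h)) ->
  (forall h, `|h| <= rho -> `|f1 h| <= B) ->
  forall h, `|h| <= rho -> `|f h - f 0| <= B * `|h| ^+ 1.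
Proof.
move=> d b h hr; apply: (@growth _ (fun h => f h - f 0) f1).
- by rewrite subrr.
- move=> y yh; have d' := d y (le_trans yh hr).
  by apply: is_derive_eq; rewrite subr0.
- by move=> y yh; rewrite expr0 mulr1; apply: b; exact: le_trans hr.
Qed.

(** The jets are taken at [0], and the derivatives are given as functions, so that
    the statement applies to translates of a smooth function. *)
Lemma taylor3 (f f1 f2 f3 f4 : R -> R) (B rho : R) :
  (forall h : R, `|h| <= rho -> is_derive h (1 : R) f (f1 h)) ->
  (forall h : R, `|h| <= rho -> is_derive h (1 : R) f1 (f2 h)) ->
  (forall h : R, `|h| <= rho -> is_derive h (1 : R) f2 (f3 h)) ->
  (forall h : R, `|h| <= rho -> is_derive h (1 : R) f3 (f4 h)) ->
  (forall h, `|h| <= rho -> `|f4 h| <= B) ->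
  forall h, `|h| <= rho ->
  `|f h - f 0 - (f1 0 * h + f2 0 / 2 * h ^+ 2 + f3 0 / 6 * h ^+ 3)| <= B * `|h| ^+ 4.
Proof.
move=> d d1 d2 d3 b.
have t3 := taylor0 d3 b.
have t2 h : `|h| <= rho -> `|f2 h - f2 0 - f3 0 * h| <= B * `|h| ^+ 2.
  move=> hr; apply: (@growth _ (fun h => f2 h - f2 0 - f3 0 * h) (fun h => f3 h - f3 0)).
  - by rewrite subrr mulr0 subr0.
  - move=> y yh; have d' := d2 y (le_trans yh hr).
    by apply: is_derive_eq; rewrite /GRing.scale/=; ring.
  - by move=> y yh; apply: t3; exact: le_trans hr.
have t1 h : `|h| <= rho ->
    `|f1 h - f1 0 - f2 0 * h - f3 0 / 2 * h ^+ 2| <= B * `|h| ^+ 3.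
  move=> hr; apply: (@growth _ (fun h => f1 h - f1 0 - f2 0 * h - f3 0 / 2 * h ^+ 2)
    (fun h => f2 h - f2 0 - f3 0 * h)).
  - by rewrite subrr expr0n/= !mulr0 !subr0.
  - move=> y yh; have d' := d1 y (le_trans yh hr).
    by apply: is_derive_eq; rewrite /GRing.scale/=; field.
  - by move=> y yh; apply: t2; exact: le_trans hr.
move=> h hr; apply: (@growth _ (fun h => f h - f 0 -
    (f1 0 * h + f2 0 / 2 * h ^+ 2 + f3 0 / 6 * h ^+ 3))
  (fun h => f1 h - f1 0 - f2 0 * h - f3 0 / 2 * h ^+ 2)).
- by rewrite subrr !expr0n/= !mulr0 !addr0 subr0.
- move=> y yh; have d' := d y (le_trans yh hr).
  by apply: is_derive_eq; rewrite /GRing.scale/=; field.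
- by move=> y yh; apply: t1; exact: le_trans hr.
Qed.

(** Taylor's formula alone does not compare two nearby values of [psi]: the last
    clause does, with a Lipschitz constant for the nonlinear part that is small
    near [0]. *)
Definition jet3 (psi : R -> R) (rho B p1 p2 p3 : R) : Prop :=
  [/\ 0 < rho, [/\ `|p1| <= B, `|p2| <= B & `|p3| <= B],
    forall h, `|h| <= rho ->
      `|psi h - (p1 * h + p2 * h ^+ 2 + p3 * h ^+ 3)| <= B * `|h| ^+ 4
  & forall h1 h2, `|h1| <= rho -> `|h2| <= rho ->
      `|psi h1 - psi h2 - p1 * (h1 - h2)| <= B * (`|h1| + `|h2|) * `|h1 - h2|].

Lemma le_sum4 (a b c d : R) : 0 <= a -> 0 <= b -> 0 <= c -> 0 <= d ->
  [/\ a <= a + b + c + d, b <= a + b + c + d, c <= a + b + c + d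
    & d <= a + b + c + d].
Proof. by move=> *; split; lra. Qed.

Lemma smooth_is_derive (A : set R) (phi : R -> R) k s : smooth_on A phi -> A s ->
  is_derive s (1 : R) (derive1n k phi) (derive1n k.+1 phi s).
Proof.
move=> sm As; rewrite derive1nS derive1E; apply/derivableP; exact: sm.
Qed.

(** On the closed half-interval the derivatives up to the fourth are bounded, which
    gives a constant valid at all base points near the centre. *)
Lemma smooth_jet3 (phi : R -> R) (eps : R) : 0 < eps ->
  smooth_on `]- eps, eps[ phi ->
  exists B, forall u0, `|u0| <= eps / 4 ->
    jet3 (fun h => phi (u0 + h) - phi u0) (eps / 4) B
      (derive1n 1 phi u0) (derive1n 2 phi u0 / 2) (derive1n 3 phi u0 / 6).
Proof.
move=> e0 sm; pose I : set R := `[- (eps / 2), eps / 2]%classic.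
have IE s : `|s| <= eps / 2 -> I s by rewrite ler_norml /I /= in_itv/=.
have Ie s : I s -> `]- eps, eps[%classic s.
  by rewrite /I /= !in_itv/= => /andP[? ?]; apply/andP; split; lra.
have dk k s : I s -> is_derive s (1 : R) (derive1n k phi) (derive1n k.+1 phi s).
  by move=> /Ie; exact: smooth_is_derive.
have bd k : exists B, forall s, I s -> `|derive1n k phi s| <= B.
  have cI : {within I, continuous (fun s => `|derive1n k phi s|)}.
    apply: continuous_in_subspaceT => s; rewrite inE => /(dk k) ds.
    have cs : {for s, continuous (derive1n k phi)}.
      by have [/derivable1_diffP/differentiable_continuous] := ds.
    by apply: continuous_comp cs _; exact: norm_continuous.
  have [|c _ cB] := EVT_max _ cI; first by lra.
  by exists `|derive1n k phi c| => s Is; apply: cB.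
have [B1 b1] := bd 1%N; have [B2 b2] := bd 2%N.
have [B3 b3] := bd 3%N; have [B4 b4] := bd 4%N.
have I0 : I 0 by apply: IE; rewrite normr0; lra.
have B1_0 := le_trans (normr_ge0 _) (b1 _ I0).
have B2_0 := le_trans (normr_ge0 _) (b2 _ I0).
have B3_0 := le_trans (normr_ge0 _) (b3 _ I0).
have B4_0 := le_trans (normr_ge0 _) (b4 _ I0).
have [le1 le2 le3 le4] := le_sum4 B1_0 B2_0 B3_0 B4_0.
exists (B1 + B2 + B3 + B4) => u0 u0e.
have Iu0 : I u0 by apply: IE; lra.
have Iu h : `|h| <= eps / 4 -> I (u0 + h).
  by move=> he; apply: IE; apply: (le_trans (ler_normD _ _)); lra.
have half (z k : R) : 1 <= k -> `|z / k| <= `|z|.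
  move=> k1; rewrite normrM; have k0 : 0 < k by lra.
  by rewrite [`|k^-1|]gtr0_norm ?invr_gt0// ler_piMr// invf_le1.
have dsh k h : `|h| <= eps / 4 ->
    is_derive h (1 : R) (fun y => derive1n k phi (u0 + y)) (derive1n k.+1 phi (u0 + h)).
  by move=> he; apply: is_derive_shift; apply: dk; exact: Iu.
have t0 h : `|h| <= eps / 4 ->
    `|phi (u0 + h) - phi u0 - (derive1n 1 phi u0 * h + derive1n 2 phi u0 / 2 * h ^+ 2
      + derive1n 3 phi u0 / 6 * h ^+ 3)| <= B4 * `|h| ^+ 4.
  move=> he.
  have := @taylor3 (fun y => phi (u0 + y)) (fun y => derive1n 1 phi (u0 + y))
    (fun y => derive1n 2 phi (u0 + y)) (fun y => derive1n 3 phi (u0 + y))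
    (fun y => derive1n 4 phi (u0 + y)) B4 (eps / 4) (dsh 0%N) (dsh 1%N) (dsh 2%N)
    (dsh 3%N) (fun y ye => b4 _ (Iu y ye)) h he.
  by rewrite !addr0.
have d1 h : `|h| <= eps / 4 ->
    `|derive1n 1 phi (u0 + h) - derive1n 1 phi u0| <= B2 * `|h|.
  move=> he.
  have := @taylor0 (fun y => derive1n 1 phi (u0 + y)) (fun y => derive1n 2 phi (u0 + y))
    B2 (eps / 4) (dsh 1%N) (fun y ye => b2 _ (Iu y ye)) h he.
  by rewrite addr0 expr1.
split; first by lra.
- split; first exact: le_trans (b1 _ Iu0) _.
  + by apply: (le_trans (half _ 2 _)); [rewrite ler1n|exact: le_trans (b2 _ Iu0) _].
  + by apply: (le_trans (half _ 6 _)); [rewrite ler1n|exact: le_trans (b3 _ Iu0) _].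
- move=> h he; apply: (le_trans (t0 h he)).
  by apply: ler_wpM2r => //; rewrite exprn_ge0.
- move=> h1 h2 h1e h2e.
  have btw y : h2 <= y <= h1 \/ h1 <= y <= h2 -> `|y| <= `|h1| + `|h2| /\ `|y| <= eps / 4.
    by move=> /le_norm_between[yh ye]; split => //; exact: ye.
  have -> : phi (u0 + h1) - phi u0 - (phi (u0 + h2) - phi u0) - derive1n 1 phi u0 * (h1 - h2)
    = (phi (u0 + h1) - derive1n 1 phi u0 * h1) - (phi (u0 + h2) - derive1n 1 phi u0 * h2).
    by ring.
  have dphi y : h2 <= y <= h1 \/ h1 <= y <= h2 ->
      is_derive y (1 : R) (fun h => phi (u0 + h)) (derive1n 1 phi (u0 + y)).
    by move=> /btw[_ ye]; exact: (dsh 0%N y ye).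
  move: (derive1n 1 phi u0) d1 dphi => k d1 dphi.
  apply: (@mvt_bound _ (fun h => phi (u0 + h) - k * h)
    (fun h => derive1n 1 phi (u0 + h) - k)).
    by move=> y ybt; apply: is_derive_sub_linear; exact: dphi.
  move=> y /btw[yh ye]; apply: (le_trans (d1 y ye)).
  exact: ler_pM.
Qed.

End taylor1.

Section rotate.
Variable R : realType.
Implicit Types (h s : R).

Section sandwich.
Variables (psi : R -> R) (rho B p1 p2 p3 C S : R).
Hypothesis J : jet3 psi rho B p1 p2 p3.
Hypotheses (C0 : 0 < C) (CS1 : C ^+ 2 + S ^+ 2 = 1) (SC : S = p1 * C).

(** Positive exactly on the region [v > psi u], in coordinates rotated by the angle
    with cosine [C] and sine [S]. *)
Definition rotE xi H : R := S * xi + C * H - psi (C * xi - S * H).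

(* The cubic graph on which [rotE] vanishes to third order, found by solving for
   [H] order by order; the relation [S = p1 * C] says that it is horizontal at 0. *)
Let al := p2 * C ^+ 3.
Let be := C * (p3 * C ^+ 3 - 2 * p2 * C * S * al).
Let P xi := al * xi ^+ 2 + be * xi ^+ 3.
Let A := 2 * B + 2 * B ^+ 2.
Definition Mrot : R :=
  2 * (2 * B * A + B * A ^+ 2 + 3 * B * A * (1 + A) ^+ 2 + B * (1 + A) ^+ 4).
Definition rhorot : R := rho / (6 * (1 + A) * (1 + B) * (1 + rho)).

Let B0 : 0 <= B. Proof. by case: J => _ [+ _ _] _ _; exact: le_trans. Qed.
Let A0 : 0 <= A. Proof. by rewrite /A addr_ge0// ?mulr_ge0// sqr_ge0. Qed.
Let rho0 : 0 < rho. Proof. by case: J. Qed.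
Let C1 : C <= 1.
Proof.
by rewrite -(expr_le1 (n := 2)) ?(ltW C0)// -CS1 lerDl sqr_ge0.
Qed.
Let S1 : `|S| <= 1.
Proof.
rewrite -(expr_le1 (n := 2))// real_normK ?num_real//.
by rewrite -CS1 lerDr sqr_ge0.
Qed.
Let CN : C != 0. Proof. by rewrite gt_eqF. Qed.

Lemma sandwich_alpha : `|al| <= B.
Proof.
have [_ [_ b2 _] _ _] := J; rewrite /al -[B]mulr1.
by apply: le_normM => //; rewrite normrX (gtr0_norm C0) exprn_ile1// ltW.
Qed.

Lemma sandwich_beta : `|be| <= B + 2 * B ^+ 2.
Proof.
have [_ [_ b2 b3] _ _] := J; rewrite /be -[leRHS]mul1r.
apply: le_normM; first by rewrite (gtr0_norm C0).
apply: (le_trans (ler_normB _ _)); apply: lerD.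
  rewrite -[B]mulr1; apply: le_normM => //.
  by rewrite normrX (gtr0_norm C0) exprn_ile1// ltW.
have -> : 2 * B ^+ 2 = 2 * B * 1 * 1 * B by ring.
apply: le_normM; last exact: sandwich_alpha.
apply: le_normM => //; apply: le_normM; last by rewrite (gtr0_norm C0).
by apply: le_normM => //; rewrite ger0_norm.
Qed.

Let denom_gt0 : 0 < 6 * (1 + A) * (1 + B) * (1 + rho).
Proof.
have h x : 0 <= x -> 0 < 1 + x by move=> x0; rewrite ltr_pwDl.
by rewrite !mulr_gt0// h// ltW.
Qed.

Lemma rhorot_gt0 : 0 < rhorot.
Proof. by rewrite divr_gt0. Qed.

Let rhorot_bound x : 0 <= x -> x <= rhorot ->
  [/\ x <= 1, 2 * x <= rho, (1 + A) * x <= rho & 2 * (B * ((3 + A) * x)) <= 1].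
Proof.
move=> x0; rewrite /rhorot ler_pdivlMr//.
move=> h.
have r0 : 0 <= rho := ltW rho0.
pose k := 6 * (1 + A) * x.
have k0 : 0 <= k by rewrite !mulr_ge0// addr_ge0.
have h' : k * ((1 + B) * (1 + rho)) <= rho.
  have -> : k * ((1 + B) * (1 + rho)) = x * (6 * (1 + A) * (1 + B) * (1 + rho)).
    by rewrite /k; ring.
  exact: h.
have h1 : k <= rho.
  apply: le_trans h'; rewrite ler_peMr// -[leLHS]mulr1.
  by apply: ler_pM; rewrite ?lerDl.
have h2 : k * (1 + B) <= 1.
  rewrite leNgt; apply/negP => g1.
  have : 1 * (1 + rho) < k * (1 + B) * (1 + rho) by rewrite ltr_pM2r// ltr_pwDl.
  by rewrite -mulrA => /lt_le_trans/(_ h'); rewrite mul1r ltNge lerDr ler01.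
have Ax : 0 <= A * x by rewrite mulr_ge0.
have Bx : 0 <= B * x by rewrite mulr_ge0.
have ABx : 0 <= B * (A * x) by rewrite mulr_ge0.
have kE : k = 6 * x + 6 * (A * x) by rewrite /k; ring.
have kBE : k * (1 + B) = 6 * x + 6 * (A * x) + 6 * (B * x) + 6 * (B * (A * x)).
  by rewrite /k; ring.
rewrite kE in h1; rewrite kBE in h2.
rewrite (_ : (1 + A) * x = x + A * x); last by ring.
rewrite (_ : B * ((3 + A) * x) = 3 * (B * x) + B * (A * x)); last by ring.
move: (A * x) (B * x) (B * _) Ax Bx ABx h1 h2 => a b c a0 b0 c0 h1 h2.
by split; lra.
Qed.

(** The coefficients [al] and [be] are chosen so that all terms of order at most
    three cancel; the terms left over are listed explicitly. *)
Lemma rotE_cubic xi : `|xi| <= rhorot -> `|rotE xi (P xi)| <= Mrot / 2 * xi ^+ 4.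
Proof.
move=> xr; have [x1 x2 xA _] := rhorot_bound (normr_ge0 _) xr.
have [_ [b1 b2 b3] Jt _] := J.
set x := `|xi| in x1 x2 xA xr.
have x0 : 0 <= x by exact: normr_ge0.
have PA : `|P xi| <= A * x ^+ 2.
  have -> : A * x ^+ 2 = B * x ^+ 2 + (B + 2 * B ^+ 2) * x ^+ 2 by rewrite /A; ring.
  apply: (le_trans (ler_normD _ _)); apply: lerD; apply: le_normM;
    rewrite ?sandwich_alpha ?sandwich_beta ?normrX//.
  by rewrite -/x ler_wiXn2l.
have PA' : `|P xi| <= A * x.
  by apply: (le_trans PA); rewrite ler_wpM2l// expr2 ler_piMl.
pose hP := C * xi - S * P xi.
have hPA : `|hP| <= (1 + A) * x.
  rewrite mulrDl mul1r; apply: (le_trans (ler_normB _ _)); apply: lerD.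
    by rewrite normrM (gtr0_norm C0) ler_piMl.
  by rewrite -[leRHS]mul1r; apply: le_normM.
have hPr : `|hP| <= rho by exact: le_trans xA.
have -> : rotE xi (P xi) =
   2 * p2 * C * S * be * xi ^+ 4 - p2 * (S ^+ 2 * P xi ^+ 2)
   + p3 * (S * (P xi * (hP ^+ 2 + hP * (C * xi) + (C * xi) ^+ 2)))
   - (psi hP - (p1 * hP + p2 * hP ^+ 2 + p3 * hP ^+ 3)).
  rewrite /rotE -/hP.
  have -> : psi hP = (psi hP - (p1 * hP + p2 * hP ^+ 2 + p3 * hP ^+ 3)) +
     (p1 * hP + p2 * hP ^+ 2 + p3 * hP ^+ 3) by ring.
  set T := psi hP - _.
  have -> : p3 * hP ^+ 3 = p3 * (C * xi) ^+ 3
     - p3 * (S * (P xi * (hP ^+ 2 + hP * (C * xi) + (C * xi) ^+ 2))).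
    by rewrite /hP; ring.
  set Q := p3 * (S * _).
  have -> : p2 * hP ^+ 2 = p2 * (C * xi) ^+ 2 - 2 * p2 * C * S * xi * P xi
      + p2 * (S ^+ 2 * P xi ^+ 2) by rewrite /hP; ring.
  have -> : p1 * hP = S * xi - p1 * S * P xi by rewrite /hP SC; ring.
  have E1 : C * P xi + p1 * S * P xi = P xi / C.
    have -> : p1 = S / C by rewrite SC mulfK.
    have -> : C * P xi + S / C * S * P xi = (C ^+ 2 + S ^+ 2) * P xi / C by field.
    by rewrite CS1 mul1r.
  have E2 : P xi / C = p2 * (C * xi) ^+ 2 + (p3 * C ^+ 3 - 2 * p2 * C * S * al) * xi ^+ 3.
    by rewrite /P /be /al; field.
  have E3 : 2 * p2 * C * S * xi * P xi = 2 * p2 * C * S * al * xi ^+ 3 +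
     2 * p2 * C * S * be * xi ^+ 4 by rewrite /P; ring.
  have -> : S * xi + C * P xi - (T + (S * xi - p1 * S * P xi +
     (p2 * (C * xi) ^+ 2 - 2 * p2 * C * S * xi * P xi + p2 * (S ^+ 2 * P xi ^+ 2)) +
     (p3 * (C * xi) ^+ 3 - Q))) = (C * P xi + p1 * S * P xi) - T -
     (p2 * (C * xi) ^+ 2 - 2 * p2 * C * S * xi * P xi + p2 * (S ^+ 2 * P xi ^+ 2)) -
     (p3 * (C * xi) ^+ 3 - Q) by ring.
  by rewrite E1 E2 E3; ring.
have -> : Mrot / 2 * xi ^+ 4 = 2 * B * 1 * 1 * A * x ^+ 4 + B * (1 * (A * x ^+ 2) ^+ 2) +
   B * (1 * ((A * x ^+ 2) * (((1 + A) * x) ^+ 2 + (1 + A) * x * ((1 + A) * x) +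
      ((1 + A) * x) ^+ 2))) + B * ((1 + A) * x) ^+ 4.
  have -> : xi ^+ 4 = x ^+ 4 by rewrite /x -normrX ger0_norm// exprn_even_ge0.
  by rewrite /Mrot; field.
have CxA : `|C * xi| <= (1 + A) * x.
  apply: le_normM => //; rewrite (gtr0_norm C0).
  by apply: (le_trans C1); rewrite lerDl.
have sq (y Y : R) : `|y| <= Y -> `|y ^+ 2| <= Y ^+ 2.
  by move=> yY; rewrite normrX lerXn2r ?nnegrE// (le_trans _ yY).
apply: (le_trans (ler_normB _ _)); apply: lerD; last first.
  apply: (le_trans (Jt _ hPr)); rewrite ler_wpM2l// lerXn2r ?nnegrE//.
  by rewrite mulr_ge0// addr_ge0.
apply: (le_trans (ler_normD _ _)); apply: lerD; last first.
  apply: le_normM => //; apply: le_normM => //; apply: le_normM => //.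
  split_norm_sum; [exact: sq|exact: le_normM|exact: sq].
apply: (le_trans (ler_normB _ _)); apply: lerD.
  apply: le_normM; last by rewrite normrX.
  apply: le_normM; last first.
    apply: (le_trans sandwich_beta).
    by rewrite /A (_ : 2 * B + _ = B + (B + 2 * B ^+ 2)) ?lerDr//; ring.
  apply: le_normM => //; apply: le_normM; last by rewrite (gtr0_norm C0).
  by apply: le_normM => //; rewrite ger0_norm.
apply: le_normM => //; apply: le_normM; last exact: sq.
by rewrite normrX -[leRHS](expr1n R 2) lerXn2r ?nnegrE.
Qed.

(** The rotated region is squeezed between two quartic perturbations of the cubic
    graph [P]: moving [H] away from [P xi] changes [rotE] at a rate at least
    one half, while [rotE] vanishes up to fourth order on the graph. *)
Lemma sandwich xi H : `|xi| <= rhorot -> `|H| <= rhorot ->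
  Mrot * xi ^+ 4 < `|H - P xi| -> (0 < rotE xi H <-> P xi < H).
Proof.
move=> xr Hr far.
have cub := rotE_cubic xr.
have [_ [b1 b2 b3] _ Jl] := J.
have [y1 y2 yA yB] : [/\ Num.max `|xi| `|H| <= 1, 2 * Num.max `|xi| `|H| <= rho,
   (1 + A) * Num.max `|xi| `|H| <= rho & 2 * (B * ((3 + A) * Num.max `|xi| `|H|)) <= 1].
  apply: rhorot_bound; first by rewrite le_max normr_ge0.
  by rewrite ge_max xr Hr.
set y := Num.max _ _ in y1 y2 yA yB.
have xy : `|xi| <= y by rewrite le_max lexx.
have Hy : `|H| <= y by rewrite le_max lexx orbT.
have y0 : 0 <= y by exact: le_trans xy.
have PA : `|P xi| <= A * y.
  have -> : A * y = B * y + (B + 2 * B ^+ 2) * y by rewrite /A; ring.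
  have xk k : `|xi| ^+ k.+1 <= y.
    rewrite exprS -[leRHS]mulr1; apply: ler_pM => //; rewrite ?exprn_ge0//.
    by rewrite exprn_ile1// (le_trans xy).
  by apply: (le_trans (ler_normD _ _)); apply: lerD; apply: le_normM;
    rewrite ?sandwich_alpha ?sandwich_beta ?normrX//.
pose h1 := C * xi - S * H; pose h2 := C * xi - S * P xi.
have Cx : `|C * xi| <= y.
  by rewrite normrM (gtr0_norm C0); apply: le_trans xy; rewrite ler_piMl.
have h1y : `|h1| <= 2 * y.
  have -> : 2 * y = y + 1 * y by ring.
  by apply: (le_trans (ler_normB _ _)); apply: lerD => //; apply: le_normM.
have h2y : `|h2| <= (1 + A) * y.
  have -> : (1 + A) * y = y + 1 * (A * y) by ring.
  by apply: (le_trans (ler_normB _ _)); apply: lerD => //; apply: le_normM.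
have := Jl h1 h2 (le_trans h1y y2) (le_trans h2y yA).
set T := psi h1 - psi h2 - p1 * (h1 - h2).
have hh : h1 - h2 = - S * (H - P xi) by rewrite /h1 /h2; ring.
have dE : rotE xi H - rotE xi (P xi) = (H - P xi) / C - T.
  have -> : rotE xi H - rotE xi (P xi) = (C + p1 * S) * (H - P xi) - T.
    by rewrite /T hh /rotE -/h1 -/h2; ring.
  have -> : p1 = S / C by rewrite SC mulfK.
  have -> : (C + S / C * S) * (H - P xi) = (C ^+ 2 + S ^+ 2) * (H - P xi) / C by field.
  by rewrite CS1 mul1r.
move=> TB.
have {}TB : `|T| <= 1 / 2 * `|H - P xi|.
  apply: (le_trans TB); rewrite hh normrM normrN mulrA; apply: ler_wpM2r => //.
  rewrite -[1 / 2]mulr1; apply: ler_pM => //; first by rewrite mulr_ge0// addr_ge0.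
  have : B * (`|h1| + `|h2|) <= B * ((3 + A) * y).
    by rewrite ler_wpM2l//; lra.
  lra.
have Ci : 1 <= C^-1 by rewrite invf_ge1.
have x4 : 0 <= xi ^+ 4 by rewrite exprn_even_ge0.
have [lt|ge] := ltP (P xi) H.
  split=> // _.
  have d0 : 0 < H - P xi by rewrite subr_gt0.
  have d1 : H - P xi <= (H - P xi) / C by rewrite ler_peMr// ltW.
  rewrite (gtr0_norm d0) in far TB.
  move: TB cub; rewrite !ler_norml => /andP[? ?] /andP[? ?]; lra.
split => // rE; suff : rotE xi H <= 0 by rewrite leNgt rE.
have d0 : H - P xi <= 0 by rewrite subr_le0.
have d1 : (H - P xi) / C <= H - P xi by rewrite ler_neMr.
rewrite (ler0_norm d0) in far TB.
move: TB cub; rewrite !ler_norml => /andP[? ?] /andP[? ?]; lra.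
Qed.

End sandwich.
End rotate.

Section identify.
Variable R : realType.

Lemma eq0_of_small (a L rho : R) : 0 < rho ->
  (forall x, 0 < x <= rho -> `|a| <= L * x) -> a = 0.
Proof.
move=> r0 H; apply/eqP; rewrite -normr_le0; apply/ler_addgt0Pr => e e0.
rewrite add0r; pose x := Num.min rho (e / (`|L| + 1)).
have L1 : 0 < `|L| + 1 by rewrite ltr_wpDl.
have x0 : 0 < x by rewrite lt_min r0 divr_gt0.
apply: (le_trans (H x _)); first by rewrite x0 ge_min lexx.
apply: (@le_trans _ _ ((`|L| + 1) * x)).
  by rewrite ler_pM2r// (le_trans (ler_norm _))// lerDl.
by rewrite mulrC -ler_pdivlMr// ge_min lexx orbT.
Qed.

Lemma poly2_eq0 (a b K rho : R) : 0 < rho ->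
  (forall x, 0 < x <= rho -> `|a * x + b * x ^+ 2| <= K * x ^+ 3) ->
  a = 0 /\ b = 0.
Proof.
move=> r0 H.
have K0 : 0 <= K.
  have := le_trans (normr_ge0 _) (H rho _); rewrite r0 lexx => /(_ isT).
  by rewrite pmulr_lge0// exprn_gt0.
have a0 : a = 0.
  pose rho1 := Num.min rho 1.
  apply: (@eq0_of_small a (`|b| + K) rho1); first by rewrite lt_min r0 ltr01.
  move=> x /andP[x0]; rewrite le_min => /andP[xr x1].
  have := H x; rewrite x0 xr => /(_ isT) Hx.
  rewrite -(ler_pM2r x0) -[X in _ * X <= _](gtr0_norm x0) -normrM.
  have -> : a * x = (a * x + b * x ^+ 2) - b * x ^+ 2 by ring.
  apply: (le_trans (ler_normB _ _)).
  have -> : (`|b| + K) * x * x = K * x ^+ 2 + `|b| * x ^+ 2 by ring.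
  apply: lerD.
    apply: (le_trans Hx); rewrite ler_wpM2l// exprSr ler_piMr//.
    by rewrite exprn_ge0// ltW.
  by rewrite normrM normrX (gtr0_norm x0).
split => //.
apply: (@eq0_of_small b K rho) => // x /andP[x0 xr].
have := H x; rewrite x0 xr a0 mul0r add0r => /(_ isT).
rewrite normrM normrX (gtr0_norm x0).
have -> : K * x ^+ 3 = K * x * x ^+ 2 by ring.
by rewrite ler_pM2r// exprn_gt0.
Qed.

Section graph.
Variables (psi g : R -> R) (rho B p1 p2 p3 C S k K rho' : R).
Hypothesis J : jet3 psi rho B p1 p2 p3.
Hypotheses (CS1 : C ^+ 2 + S ^+ 2 = 1) (r'0 : 0 < rho').
Hypothesis gk : forall xi, `|xi| <= rho' -> `|g xi - k * xi ^+ 2| <= K * `|xi| ^+ 3.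
Hypothesis gE : forall xi H, `|xi| <= rho' -> `|H| <= rho' ->
  0 < rotE psi C S xi H <-> g xi < H.

Let r0 : 0 < rho. Proof. by case: J. Qed.
Let B0 : 0 <= B. Proof. by case: J => _ [+ _ _] _ _; exact: le_trans. Qed.
Let G := `|k| + `|K|.
Let G0 : 0 <= G. Proof. by rewrite addr_ge0. Qed.
Let C1 : `|C| <= 1.
Proof.
by rewrite -(expr_le1 (n := 2))// real_normK ?num_real// -CS1 lerDl sqr_ge0.
Qed.
Let S1 : `|S| <= 1.
Proof.
by rewrite -(expr_le1 (n := 2))// real_normK ?num_real// -CS1 lerDr sqr_ge0.
Qed.
Let rho1 := Num.min 1 (Num.min (rho' / 2 / (1 + G)) (rho / 2 / (1 + G))).
Let G1 : 0 < 1 + G. Proof. by rewrite ltr_pwDl. Qed.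

Let rho1_gt0 : 0 < rho1.
Proof. by rewrite !lt_min ltr01 !divr_gt0. Qed.

Let small xi : `|xi| <= rho1 ->
  [/\ `|xi| <= 1, `|xi| <= rho', `|g xi| <= G * `|xi| ^+ 2, `|g xi| <= rho' / 2 &
      `|xi| + `|g xi| <= rho / 2 /\ `|xi| + `|g xi| <= (1 + G) * `|xi|].
Proof.
rewrite !le_min !(ler_pdivlMr _ _ G1) => /andP[x1 /andP[x2 x3]].
have x0 := normr_ge0 xi.
have xr' : `|xi| <= rho'.
  apply: (@le_trans _ _ (`|xi| * (1 + G))); first by rewrite ler_peMr// lerDl.
  by apply: (le_trans x2); rewrite ler_pdivrMr// ler_peMr// ?ler1n// ltW.
have g1 : `|g xi| <= G * `|xi| ^+ 2.
  have -> : g xi = k * xi ^+ 2 + (g xi - k * xi ^+ 2) by ring.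
  rewrite /G mulrDl; apply: (le_trans (ler_normD _ _)); apply: lerD.
    by rewrite normrM normrX.
  apply: (le_trans (gk xr')); apply: (@le_trans _ _ (`|K| * `|xi| ^+ 3)).
    by rewrite ler_wpM2r ?exprn_ge0// ler_norm.
  by rewrite ler_wpM2l// ler_wiXn2l.
have g2 : `|g xi| <= G * `|xi|.
  by apply: (le_trans g1); rewrite ler_wpM2l// expr2 ler_piMl.
have g3 : `|xi| + `|g xi| <= (1 + G) * `|xi| by rewrite mulrDl mul1r lerD2l.
split => //.
  by apply: (le_trans g2); apply: le_trans x2; rewrite mulrC ler_wpM2l// lerDr.
split => //.
by apply: (le_trans g3); rewrite mulrC.
Qed.

Let psi0 : psi 0 = 0.
Proof.
have [_ _ /(_ 0) + _] := J; rewrite normr0 => /(_ (ltW r0)).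
by rewrite !expr0n/= !mulr0 !addr0 subr0 normr_le0 => /eqP.
Qed.

(** The sign of [rotE] changes across the graph of [g], and [rotE] is continuous:
    it is not positive on the graph and positive just above it. *)
Lemma rotE_graph xi : `|xi| <= rho1 -> rotE psi C S xi (g xi) = 0.
Proof.
move=> /small[x1 xr' g1 g2 [gr _]].
have gr' : `|g xi| <= rho'.
  by apply: (le_trans g2); rewrite ler_pdivrMr// ler_peMr// ?ler1n// ltW.
apply/eqP; rewrite eq_le; apply/andP; split.
  by rewrite leNgt; apply/negP => /(gE xr' gr'); rewrite ltxx.
have [_ [b1 _ _] _ Jl] := J.
pose L := 1 + (B + 2 * B * rho).
have L0 : 0 < L by rewrite /L ltr_pwDl// addr_ge0// !mulr_ge0// ltW.
apply/ler_addgt0Pr => e e0.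
pose s := Num.min (Num.min (rho' / 2) (rho / 2)) (e / L).
have s0 : 0 < s by rewrite !lt_min !divr_gt0.
have [sr' sr sL] : [/\ s <= rho' / 2, s <= rho / 2 & s * L <= e].
  by split; rewrite -?ler_pdivlMr// /s !ge_min lexx ?orbT.
have gs' : `|g xi + s| <= rho'.
  apply: (le_trans (ler_normD _ _)); rewrite (gtr0_norm s0).
  by rewrite [rho']splitr lerD.
have Epos : 0 < rotE psi C S xi (g xi + s) by apply/gE => //; rewrite ltrDl.
pose h1 := C * xi - S * (g xi + s); pose h2 := C * xi - S * g xi.
have h2r : `|h2| <= rho / 2.
  apply: le_trans gr; apply: (le_trans (ler_normB _ _)).
  by rewrite lerD// normrM ler_piMl.
have h12 : h1 - h2 = - S * s by rewrite /h1 /h2; ring.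
have h12s : `|h1 - h2| <= s by rewrite h12 normrM normrN (gtr0_norm s0) ler_piMl// ltW.
have h1r : `|h1| <= rho.
  have -> : h1 = h2 + (h1 - h2) by ring.
  by rewrite [rho]splitr (le_trans (ler_normD _ _))// lerD// (le_trans h12s).
have h2r' : `|h2| <= rho.
  by apply: (le_trans h2r); rewrite ler_pdivrMr// ler_peMr// ?ler1n// ltW.
have psis : `|psi h1 - psi h2| <= (B + 2 * B * rho) * s.
  have -> : psi h1 - psi h2 = p1 * (h1 - h2) + (psi h1 - psi h2 - p1 * (h1 - h2)) by ring.
  rewrite mulrDl; apply: (le_trans (ler_normD _ _)); apply: lerD; first exact: le_normM.
  apply: (le_trans (Jl _ _ h1r h2r')).
  apply: ler_pM => //; first by rewrite mulr_ge0// addr_ge0.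
  have -> : 2 * B * rho = B * (rho + rho) by ring.
  by rewrite ler_wpM2l// lerD.
have : rotE psi C S xi (g xi + s) - rotE psi C S xi (g xi) <= L * s.
  have -> : rotE psi C S xi (g xi + s) - rotE psi C S xi (g xi) =
    C * s - (psi h1 - psi h2) by rewrite /rotE /h1 /h2; ring.
  rewrite /L mulrDl; apply: (le_trans (ler_norm _)).
  apply: (le_trans (ler_normB _ _)); apply: lerD => //.
  by apply: le_normM => //; rewrite gtr0_norm.
rewrite lerBlDr => H1; have := lt_le_trans Epos H1.
move=> /ltW/le_trans; apply; rewrite addrC lerD2l.
by rewrite mulrC.
Qed.

(** Inserting [g xi = k xi^2] in [rotE xi (g xi) = 0] and comparing the coefficients
    of [xi] and of [xi^2] determines the slope and the curvature.  That leaves the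
    sign of [C]: if [C] were negative, [rotE] would be negative just above the
    graph. *)
Lemma identify : [/\ 0 < C, S = p1 * C & k = p2 * C ^+ 3].
Proof.
have [_ [b1 b2 b3] Jt Jl] := J.
pose K3 := B * (1 + G) ^+ 3 + B * (1 + G) ^+ 4 + (1 + B) * `|K| + B * (2 * G + G ^+ 2).
have [] := @poly2_eq0 (S - p1 * C) ((C + p1 * S) * k - p2 * C ^+ 2) K3 rho1 rho1_gt0.
  move=> x /andP[x0 xr].
  have xn : `|x| = x by exact: gtr0_norm.
  have := @small x; rewrite xn => /(_ xr)[x1 xr' g1 g2 [gr gG]].
  have E0 := @rotE_graph x; rewrite xn in E0; have {}E0 := E0 xr.
  set h := C * x - S * g x.
  have hG : `|h| <= (1 + G) * x.
    apply: le_trans gG; apply: (le_trans (ler_normB _ _)); apply: lerD.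
      by rewrite normrM xn ler_piMl// ltW.
    by rewrite normrM ler_piMl.
  have hr : `|h| <= rho.
    apply: (@le_trans _ _ (rho / 2)).
      apply: le_trans gr; apply: (le_trans (ler_normB _ _)); apply: lerD.
        by rewrite normrM xn ler_piMl// ltW.
      by rewrite normrM ler_piMl.
    by rewrite ler_pdivrMr// ler_peMr// ?ler1n// ltW.
  pose q := g x - k * x ^+ 2.
  have qK : `|q| <= `|K| * x ^+ 3.
    have := @gk x; rewrite xn => /(_ xr')/le_trans; apply.
    by rewrite ler_wpM2r ?exprn_ge0 ?ler_norm// ltW.
  pose T := psi h - (p1 * h + p2 * h ^+ 2 + p3 * h ^+ 3).
  have -> : (S - p1 * C) * x + ((C + p1 * S) * k - p2 * C ^+ 2) * x ^+ 2 =
     p3 * h ^+ 3 + T - (C + p1 * S) * q - p2 * (2 * C * S * x * g x - S ^+ 2 * g x ^+ 2)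
     + rotE psi C S x (g x).
    by rewrite /T /rotE -/h /q; rewrite /h; ring.
  rewrite E0 addr0.
  have x4 : x ^+ 4 <= x ^+ 3 by rewrite ler_wiXn2l// ltW.
  have -> : K3 * x ^+ 3 = B * ((1 + G) ^+ 3 * x ^+ 3) + B * ((1 + G) ^+ 4 * x ^+ 3) +
     (1 + B) * (`|K| * x ^+ 3) + B * (2 * G * x ^+ 3 + G ^+ 2 * x ^+ 3).
    by rewrite /K3; ring.
  apply: (le_trans (ler_normB _ _)); apply: lerD; last first.
    apply: le_normM => //; apply: (le_trans (ler_normB _ _)); apply: lerD.
      have -> : 2 * G * x ^+ 3 = 2 * 1 * 1 * x * (G * x ^+ 2) by ring.
      apply: le_normM => //; apply: le_normM; last by rewrite xn.
      by apply: le_normM => //; apply: le_normM => //; rewrite ger0_norm.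
    have -> : G ^+ 2 * x ^+ 3 = 1 * (G ^+ 2 * x ^+ 3) by ring.
    apply: le_normM; first by rewrite normrX exprn_ile1.
    rewrite normrX; apply: (@le_trans _ _ ((G * x ^+ 2) ^+ 2)).
      by rewrite lerXn2r ?nnegrE// mulr_ge0// sqr_ge0.
    by rewrite exprMn -exprM ler_wpM2l ?sqr_ge0.
  apply: (le_trans (ler_normB _ _)); apply: lerD; last first.
    apply: le_normM => //; apply: (le_trans (ler_normD _ _)); apply: lerD => //.
    by rewrite -[B]mulr1; apply: le_normM.
  apply: (le_trans (ler_normD _ _)); apply: lerD.
    apply: le_normM => //; rewrite normrX -exprMn lerXn2r ?nnegrE// mulr_ge0// ltW//.
  apply: (le_trans (Jt _ hr)); rewrite ler_wpM2l//.
  apply: (@le_trans _ _ (((1 + G) * x) ^+ 4)).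
    by rewrite lerXn2r ?nnegrE// mulr_ge0// ltW.
  by rewrite exprMn ler_wpM2l// exprn_ge0// ltW.
move=> /eqP; rewrite subr_eq0 => /eqP SC /eqP; rewrite subr_eq0 => /eqP kE.
have C2 : C ^+ 2 * (1 + p1 ^+ 2) = 1 by rewrite -[RHS]CS1 SC; ring.
have CN : C != 0 by apply/eqP => C0; move: C2; rewrite C0 expr0n/= mul0r => /eqP; rewrite eq_sym oner_eq0.
have g0 : g 0 = 0.
  have := @gk 0; rewrite normr0 => /(_ (ltW r'0)).
  by rewrite !expr0n/= !mulr0 subr0 normr_le0 => /eqP.
have Cge0 : 0 <= C.
  rewrite leNgt; apply/negP => Cneg.
  have CSp : C + p1 * S = C^-1.
    by rewrite SC -[LHS](mulfK CN) (_ : (C + p1 * (p1 * C)) * C = C ^+ 2 * (1 + p1 ^+ 2));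
      [rewrite C2 mul1r|ring].
  have Ci : C^-1 < 0 by rewrite invr_lt0.
  suff : C^-1 = 0 by move=> h; move: Ci; rewrite h ltxx.
  apply: (@eq0_of_small _ B (Num.min rho' rho)); first by rewrite lt_min r'0.
  move=> x /andP[x0]; rewrite le_min => /andP[xr' xr].
  have xn : `|x| = x by exact: gtr0_norm.
  have Ep : 0 < rotE psi C S 0 x.
    by apply/gE; rewrite ?normr0 ?xn ?g0// ltW.
  have Sx : `|- S * x| <= x by rewrite normrM normrN xn ler_piMl// ltW.
  have := Jl (- S * x) 0; rewrite normr0.
  move=> /(_ (le_trans Sx xr) (ltW r0)); rewrite psi0 !subr0 addr0 => Hj.
  have {}Hj : `|psi (- S * x) - p1 * (- S * x)| <= B * x * x.
    apply: (le_trans Hj); apply: ler_pM => //; first by rewrite mulr_ge0.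
    by rewrite ler_wpM2l.
  move: Ep; rewrite /rotE mulr0 add0r mulr0 add0r -mulNr => Ep.
  rewrite ltr0_norm// -CSp.
  rewrite -(ler_pM2r x0).
  have -> : - (C + p1 * S) * x = - (C * x - psi (- S * x)) - (psi (- S * x) - p1 * (- S * x)).
    by ring.
  apply: (@le_trans _ _ (0 + `|psi (- S * x) - p1 * (- S * x)|)); last by rewrite add0r.
  apply: lerD; first by rewrite oppr_le0 ltW.
  by rewrite -normrN ler_norm.
split => //; first by rewrite lt_neqAle eq_sym CN.
have : (C + p1 * S) * k * C = p2 * C ^+ 2 * C by rewrite kE.
have -> : (C + p1 * S) * k * C = C ^+ 2 * (1 + p1 ^+ 2) * k by rewrite SC; ring.
by rewrite C2 mul1r => ->; ring.
Qed.

End graph.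
End identify.

(** * Uniform description of the boundary *)
Section charts.
Variable R : realType.
Implicit Types (x y z b n m o p q : R * R) (N : R).

(** The inverse of [frame o m] when [m] is a unit vector. *)
Definition coords o m y : R * R :=
  ((y.1 - o.1) * m.2 - (y.2 - o.2) * m.1, (y.1 - o.1) * m.1 + (y.2 - o.2) * m.2).

Lemma enorm1 m : enorm m = 1 -> m.1 ^+ 2 + m.2 ^+ 2 = 1.
Proof. by move=> m1; rewrite -enorm_sqr m1 expr1n. Qed.

Lemma enormN p : enorm (- p) = enorm p.
Proof. by rewrite /enorm /= !sqrrN. Qed.

Lemma enorm_triangle p q : enorm (p + q) <= enorm p + enorm q.
Proof.
have p0 := enorm_ge0 p; have q0 := enorm_ge0 q.
apply: enorm_le; first by rewrite addr_ge0.
have pq : p.1 * q.1 + p.2 * q.2 <= enorm p * enorm q.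
  apply: (le_trans (ler_norm _)).
  rewrite -(ler_pXn2r (n := 2)) ?nnegrE ?mulr_ge0// real_normK ?num_real//.
  rewrite exprMn !enorm_sqr -subr_ge0.
  by apply: (le_trans (sqr_ge0 (p.1 * q.2 - p.2 * q.1))); rewrite le_eqVlt;
    apply/orP; left; apply/eqP; ring.
have -> : (enorm p + enorm q) ^+ 2 =
  enorm p ^+ 2 + enorm q ^+ 2 + 2 * (enorm p * enorm q) by ring.
by rewrite !enorm_sqr /=; move: (enorm p * enorm q) pq => w pq; nra.
Qed.

Lemma coordsK o m y : enorm m = 1 -> frame o m (coords o m y) = y.
Proof.
move=> /enorm1 m1; case: y => y1 y2; rewrite /frame /coords /=; congr (_, _).
  transitivity (o.1 + (y1 - o.1) * (m.1 ^+ 2 + m.2 ^+ 2)); first by ring.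
  by rewrite m1; ring.
transitivity (o.2 + (y2 - o.2) * (m.1 ^+ 2 + m.2 ^+ 2)); first by ring.
by rewrite m1; ring.
Qed.

Lemma enorm_coords o m y z : enorm m = 1 ->
  enorm (coords o m y - coords o m z) = enorm (y - z).
Proof.
move=> /enorm1 m1; rewrite /enorm; congr Num.sqrt; rewrite /coords /=.
transitivity (((y.1 - z.1) ^+ 2 + (y.2 - z.2) ^+ 2) * (m.1 ^+ 2 + m.2 ^+ 2)).
  by ring.
by rewrite m1 mulr1.
Qed.

Lemma coords_le o m y z : enorm m = 1 ->
  `|(coords o m y).1 - (coords o m z).1| <= enorm (y - z) /\
  `|(coords o m y).2 - (coords o m z).2| <= enorm (y - z).
Proof.
move=> m1; rewrite -(enorm_coords o y z m1); split.
  exact: (normr_le_enorm1 (coords o m y - coords o m z)).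
exact: (normr_le_enorm2 (coords o m y - coords o m z)).
Qed.

Lemma coords_self o m : coords o m o = (0, 0).
Proof. by rewrite /coords !subrr !mul0r subrr addr0. Qed.

Lemma closure_enorm (A : set (R * R)) b e : closure A b -> 0 < e ->
  exists y, A y /\ enorm (y - b) < e.
Proof.
move=> cA e0; have e20 : 0 < e / 3 by rewrite divr_gt0.
have [y [Ay [y1 y2]]] := cA _ (nbhsx_ballx b (PosNum e20)%:num e20).
exists y; split => //; apply: (le_lt_trans (enorm_le_sum _)).
rewrite /ball/= in y1 y2; rewrite /= distrC [`|y.2 - _|]distrC.
apply: (lt_le_trans (ltrD y1 y2)); lra.
Qed.

Lemma nbhs_enorm b e : 0 < e -> nbhs b [set y | enorm (y - b) < e].
Proof.
move=> e0; have e20 : 0 < e / 3 by rewrite divr_gt0.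
apply: filterS (nbhsx_ballx b _ e20) => y [y1 y2] /=.
apply: (le_lt_trans (enorm_le_sum _)).
rewrite /ball/= in y1 y2; rewrite /= distrC [`|y.2 - _|]distrC.
apply: (lt_le_trans (ltrD y1 y2)); lra.
Qed.

Definition leg (Omega : set (R * R)) (L : R) z z' : Prop :=
  [/\ forall s : R, 0 <= s <= 1 ->
        Omega (z.1 + s * (z'.1 - z.1), z.2 + s * (z'.2 - z.2)),
      `|z'.1 - z.1| <= L & `|z'.2 - z.2| <= L].

(** A substitute for convexity: a segment between two points near the boundary may
    leave [Omega], but three segments are enough to go around the obstacle. *)
Definition linked Omega N x y : Prop :=
  exists z1 z2, [/\ leg Omega (N * enorm (y - x)) x z1,
    leg Omega (N * enorm (y - x)) z1 z2 & leg Omega (N * enorm (y - x)) z2 y].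

(** What the expansion uses of the boundary near [b], with one constant [N], so
    that compactness can make [N] independent of [b].  The cubic coefficient [be] contributes a term that is odd in the
    tangential variable and integrates to zero. *)
Definition regular_at (Omega : set (R * R)) N b : Prop :=
  (forall x n gamma, enorm (b - x) < N^-1 -> adapted_coordinates Omega x b n gamma ->
   exists be, [/\ `|derive1n 2 gamma 0| <= N, `|be| <= N &
     forall p, enorm p < N^-1 ->
       let P := - enorm (b - x) + (derive1n 2 gamma 0 / 2 * p.1 ^+ 2 + be * p.1 ^+ 3) in
       N * p.1 ^+ 4 < `|p.2 - P| -> Omega (frame x n p) <-> P < p.2]) /\
  (forall x y, Omega x -> Omega y -> enorm (b - x) < N^-1 -> enorm (y - x) < N^-1 ->
   linked Omega N x y).

Section local.
Variables (Omega : set (R * R)) (b0 m : R * R) (phi : R -> R) (eps B : R).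
Hypotheses (oO : open Omega) (m1 : enorm m = 1) (phi0 : phi 0 = 0) (e0 : 0 < eps).
Hypothesis sm : smooth_on `]- eps, eps[ phi.
Hypothesis Oe : forall p, enorm p < eps -> Omega (frame b0 m p) <-> phi p.1 < p.2.
Hypothesis J : forall u0, `|u0| <= eps / 4 ->
    jet3 (fun h => phi (u0 + h) - phi u0) (eps / 4) B
      (derive1n 1 phi u0) (derive1n 2 phi u0 / 2) (derive1n 3 phi u0 / 6).

Let B0 : 0 <= B.
Proof.
have [|_ [+ _ _] _ _] := J (u0 := 0); first by rewrite normr0 divr_ge0// ltW.
exact: le_trans.
Qed.

Let lip u u' : `|u| <= eps / 4 -> `|u'| <= eps / 4 ->
  `|phi u - phi u'| <= B * `|u - u'|.
Proof.
move=> ue u'e; apply: (@mvt_bound _ phi (derive1n 1 phi)).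
  move=> y ybt; have [_ ye] := le_norm_between ybt.
  have {}ye := ye _ ue u'e.
  apply: (@smooth_is_derive _ _ phi 0 y sm).
  by move: ye; rewrite ler_norml /= in_itv/= => /andP[? ?]; have := e0 => e0'; apply/andP; split; lra.
move=> y ybt; have [_ ye] := le_norm_between ybt.
by have [_ [+ _ _] _ _] := J (ye _ ue u'e).
Qed.

Let chart y : enorm (y - b0) < eps ->
  Omega y <-> phi (coords b0 m y).1 < (coords b0 m y).2.
Proof.
move=> ye; rewrite -{1}(coordsK b0 y m1); apply: Oe.
move: ye; rewrite -(enorm_coords b0 y b0 m1) coords_self.
by have -> : coords b0 m y - (0, 0) = coords b0 m y by exact: subr0.
Qed.

(** Above the graph [b] would be interior; below it, as the graph is Lipschitz,
    [b] would be at a positive distance from [Omega]. *)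
Lemma frontier_graph b : frontier Omega b -> enorm (b - b0) < eps / 8 ->
  (coords b0 m b).2 = phi (coords b0 m b).1.
Proof.
move=> [cb nb] be; have e0' : 0 < eps by exact: e0.
have [u0e v0e] := coords_le b0 b b0 m1.
rewrite coords_self/= !subr0 in u0e v0e.
apply/eqP; rewrite eq_le; apply/andP; split.
  rewrite leNgt; apply/negP => lt; apply: nb.
  by move/interior_id : oO => ->; apply/chart => //; lra.
rewrite leNgt; apply/negP => lt.
set u0 := (coords b0 m b).1 in u0e lt; set v0 := (coords b0 m b).2 in v0e lt.
pose d := phi u0 - v0; have d0 : 0 < d by rewrite subr_gt0.
pose e := Num.min (eps / 8) (d / (1 + B)).
have B1 : 0 < 1 + B by rewrite ltr_pwDl.
have e'0 : 0 < e by rewrite lt_min !divr_gt0.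
have [y [Oy ye]] := closure_enorm cb e'0.
have [ue ve] := coords_le b0 y b m1.
set u := (coords b0 m y).1 in ue; set v := (coords b0 m y).2 in ve.
have ye8 : enorm (y - b) < eps / 8 by apply: lt_le_trans ye _; rewrite ge_min lexx.
have yd : enorm (y - b) * (1 + B) < d.
  by rewrite -ltr_pdivlMr//; apply: lt_le_trans ye _; rewrite ge_min lexx orbT.
have u4 : `|u| <= eps / 4.
  have -> : u = (u - u0) + u0 by rewrite subrK.
  by apply: (le_trans (ler_normD _ _)); lra.
have u04 : `|u0| <= eps / 4 by lra.
have yb0 : enorm (y - b0) < eps.
  rewrite -(enorm_coords b0 y b0 m1) coords_self.
  apply: (le_lt_trans (enorm_le_sum _)); rewrite /= !subr0 -/u -/v.
  have : `|v| <= eps / 4.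
    have -> : v = (v - v0) + v0 by rewrite subrK.
    by apply: (le_trans (ler_normD _ _)); lra.
  lra.
have /(chart yb0) := Oy; rewrite -/u -/v.
have := lip u4 u04.
have uB : B * `|u - u0| <= B * enorm (y - b) by rewrite ler_wpM2l.
rewrite ltNge => l1; apply/negP; rewrite negbK.
move: ve l1; rewrite !ler_norml => /andP[_ h1] /andP[h2 _].
rewrite /d in yd; lra.
Qed.

Let chart_frame p : `|p.1| <= eps / 4 -> `|p.2| <= eps / 4 ->
  Omega (frame b0 m p) <-> phi p.1 < p.2.
Proof.
move=> h1 h2; apply: Oe; apply: (le_lt_trans (enorm_le_sum _)).
by have e0' := e0; lra.
Qed.

Let chart_leg q q' L :
  (forall s, 0 <= s <= 1 -> let p := (q.1 + s * (q'.1 - q.1), q.2 + s * (q'.2 - q.2)) in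
     [/\ `|p.1| <= eps / 4, `|p.2| <= eps / 4 & phi p.1 < p.2]) ->
  `|q'.1 - q.1| + `|q'.2 - q.2| <= L ->
  leg Omega L (frame b0 m q) (frame b0 m q').
Proof.
move=> H qL.
have mn : `|m.1| <= 1 /\ `|m.2| <= 1.
  by rewrite -m1 normr_le_enorm1 normr_le_enorm2.
case: mn => mn1 mn2; split.
- move=> s /H[/= h1 h2 h3].
  have := (@chart_frame (q.1 + s * (q'.1 - q.1), q.2 + s * (q'.2 - q.2)) h1 h2).2 h3.
  rewrite /frame/=; congr Omega; congr (_, _); ring.
- rewrite /frame/=; apply: le_trans qL.
  have -> : b0.1 + q'.1 * m.2 + q'.2 * m.1 - (b0.1 + q.1 * m.2 + q.2 * m.1) =
    (q'.1 - q.1) * m.2 + (q'.2 - q.2) * m.1 by ring.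
  apply: (le_trans (ler_normD _ _)); apply: lerD.
    by rewrite normrM ler_piMr.
  by rewrite normrM ler_piMr.
- rewrite /frame/=; apply: le_trans qL.
  have -> : b0.2 - q'.1 * m.1 + q'.2 * m.2 - (b0.2 - q.1 * m.1 + q.2 * m.2) =
    - (q'.1 - q.1) * m.1 + (q'.2 - q.2) * m.2 by ring.
  apply: (le_trans (ler_normD _ _)); apply: lerD.
    by rewrite normrM normrN ler_piMr.
  by rewrite normrM ler_piMr.
Qed.

Let convex_le (a b c s : R) : 0 <= s <= 1 -> `|a| <= c -> `|b| <= c ->
  `|a + s * (b - a)| <= c.
Proof.
move=> /andP[s0 s1]; rewrite !ler_norml => /andP[h1 h2] /andP[h3 h4].
by apply/andP; split; nra.
Qed.

(* Up to the height [h], which exceeds both heights by enough to stay above the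
   graph in between, then across, then down. *)
Let linked_coords (N d u1 v1 u2 v2 : R) : 1 + B <= N -> 0 <= d ->
  d + B * d <= eps / 8 -> `|u1| <= eps / 8 -> `|v1| <= eps / 8 ->
  `|u2 - u1| <= d -> `|v2 - v1| <= d -> phi u1 < v1 -> phi u2 < v2 ->
  exists z1 z2, [/\ leg Omega (N * d) (frame b0 m (u1, v1)) z1,
    leg Omega (N * d) z1 z2 & leg Omega (N * d) z2 (frame b0 m (u2, v2))].
Proof.
move=> BN d0 yx ux vx uy vy hx hy.
have e0' : 0 < eps by exact: e0.
have Bd : 0 <= B * d by rewrite mulr_ge0.
have uB : B * `|u2 - u1| <= B * d by rewrite ler_wpM2l.
have uB0 : 0 <= B * `|u2 - u1| by rewrite mulr_ge0.
pose h := Num.max v1 v2 + B * `|u2 - u1|.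
have h1 : v1 <= h by rewrite /h; apply: (le_trans (_ : v1 <= Num.max v1 v2)); rewrite ?le_max ?lexx// lerDl.
have h2 : v2 <= h by rewrite /h; apply: (le_trans (_ : v2 <= Num.max v1 v2)); rewrite ?le_max ?lexx ?orbT// lerDl.
have u2e : `|u2| <= eps / 4.
  by have := ler_normD (u2 - u1) u1; rewrite subrK; lra.
have u1e : `|u1| <= eps / 4 by lra.
have v2e : `|v2| <= eps / 4.
  by have := ler_normD (v2 - v1) v1; rewrite subrK; lra.
have v1e : `|v1| <= eps / 4 by lra.
have hv1 : h - v1 <= d + B * d.
  rewrite /h; move: vy; rewrite ler_norml => /andP[? ?].
  have : Num.max v1 v2 <= v1 + d by rewrite ge_max; apply/andP; split; lra.
  lra.
have hv2 : h - v2 <= d + B * d.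
  rewrite /h; move: vy; rewrite ler_norml => /andP[? ?].
  have : Num.max v1 v2 <= v2 + d by rewrite ge_max; apply/andP; split; lra.
  lra.
have he : `|h| <= eps / 4.
  move: vx v1e; rewrite !ler_norml => /andP[? ?] /andP[? ?].
  by apply/andP; split; lra.
have Nd : d + B * d <= N * d.
  have -> : d + B * d = (1 + B) * d by ring.
  by rewrite ler_wpM2r.
exists (frame b0 m (u1, h)), (frame b0 m (u2, h)); split; apply: chart_leg => /=.
- move=> s s01; split.
  + by rewrite subrr mulr0 addr0.
  + exact: convex_le.
  + rewrite subrr mulr0 addr0; apply: (lt_le_trans hx).
    by case/andP: s01 => s0 _; rewrite lerDl mulr_ge0// subr_ge0.
- by rewrite subrr normr0 add0r ger0_norm ?subr_ge0//; lra.
- move=> s s01; have ce := convex_le s01 u1e u2e; split => //.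
  + by rewrite subrr mulr0 addr0.
  + rewrite subrr mulr0 addr0.
    have := lip ce u1e; rewrite addrAC subrr add0r ler_norml => /andP[_ l1].
    have su : B * `|s * (u2 - u1)| <= B * `|u2 - u1|.
      case/andP: s01 => s0 s1.
      by rewrite ler_wpM2l// normrM (ger0_norm s0) ler_piMl.
    have : v1 <= Num.max v1 v2 by rewrite le_max lexx.
    by rewrite /h; lra.
- by rewrite subrr normr0 addr0; lra.
- move=> s s01; split.
  + by rewrite subrr mulr0 addr0.
  + exact: convex_le.
  + rewrite subrr mulr0 addr0; apply: (lt_le_trans hy).
    case/andP: s01 => s0 s1.
    have -> : h + s * (v2 - h) = v2 + (1 - s) * (h - v2) by ring.
    by rewrite lerDl mulr_ge0// subr_ge0.
- by rewrite subrr normr0 add0r distrC ger0_norm ?subr_ge0//; lra.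
Qed.

(** In the chart the domain lies above a Lipschitz graph. *)
Lemma local_linked N x y : 1 + B <= N -> enorm (x - b0) <= eps / 8 ->
  (1 + B) * enorm (y - x) <= eps / 8 ->
  Omega x -> Omega y -> linked Omega N x y.
Proof.
move=> BN xb yx Ox Oy.
have e0' : 0 < eps by exact: e0.
have [ux vx] := coords_le b0 x b0 m1; rewrite coords_self/= !subr0 in ux vx.
have [uy vy] := coords_le b0 y x m1.
have d0 : 0 <= enorm (y - x) by exact: enorm_ge0.
have Bd : 0 <= B * enorm (y - x) by rewrite mulr_ge0.
rewrite mulrDl mul1r in yx.
have xe : enorm (x - b0) < eps by lra.
have /(chart xe) hx := Ox.
have ye : enorm (y - b0) < eps.
  rewrite -(enorm_coords b0 y b0 m1) coords_self.
  have -> : coords b0 m y - (0, 0) = coords b0 m y by exact: subr0.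
  apply: (le_lt_trans (enorm_le_sum _)).
  rewrite -[(coords b0 m y).1](subrK (coords b0 m x).1).
  rewrite -[(coords b0 m y).2](subrK (coords b0 m x).2).
  apply: (le_lt_trans (lerD (ler_normD _ _) (ler_normD _ _))).
  apply: (le_lt_trans (lerD (lerD uy ux) (lerD vy vx))).
  lra.
have /(chart ye) hy := Oy.
have := linked_coords BN d0 yx (le_trans ux xb) (le_trans vx xb) uy vy hx hy.
by rewrite -!surjective_pairing !coordsK.
Qed.

Let rr := rhorot (eps / 4) B.
Let MM := Mrot B.

Let rr0 : 0 < rr.
Proof.
have h : `|0 : R| <= eps / 4 by rewrite normr0 divr_ge0// ltW.
exact: (rhorot_gt0 (J h)).
Qed.

(** In any frame adapted to a boundary point of the chart the boundary is a
    rotated copy of the graph of [phi]; the adapted graph serves only to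
    identify the angle and the curvature. *)
Lemma local_sandwich x b n gamma : frontier Omega b -> enorm (b - b0) < eps / 8 ->
  adapted_coordinates Omega x b n gamma ->
  exists be, [/\ `|derive1n 2 gamma 0| <= 2 * B, `|be| <= B + 2 * B ^+ 2 &
    forall xi H, `|xi| <= rr -> `|H| <= rr -> `|xi| <= eps / 8 -> `|H| <= eps / 8 ->
      MM * xi ^+ 4 < `|H - (derive1n 2 gamma 0 / 2 * xi ^+ 2 + be * xi ^+ 3)| ->
      Omega (frame x n (xi, H - enorm (b - x))) <->
      derive1n 2 gamma 0 / 2 * xi ^+ 2 + be * xi ^+ 3 < H].
Proof.
move=> fb bb0 [n1 xb g0 dg0 [eps' e'0 [smg Og]]].
have e0' : 0 < eps by exact: e0.
have vphi := frontier_graph fb bb0.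
have [u0e v0e] := coords_le b0 b b0 m1.
rewrite coords_self/= !subr0 in u0e v0e.
set u0 := (coords b0 m b).1 in vphi u0e; set v0 := (coords b0 m b).2 in vphi v0e.
have u04 : `|u0| <= eps / 4 by lra.
have Ju := J u04.
set r := enorm (b - x) in xb g0 Og *.
pose C := n.1 * m.1 + n.2 * m.2; pose S := n.2 * m.1 - n.1 * m.2.
have CS1 : C ^+ 2 + S ^+ 2 = 1.
  transitivity ((n.1 ^+ 2 + n.2 ^+ 2) * (m.1 ^+ 2 + m.2 ^+ 2)).
    by rewrite /C /S; ring.
  by rewrite (enorm1 n1) (enorm1 m1) mulr1.
pose psi h := phi (u0 + h) - phi u0.
have fE xi H : frame x n (xi, H - r) =
    frame b0 m (u0 + (C * xi - S * H), v0 + (S * xi + C * H)).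
  rewrite -(coordsK b0 (frame x n (xi, H - r)) m1); congr (frame b0 m _).
  have x1 : x.1 = b.1 + r * n.1 by rewrite -xb /frame/=; ring.
  have x2 : x.2 = b.2 + r * n.2 by rewrite -xb /frame/=; ring.
  by rewrite /coords /frame/= x1 x2 /u0 /v0 /coords/= /C /S; congr (_, _); ring.
have C1 : `|C| <= 1.
  by rewrite -(expr_le1 (n := 2))// real_normK ?num_real// -CS1 lerDl sqr_ge0.
have S1 : `|S| <= 1.
  by rewrite -(expr_le1 (n := 2))// real_normK ?num_real// -CS1 lerDr sqr_ge0.
have OE xi H : `|xi| <= eps / 8 -> `|H| <= eps / 8 ->
    Omega (frame x n (xi, H - r)) <-> 0 < rotE psi C S xi H.
  move=> xie He; rewrite fE.
  have b1 (a s w t c : R) : `|a| <= eps / 8 -> `|s| <= 1 -> `|w| <= eps / 8 ->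
      `|t| <= 1 -> `|c| <= eps / 8 -> `|a + (s * w + t * c)| < eps / 2.
    move=> ha hs hw ht hc.
    have sw : `|s * w| <= 1 * (eps / 8) by exact: le_normM.
    have tc : `|t * c| <= 1 * (eps / 8) by exact: le_normM.
    apply: (le_lt_trans (ler_normD _ _)).
    apply: (le_lt_trans (lerD ha (ler_normD _ _))).
    apply: (le_lt_trans (lerD (lexx _) (lerD sw tc))); lra.
  have -> : Omega (frame b0 m (u0 + (C * xi - S * H), v0 + (S * xi + C * H))) <->
     phi (u0 + (C * xi - S * H)) < v0 + (S * xi + C * H).
    apply: Oe; apply: (le_lt_trans (enorm_le_sum _)) => /=.
    have u8 : `|u0| <= eps / 8 by lra.
    have v8 : `|v0| <= eps / 8 by lra.
    have := ltrD (b1 u0 C xi (- S) H u8 C1 xie _ He) (b1 v0 S xi C H v8 S1 xie C1 He).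
    rewrite normrN mulNr => /(_ S1) /lt_le_trans; apply; lra.
  rewrite /rotE /psi vphi; split => h; first by move: h; rewrite -subr_gt0 => h; apply: (lt_le_trans h); rewrite le_eqVlt; apply/orP; left; apply/eqP; ring.
  by move: h; rewrite -[in X in _ -> X]subr_gt0 => h; apply: (lt_le_trans h); rewrite le_eqVlt; apply/orP; left; apply/eqP; ring.
have [Bg Jg] := smooth_jet3 e'0 smg.
have {}Jg : jet3 (fun h => gamma (0 + h) - gamma 0) (eps' / 4) Bg (derive1n 1 gamma 0)
    (derive1n 2 gamma 0 / 2) (derive1n 3 gamma 0 / 6).
  by apply: Jg; rewrite normr0 divr_ge0// ltW.
pose g xi := gamma xi + r.
pose rho' := Num.min (Num.min (eps' / 4) 1) (eps / 8).
have rho'0 : 0 < rho' by rewrite !lt_min !divr_gt0// ltr01.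
have gk xi : `|xi| <= rho' ->
    `|g xi - derive1n 2 gamma 0 / 2 * xi ^+ 2| <= (Bg + Bg) * `|xi| ^+ 3.
  rewrite !le_min => /andP[/andP[xe x1] _].
  have [_ [_ _ b3] Jt _] := Jg.
  have Bg0 : 0 <= Bg by exact: le_trans b3.
  have := Jt xi xe; rewrite derive1n1 dg0 add0r mul0r add0r g0.
  move: b3; generalize (derive1n 2 gamma 0 / 2) (derive1n 3 gamma 0 / 6) => k p3 b3 H.
  have -> : g xi - k * xi ^+ 2 = (gamma xi - - r - (k * xi ^+ 2 + p3 * xi ^+ 3)) + p3 * xi ^+ 3.
    by rewrite /g; ring.
  rewrite mulrDl; apply: (le_trans (ler_normD _ _)); apply: lerD.
    by apply: (le_trans H); rewrite ler_wpM2l// ler_wiXn2l.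
  by apply: le_normM => //; rewrite normrX.
have gE xi H : `|xi| <= rho' -> `|H| <= rho' -> 0 < rotE psi C S xi H <-> g xi < H.
  rewrite !le_min => /andP[/andP[xe _] xe8] /andP[/andP[He _] He8].
  rewrite -(OE _ _ xe8 He8).
  have -> : Omega (frame x n (xi, H - r)) <-> gamma xi < H - r.
    apply: Og; apply: (le_lt_trans (enorm_le_sum _)); rewrite /= g0 subr0 opprK subrK.
    apply: (le_lt_trans (lerD xe He)); lra.
  by rewrite /g ltrBrDr.
have [C0 SC kE] := identify Ju CS1 rho'0 gk gE.
clear gk gE Jg; move: Ju SC kE.
generalize (derive1n 1 phi u0) (derive1n 2 phi u0) (derive1n 3 phi u0)
  (derive1n 2 gamma 0) => q1 q2 q3 k2 Ju SC kE.
have sa := sandwich_alpha Ju C0 CS1; have sb := sandwich_beta Ju C0 CS1.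
rewrite -kE in sa sb.
exists (C * (q3 / 6 * C ^+ 3 -
   2 * (q2 / 2) * C * S * (k2 / 2))); split => //.
  have -> : k2 = 2 * (k2 / 2) by field.
  by apply: le_normM => //; rewrite ger0_norm.
move=> xi H xr Hr xe He far.
rewrite (OE _ _ xe He).
have := @sandwich _ psi _ _ _ _ _ C S Ju C0 CS1 SC xi H xr Hr.
by rewrite -kE; apply.
Qed.

Lemma local_regular : exists N0, forall N b, N0 < N -> frontier Omega b ->
  enorm (b - b0) < eps / 16 -> regular_at Omega N b.
Proof.
have e0' : 0 < eps by exact: e0.
have M0 : 0 <= MM.
  rewrite /MM /Mrot; have B2 := sqr_ge0 B.
  have A0 : 0 <= 2 * B + 2 * B ^+ 2 by rewrite addr_ge0// mulr_ge0.
  by rewrite mulr_ge0// !addr_ge0// ?mulr_ge0// ?exprn_ge0// addr_ge0.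
exists (2 / rr + 16 * (2 + B) / eps + (MM + (3 * B + 2 * B ^+ 2 + 1))) => N b NN fb be.
have t1 : 0 <= 2 / rr by rewrite divr_ge0// ltW.
have t2 : 0 <= 16 * (2 + B) / eps by rewrite divr_ge0 ?mulr_ge0 ?addr_ge0// ltW.
have B2 : 0 <= B ^+ 2 by exact: sqr_ge0.
have B0' : 0 <= B by exact: B0.
have [n1 n2 n3 n4] : [/\ 2 / rr <= N, 16 * (2 + B) / eps <= N, MM <= N &
    3 * B + 2 * B ^+ 2 + 1 <= N].
  by move: (2 / rr) (16 * (2 + B) / eps) MM (B ^+ 2) t1 t2 M0 B2 NN; split; lra.
have N0 : 0 < N by lra.
have r1 : 2 * N^-1 <= rr.
  by move: n1; rewrite ler_pdivrMr// => n1; rewrite ler_pdivrMr// mulrC.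
have r2 : (2 + B) * N^-1 <= eps / 16.
  move: n2; rewrite ler_pdivrMr// => n2; rewrite ler_pdivrMr//.
  by rewrite mulrAC ler_pdivlMr// [N * _]mulrC [_ * 16]mulrC in n2 *.
have Ni0 : 0 < N^-1 by rewrite invr_gt0.
have BNi : 0 <= B * N^-1 by rewrite mulr_ge0// ltW.
rewrite mulrDl in r2.
split.
  move=> x n gamma bx ad.
  have be8 : enorm (b - b0) < eps / 8 by lra.
  have [bb [k1 k2 H]] := local_sandwich fb be8 ad.
  exists bb; split; [apply: (le_trans k1); lra|apply: (le_trans k2); lra|].
  move=> p pN P far.
  have p1 := le_trans (normr_le_enorm1 p) (ltW pN).
  have p2 := le_trans (normr_le_enorm2 p) (ltW pN).
  have r0 := enorm_ge0 (b - x).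
  pose Hh := p.2 + enorm (b - x).
  have Hh2 : `|Hh| <= 2 * N^-1.
    apply: (le_trans (ler_normD _ _)); rewrite (ger0_norm r0).
    apply: (le_trans (lerD p2 (ltW bx))); lra.
  have := H p.1 Hh (le_trans p1 _) (le_trans Hh2 r1) (le_trans p1 _) (le_trans Hh2 _).
  have -> : Hh - enorm (b - x) = p.2 by rewrite /Hh addrK.
  rewrite -surjective_pairing => {}H.
  have -> : P < p.2 <-> derive1n 2 gamma 0 / 2 * p.1 ^+ 2 + bb * p.1 ^+ 3 < Hh.
    by rewrite /P /Hh addrC ltrBlDr.
  apply: H; [lra|lra|lra|].
  have -> : Hh - (derive1n 2 gamma 0 / 2 * p.1 ^+ 2 + bb * p.1 ^+ 3) = p.2 - P.
    by rewrite /P /Hh; ring.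
  by apply: le_lt_trans far; rewrite ler_wpM2r ?exprn_even_ge0.
move=> x y Ox Oy bx yx.
have xb : enorm (x - b0) <= eps / 8.
  have -> : x - b0 = - (b - x) + (b - b0) by rewrite opprB addrA subrK.
  by apply: (le_trans (enorm_triangle _ _)); rewrite enormN; lra.
apply: local_linked => //; first lra.
apply: (@le_trans _ _ ((1 + B) * N^-1)); first by rewrite ler_wpM2l ?addr_ge0// ltW.
by rewrite mulrDl; lra.
Qed.

End local.
End charts.

Section uniform.
Variable R : realType.

Lemma box_compact (M : R) : compact (`[- M, M] `*` `[- M, M] : set (R * R)).
Proof. by apply: compact_setX; exact: segment_compact. Qed.

Lemma bounded_box (A : set (R * R)) : bounded_set A ->
  exists M : R, A `<=` `[- M, M] `*` `[- M, M].
Proof.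
move=> [M [_ MA]]; exists (M + 1) => y Ay.
have := MA (M + 1) (ltr_pwDr ltr01 (lexx M)) y Ay.
rewrite /= => h; rewrite prod_normE in h.
have h1 : `|y.1| <= M + 1 by apply: le_trans h; rewrite le_max lexx.
have h2 : `|y.2| <= M + 1 by apply: le_trans h; rewrite le_max lexx orbT.
by split; rewrite /= in_itv/= -ler_norml.
Qed.

(** The frontier is closed; it lies in the closure of the domain, and misses the
    domain itself, so that it is bounded in both cases. *)
Lemma compact_frontier (Omega : set (R * R)) :
  interior_or_exterior_domain Omega -> compact (frontier Omega).
Proof.
move=> [oO _ _ bd].
have cF : closed (frontier Omega).
  rewrite /frontier setDE; apply: closedI; first exact: closed_closure.
  by apply: open_closedC; exact: open_interior.
have [M FM] : exists M : R, frontier Omega `<=` `[- M, M] `*` `[- M, M].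
  case: bd => /bounded_box[M OM]; exists M; last first.
    by move=> y [_ ny]; apply: OM => Oy; apply: ny; rewrite (interior_id _).1.
  move=> y [cy _]; have cB := compact_closed (@norm_hausdorff _ _) (@box_compact M).
  by rewrite ((closure_id _).1 cB); exact: (closureS OM) cy.
exact: subclosed_compact cF (@box_compact M) FM.
Qed.

(** A finite number of charts covers the frontier. *)
Lemma regular_boundary (Omega : set (R * R)) :
  interior_or_exterior_domain Omega -> smooth_boundary Omega ->
  exists N, 0 < N /\ forall b, frontier Omega b -> regular_at Omega N b.
Proof.
move=> io sm; have cF := compact_frontier io.
have oO : open Omega by case: io.
have /compact_near_coveringP cov := cF.
have := cov R (+oo : set_system R) (fun N b => frontier Omega b -> regular_at Omega N b) _.
have H : forall b0, frontier Omega b0 ->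
    \forall b \near b0 & N \near +oo, frontier Omega b -> regular_at Omega N b.
  move=> b0 /sm[m [phi [m1 phi0 [eps e0 [smphi Oe]]]]].
  have [B J] := smooth_jet3 e0 smphi.
  have Oe' p : enorm p < eps -> Omega (frame b0 m p) <-> phi p.1 < p.2.
    by move=> pe; apply: Oe; rewrite phi0 (_ : p - (0, 0) = p)//; exact: subr0.
  have [N0 HN] := local_regular oO m1 e0 smphi Oe' J.
  exists ([set b | enorm (b - b0) < eps / 16], [set N | N0 < N]).
    split; first by apply: nbhs_enorm; rewrite divr_gt0.
    by exists N0; split; [exact: num_real|].
  by move=> [b N] [/= be NN] fb; exact: HN.
move=> /(_ _ H) HN.
near (+oo : set_system R) => N.
exists N; split; first by near: N; exact: nbhs_pinfty_gt.
move=> b fb; have : frontier Omega `<=` (fun b => frontier Omega b -> regular_at Omega N b).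
  by near: N; exact: HN.
by apply.
Unshelve. all: by end_near. Qed.

End uniform.

(** * Taylor expansion along paths in the domain *)
Section planar_calculus.
Variable R : realType.
Implicit Types (x y z q v : R * R) (f k : R * R -> R).

(** An estimate without quotient is easier to check than a limit of quotients. *)
Lemma is_derive_eps (g : R -> R) (s l : R) :
  (forall e, 0 < e -> exists2 d, 0 < d &
     forall t, `|t| < d -> `|g (s + t) - g s - l * t| <= e * `|t|) ->
  is_derive s (1 : R) g l.
Proof.
move=> H.
have cv : h^-1 *: (g (h *: (1 : R) + s) - g s) @[h --> 0^'] --> (l : R).
  apply/cvgrPdist_le => e e0; have [d d0 Hd] := H e e0.
  near=> t.
  have t0 : t != 0 by near: t; exact: nbhs_dnbhs_neq.
  have td : `|t| < d.
    near: t; apply: dnbhs0_lt; exact: d0.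
  have := Hd t td; rewrite /GRing.scale/= mulr1 [t + s]addrC => h.
  have -> : l - t^-1 * (g (s + t) - g s) = - (t^-1 * (g (s + t) - g s - l * t)).
    by field.
  by rewrite normrN normrM normfV mulrC ler_pdivrMr ?normr_gt0.
apply: DeriveDef; first exact: cvgP cv.
exact: cvg_lim cv.
Unshelve. all: by end_near. Qed.

Lemma is_derive_line f q v (l : R) :
  is_derive q v f l <-> is_derive (0 : R) (1 : R) (fun s => f (q.1 + s * v.1, q.2 + s * v.2)) l.
Proof.
have E : (fun h : R => h^-1 *: (f (h *: v + q) - f q)) =
   (fun h : R => h^-1 *: ((fun s => f (q.1 + s * v.1, q.2 + s * v.2)) (h *: (1 : R) + 0) -
      (fun s => f (q.1 + s * v.1, q.2 + s * v.2)) 0)).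
  apply/funext => h; congr (_ *: (f _ - f _)).
    rewrite addr0 [X in (q.1 + X * _, _)](_ : _ = h) ?[X in (_, q.2 + X * _)](_ : _ = h);
      [|exact: mulr1|exact: mulr1].
    by apply: injective_projections; rewrite /= addrC.
  by case: q => q1 q2 /=; rewrite !mul0r !addr0.
split=> -[d dE]; apply: DeriveDef.
- by move: d; rewrite /derivable E.
- by move: dE; rewrite /derive E.
- by rewrite /derivable E.
- by rewrite /derive E.
Qed.

(** The chain rule along lines with the gradient [(k1, k2)], in a form that never
    mentions derivatives in the plane. *)
Definition C1 (Omega : set (R * R)) k k1 k2 : Prop :=
  forall y v (s : R), Omega (y.1 + s * v.1, y.2 + s * v.2) ->
    is_derive s (1 : R) (fun t => k (y.1 + t * v.1, y.2 + t * v.2))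
      (v.1 * k1 (y.1 + s * v.1, y.2 + s * v.2) + v.2 * k2 (y.1 + s * v.1, y.2 + s * v.2)).

Lemma nbhs_box y (A : set (R * R)) : nbhs y A ->
  exists2 d : R, 0 < d & forall q, `|q.1 - y.1| < d -> `|q.2 - y.2| < d -> A q.
Proof.
move=> /nbhs_ballP[d d0 dA]; exists d => // q h1 h2; apply: dA.
by split; rewrite /ball/= distrC.
Qed.

Section C1_of_partials.
Variables (Omega : set (R * R)) (k : R * R -> R).
Hypothesis oO : open Omega.
Hypothesis dk : forall y, Omega y ->
  derivable k y ((1, 0) : R * R) /\ derivable k y ((0, 1) : R * R).
Hypothesis ck1 : forall y, Omega y -> {for y, continuous (partial1 k)}.
Hypothesis ck2 : forall y, Omega y -> {for y, continuous (partial2 k)}.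

Let slice1 (a b : R) : Omega (a, b) ->
  is_derive a (1 : R) (fun t => k (t, b)) (partial1 k (a, b)).
Proof.
move=> /dk[/derivableP d _]; move/is_derive_line : d => /= d.
apply/is_derive_eps => e e0.
have cv := @ex_derive _ _ _ _ _ _ _ d.
have dv := @derive_val _ _ _ _ _ _ _ d.
have : h^-1 *: ((fun s : R => k (a + s * 1, b + s * 0)) (h *: (1 : R) + 0) -
   (fun s : R => k (a + s * 1, b + s * 0)) 0) @[h --> 0^'] --> partial1 k (a, b).
  by rewrite /partial1 -dv; exact: cv.
move=> /cvgrPdist_le/(_ e e0) /nbhs_ballP[r r0 rH].
exists r => // t tr.
have [->|t0] := eqVneq t 0; first by rewrite addr0 mulr0 subr0 subrr !normr0 mulr0.
have := rH t _ t0; rewrite /ball/= sub0r normrN => /(_ tr).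
rewrite /GRing.scale/= !(mulr0, addr0, mulr1) => h.
have -> : k (a + t, b) - k (a, b) - partial1 k (a, b) * t =
   - (partial1 k (a, b) - t^-1 * (k (a + t, b) - k (a, b))) * t by field.
by rewrite normrM normrN ler_wpM2r.
Qed.

Let slice2 (a b : R) : Omega (a, b) ->
  is_derive b (1 : R) (fun t => k (a, t)) (partial2 k (a, b)).
Proof.
move=> /dk[_ /derivableP d]; move/is_derive_line : d => /= d.
apply/is_derive_eps => e e0.
have cv := @ex_derive _ _ _ _ _ _ _ d.
have dv := @derive_val _ _ _ _ _ _ _ d.
have : h^-1 *: ((fun s : R => k (a + s * 0, b + s * 1)) (h *: (1 : R) + 0) -
   (fun s : R => k (a + s * 0, b + s * 1)) 0) @[h --> 0^'] --> partial2 k (a, b).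
  by rewrite /partial2 -dv; exact: cv.
move=> /cvgrPdist_le/(_ e e0) /nbhs_ballP[r r0 rH].
exists r => // t tr.
have [->|t0] := eqVneq t 0; first by rewrite addr0 mulr0 subr0 subrr !normr0 mulr0.
have := rH t _ t0; rewrite /ball/= sub0r normrN => /(_ tr).
rewrite /GRing.scale/= !(mulr0, addr0, mulr1) => h.
have -> : k (a, b + t) - k (a, b) - partial2 k (a, b) * t =
   - (partial2 k (a, b) - t^-1 * (k (a, b + t) - k (a, b))) * t by field.
by rewrite normrM normrN ler_wpM2r.
Qed.

Let close y (e : R) : Omega y -> 0 < e -> exists2 d : R, 0 < d &
  forall q, `|q.1 - y.1| < d -> `|q.2 - y.2| < d ->
   [/\ Omega q, `|partial1 k q - partial1 k y| <= e &
       `|partial2 k q - partial2 k y| <= e].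
Proof.
move=> Oy e0.
have nO : nbhs y Omega by exact: open_nbhs_nbhs.
have n1 : nbhs y [set q | `|partial1 k q - partial1 k y| <= e].
  have /cvgrPdist_le/(_ e e0) := ck1 Oy.
  by apply: filterS => q /=; rewrite distrC.
have n2 : nbhs y [set q | `|partial2 k q - partial2 k y| <= e].
  have /cvgrPdist_le/(_ e e0) := ck2 Oy.
  by apply: filterS => q /=; rewrite distrC.
have [d d0 H] := nbhs_box (filterI nO (filterI n1 n2)).
by exists d => // q h1 h2; have [? [? ?]] := H q h1 h2.
Qed.

Let differential y (e : R) : Omega y -> 0 < e -> exists2 d : R, 0 < d &
  forall a b, `|a| < d -> `|b| < d ->
  `|k (y.1 + a, y.2 + b) - k y - (partial1 k y * a + partial2 k y * b)| <=
   e * (`|a| + `|b|).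
Proof.
move=> Oy e0; have [d d0 H] := close Oy e0; exists d => // a b ad bd.
have -> : k (y.1 + a, y.2 + b) - k y - (partial1 k y * a + partial2 k y * b) =
  ((k (y.1 + a, y.2 + b) - partial1 k y * (y.1 + a)) - (k (y.1, y.2 + b) - partial1 k y * y.1))
  + ((k (y.1, y.2 + b) - partial2 k y * (y.2 + b)) - (k (y.1, y.2) - partial2 k y * y.2)).
  by rewrite -surjective_pairing; ring.
have btw (w c t : R) : w <= t <= w + c \/ w + c <= t <= w -> `|t - w| <= `|c|.
  have := ler_norm c; have := ler_norm (- c); rewrite normrN.
  by move=> ? ? [/andP[? ?]|/andP[? ?]]; rewrite ler_norml; apply/andP; split; lra.
apply: (le_trans (ler_normD _ _)); rewrite [leRHS]mulrDr; apply: lerD.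
  have -> : a = y.1 + a - y.1 by rewrite addrAC subrr add0r.
  rewrite [X in k (y.1 + X, _)](_ : _ = a); last by ring.
  rewrite [X in partial1 k y * (y.1 + X)](_ : _ = a); last by ring.
  apply: (@mvt_bound _ (fun t => k (t, y.2 + b) - partial1 k y * t)
    (fun t => partial1 k (t, y.2 + b) - partial1 k y)) => t /btw ta.
    apply: is_derive_sub_linear; apply: slice1.
    by have [] := H (t, y.2 + b) (le_lt_trans ta ad) _; rewrite //= addrAC subrr add0r.
  by have [] := H (t, y.2 + b) (le_lt_trans ta ad) _; rewrite //= addrAC subrr add0r.
have -> : b = y.2 + b - y.2 by rewrite addrAC subrr add0r.
rewrite [X in k (_, y.2 + X)](_ : _ = b); last by ring.
rewrite [X in partial2 k y * (y.2 + X)](_ : _ = b); last by ring.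
apply: (@mvt_bound _ (fun t => k (y.1, t) - partial2 k y * t)
  (fun t => partial2 k (y.1, t) - partial2 k y)) => t /btw tb.
  apply: is_derive_sub_linear; apply: slice2.
  by have [] := H (y.1, t) _ (le_lt_trans tb bd); rewrite //= subrr normr0.
by have [] := H (y.1, t) _ (le_lt_trans tb bd); rewrite //= subrr normr0.
Qed.

(** Continuous partial derivatives make a function differentiable: the increment is
    split into a horizontal and a vertical one. *)
Lemma C1_partials : C1 Omega k (partial1 k) (partial2 k).
Proof.
move=> y v s Oys; apply/is_derive_eps => e e0.
pose V := `|v.1| + `|v.2| + 1.
have V0 : 0 < V by rewrite ltr_wpDl// addr_ge0.
have [d d0 H] := differential Oys (divr_gt0 e0 V0).
exists (d / V); first by rewrite divr_gt0.
move=> t; rewrite ltr_pdivlMr// => td.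
have t1 : `|t * v.1| < d.
  apply: le_lt_trans td; rewrite normrM ler_wpM2l// /V -addrA lerDl addr_ge0//.
have t2 : `|t * v.2| < d.
  apply: le_lt_trans td; rewrite normrM ler_wpM2l// /V [`|v.1| + _]addrC -addrA lerDl addr_ge0//.
have := H _ _ t1 t2 => /=.
have -> : y.1 + s * v.1 + t * v.1 = y.1 + (s + t) * v.1 by ring.
have -> : y.2 + s * v.2 + t * v.2 = y.2 + (s + t) * v.2 by ring.
set w := (y.1 + s * v.1, y.2 + s * v.2) => h.
have -> : (v.1 * partial1 k w + v.2 * partial2 k w) * t =
  partial1 k w * (t * v.1) + partial2 k w * (t * v.2) by ring.
apply: (le_trans h).
have -> : e / V * (`|t * v.1| + `|t * v.2|) = e * `|t| * ((`|v.1| + `|v.2|) / V).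
  by rewrite !normrM; ring.
rewrite ler_piMr//; first by rewrite mulr_ge0// ltW.
by rewrite ler_pdivrMr// mul1r /V lerDl.
Qed.

End C1_of_partials.
End planar_calculus.

Section C1_slices.
Variables (R : realType) (Omega : set (R * R)) (k k1 k2 : R * R -> R).
Hypothesis dk : C1 Omega k k1 k2.

Lemma C1_slice1 (c a b : R) : Omega (c + a, b) ->
  is_derive a (1 : R) (fun t => k (c + t, b)) (k1 (c + a, b)).
Proof.
move=> Oab; have := @dk (c, b) (1, 0) a; rewrite /=.
rewrite (_ : (fun t : R => k (c + t * 1, b + t * 0)) = (fun t => k (c + t, b))).
  by rewrite mulr1 mulr0 addr0 mul1r mul0r addr0 => /(_ Oab).
by apply/funext => t; rewrite mulr1 mulr0 addr0.
Qed.

Lemma C1_slice2 (c a b : R) : Omega (a, c + b) ->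
  is_derive b (1 : R) (fun t => k (a, c + t)) (k2 (a, c + b)).
Proof.
move=> Oab; have := @dk (a, c) (0, 1) b; rewrite /=.
rewrite (_ : (fun t : R => k (a + t * 0, c + t * 1)) = (fun t => k (a, c + t))).
  by rewrite mulr1 mulr0 addr0 mul1r mul0r add0r => /(_ Oab).
by apply/funext => t; rewrite mulr1 mulr0 addr0.
Qed.

End C1_slices.

(** Both are the limit of the same second difference quotient over a small
    square. *)
Lemma mixed_derivatives (R : realType) (Omega : set (R * R))
    (k k1 k2 k11 k12 k21 k22 : R * R -> R) (y : R * R) : open Omega ->
  C1 Omega k k1 k2 -> C1 Omega k1 k11 k21 -> C1 Omega k2 k12 k22 ->
  {for y, continuous k12} -> {for y, continuous k21} -> Omega y ->
  k12 y = k21 y.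
Proof.
move=> oO dk dk1 dk2 ck12 ck21 Oy.
apply/eqP; rewrite -subr_eq0 -normr_le0; apply/ler_addgt0Pr => e0 e00.
rewrite add0r; pose e := e0 / 2; have e_gt0 : 0 < e by rewrite divr_gt0.
have near12 : nbhs y [set q | `|k12 q - k12 y| <= e].
  have /cvgrPdist_le/(_ e e_gt0) := ck12.
  by apply: filterS => q /=; rewrite distrC.
have near21 : nbhs y [set q | `|k21 q - k21 y| <= e].
  have /cvgrPdist_le/(_ e e_gt0) := ck21.
  by apply: filterS => q /=; rewrite distrC.
have nO : nbhs y Omega by exact: open_nbhs_nbhs.
have [d d0 H] := nbhs_box (filterI nO (filterI near12 near21)).
pose s := d / 2; have s0 : 0 < s by rewrite divr_gt0.
have sd a : 0 <= a <= s \/ s <= a <= 0 -> `|a| < d.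
  by rewrite ltr_norml /s; move=> [/andP[? ?]|/andP[? ?]]; apply/andP; split; lra.
have Hb a b : 0 <= a <= s \/ s <= a <= 0 -> 0 <= b <= s \/ s <= b <= 0 ->
   [/\ Omega (y.1 + a, y.2 + b),
       `|k12 (y.1 + a, y.2 + b) - k12 y| <= e &
       `|k21 (y.1 + a, y.2 + b) - k21 y| <= e].
  move=> /sd ad /sd bd.
  have e1 : `|(y.1 + a, y.2 + b).1 - y.1| < d by rewrite /= [y.1 + a]addrC addrK.
  have e2 : `|(y.1 + a, y.2 + b).2 - y.2| < d by rewrite /= [y.2 + b]addrC addrK.
  by have [? [? ?]] := H _ e1 e2.
have zero_s : 0 <= (0 : R) <= s \/ s <= (0 : R) <= 0 by left; rewrite lexx ltW.
have s_s : 0 <= s <= s \/ s <= s <= 0 by left; rewrite lexx ltW.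
pose De := k (y.1 + s, y.2 + s) - k (y.1 + s, y.2 + 0) -
  (k (y.1 + 0, y.2 + s) - k (y.1 + 0, y.2 + 0)).
have b1 : `|De - k21 y * s * s| <= e * s * s.
  have := @mvt_bound _ (fun a => k (y.1 + a, y.2 + s) - k (y.1 + a, y.2 + 0)
     - k21 y * s * a)
    (fun a => k1 (y.1 + a, y.2 + s) - k1 (y.1 + a, y.2 + 0)
     - k21 y * s) (e * s) 0 s.
  rewrite subr0 (gtr0_norm s0) mulr0 subr0 addrAC => h.
  rewrite /De; apply: h => [a ha|a ha].
    apply: is_derive_sub_linear; apply: is_deriveB; apply: (C1_slice1 dk).
      by have [] := Hb a s ha s_s.
    by have [] := Hb a 0 ha zero_s.
  have := @mvt_bound _ (fun b => k1 (y.1 + a, y.2 + b) - k21 y * b)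
    (fun b => k21 (y.1 + a, y.2 + b) - k21 y) e 0 s.
  rewrite subr0 (gtr0_norm s0) mulr0 subr0 addrAC; apply => b hb.
    apply: is_derive_sub_linear; apply: (C1_slice2 dk1).
    by have [] := Hb a b ha hb.
  by have [] := Hb a b ha hb.
have b2 : `|De - k12 y * s * s| <= e * s * s.
  have -> : De = k (y.1 + s, y.2 + s) - k (y.1 + 0, y.2 + s) -
     (k (y.1 + s, y.2 + 0) - k (y.1 + 0, y.2 + 0)) by rewrite /De; ring.
  have := @mvt_bound _ (fun b => k (y.1 + s, y.2 + b) - k (y.1 + 0, y.2 + b)
     - k12 y * s * b)
    (fun b => k2 (y.1 + s, y.2 + b) - k2 (y.1 + 0, y.2 + b)
     - k12 y * s) (e * s) 0 s.
  rewrite subr0 (gtr0_norm s0) mulr0 subr0 addrAC => h.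
  apply: h => [b hb|b hb].
    apply: is_derive_sub_linear; apply: is_deriveB; apply: (C1_slice2 dk).
      by have [] := Hb s b s_s hb.
    by have [] := Hb 0 b zero_s hb.
  have := @mvt_bound _ (fun a => k2 (y.1 + a, y.2 + b) - k12 y * a)
    (fun a => k12 (y.1 + a, y.2 + b) - k12 y) e 0 s.
  rewrite subr0 (gtr0_norm s0) mulr0 subr0 addrAC; apply => a ha.
    apply: is_derive_sub_linear; apply: (C1_slice1 dk2).
    by have [] := Hb a b ha hb.
  by have [] := Hb a b ha hb.
have s2 : 0 < s * s by rewrite mulr_gt0.
rewrite -(ler_pM2r s2) -{1}(gtr0_norm s2) -normrM.
have -> : (k12 y - k21 y) * (s * s) =
  (De - k21 y * s * s) - (De - k12 y * s * s) by ring.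
apply: (le_trans (ler_normB _ _)).
have -> : e0 * (s * s) = e * s * s + e * s * s by rewrite /e; field.
exact: lerD.
Qed.

Section smooth_function.
Variable R : realType.
Implicit Types (x y z q v : R * R) (k : R * R -> R).
Variables (Omega : set (R * R)) (f : R * R -> R).
Hypothesis oO : open Omega.
Hypothesis sf : smooth_up_to_boundary Omega f.
Hypothesis cf : compactly_supported Omega f.

Let D w : R * R -> R := pderiv w f.

Lemma continuous_pderiv w y : Omega y -> {for y, continuous (D w)}.
Proof.
move=> Oy; have [_ _ /(_ w)[g cg gE]] := sf.
have cgy : {for y, continuous g}.
  have cO : {within Omega, continuous g}.
    by apply: continuous_subspaceW cg; exact: subset_closure.
  by move: cO; rewrite continuous_open_subspace// => /(_ y); rewrite inE; apply.
have E : \forall z \near y, g z = D w z.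
  have : nbhs y Omega by exact: open_nbhs_nbhs.
  by apply: filterS => z Oz; exact: gE.
have H : D w z @[z --> y] --> D w y.
  by rewrite -(nbhs_singleton E); apply: cvg_trans cgy; exact: near_eq_cvg.
exact: H.
Qed.

Lemma C1_pderiv w : C1 Omega (D w) (D (true :: w)) (D (false :: w)).
Proof.
have [_ dw _] := sf.
apply: (C1_partials oO (dw w)).
  by move=> y Oy; exact: (@continuous_pderiv (true :: w) y Oy).
by move=> y Oy; exact: (@continuous_pderiv (false :: w) y Oy).
Qed.

(** The derivatives extend continuously to the compact support of [f], and vanish
    away from it. *)
Lemma bounded_pderiv w : exists M, forall y, Omega y -> `|D w y| <= M.
Proof.
set S := closure (closure Omega `&` [set x | f x != 0]).
have cS : compact S by exact: cf.
have [_ _ /(_ w)[g cg gE]] := sf.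
have SO : S `<=` closure Omega.
  apply: (subset_trans (closureS (@subIsetl _ _ _))).
  by rewrite -(closure_id _).1//; exact: closed_closure.
have [M HM] : exists M, forall y, S y -> `|g y| <= M.
  have [/set0P[y0 Sy0]|] := boolP (S != set0); last first.
    by rewrite negbK => /eqP S0; exists 0 => y; rewrite S0.
  have cgS : {within S, continuous (fun y => `|g y|)}.
    have cgS : {within S, continuous g} by exact: continuous_subspaceW cg.
    move=> y; apply: continuous_comp; [exact: cgS|exact: norm_continuous].
  have : compact [set `|g y| | y in S] by exact: continuous_compact.
  move=> /compact_bounded[M [_ HM]]; exists (M + 1) => y Sy.
  have := HM (M + 1) (ltr_pwDr ltr01 (lexx M)) `|g y| _.
  by rewrite /= normr_id; apply; exists y.
exists (Num.max M 0) => y Oy.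
have [Sy|nSy] := pselect (S y).
  by rewrite /D -gE// le_max HM.
have cS' : open (~` S) by apply: closed_openC; exact: closed_closure.
have nS : \forall z \near y, f z = 0.
  have : nbhs y (~` S `&` Omega).
    by apply: filterI; apply: open_nbhs_nbhs.
  apply: filterS => z [nSz Oz]; apply: contrapT => /eqP fz; apply: nSz.
  by apply: subset_closure; split => //; exact: subset_closure.
suff D0 : \forall z \near y, D w z = 0.
  by rewrite (nbhs_singleton D0) normr0 le_max lexx orbT.
elim: w {g cg gE HM} => [//|i w IH]; rewrite /D /=.
have IH' : \forall z \near y, \near z, D w z = 0.
  exact: (near_join IH).
apply: filterS IH' => z Hz.
have d0 v : 'D_v (D w) z = 0.
  have -> : 'D_v (D w) z = 'D_v (cst (0 : R)) z by exact: near_eq_derive.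
  exact: derive_cst.
by case: i; rewrite /partial1 /partial2 d0.
Qed.

Lemma bounded_pderivs (ws : seq (seq bool)) : exists2 M, 0 <= M &
  forall w, w \in ws -> forall y, Omega y -> `|D w y| <= M.
Proof.
elim: ws => [|w ws [M M0 H]]; first by exists 0.
have [M' H'] := bounded_pderiv w.
exists (M + `|M'|) => [|v]; first by rewrite addr_ge0.
rewrite inE => /predU1P[->|vws] y Oy; last by rewrite ler_wpDr// H.
by apply: (le_trans (H' y Oy)); rewrite ler_wpDl// ler_norm.
Qed.

Lemma Schwarz y : Omega y -> D [:: true; false] y = D [:: false; true] y.
Proof.
move=> Oy; exact: (mixed_derivatives oO (C1_pderiv [::]) (C1_pderiv [:: true])
  (C1_pderiv [:: false]) (@continuous_pderiv [:: true; false] y Oy)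
  (@continuous_pderiv [:: false; true] y Oy) Oy).
Qed.

(** The factor two accounts for the two components of the gradient. *)
Lemma leg_bound (k k1 k2 : R * R -> R) (A L : R) z z' : C1 Omega k k1 k2 ->
  leg Omega L z z' -> 0 <= A ->
  (forall s, 0 <= s <= 1 ->
     `|k1 (z.1 + s * (z'.1 - z.1), z.2 + s * (z'.2 - z.2))| <= A /\
     `|k2 (z.1 + s * (z'.1 - z.1), z.2 + s * (z'.2 - z.2))| <= A) ->
  forall s, 0 <= s <= 1 ->
   `|k (z.1 + s * (z'.1 - z.1), z.2 + s * (z'.2 - z.2)) - k z| <= 2 * A * L.
Proof.
move=> dk [Ol L1 L2] A0 bk s /andP[s0 s1].
have L0 : 0 <= L by exact: le_trans L1.
have := @mvt_bound _ (fun s => k (z.1 + s * (z'.1 - z.1), z.2 + s * (z'.2 - z.2)))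
  (fun s => (z'.1 - z.1) * k1 (z.1 + s * (z'.1 - z.1), z.2 + s * (z'.2 - z.2)) +
     (z'.2 - z.2) * k2 (z.1 + s * (z'.1 - z.1), z.2 + s * (z'.2 - z.2))) (2 * A * L) 0 s.
have in01 t : 0 <= t <= s \/ s <= t <= 0 -> 0 <= t <= 1.
  by move=> [/andP[? ?]|/andP[? ?]]; apply/andP; split; lra.
rewrite !mul0r !addr0 -surjective_pairing subr0 (ger0_norm s0) => H.
apply: (le_trans (H _ _)).
- by move=> t /in01/Ol Ot; exact: (dk z (z'.1 - z.1, z'.2 - z.2) t Ot).
- move=> t /in01/bk[h1 h2]; have -> : 2 * A * L = L * A + L * A by ring.
  by apply: (le_trans (ler_normD _ _)); apply: lerD; apply: le_normM.
- by rewrite ler_piMr// !mulr_ge0.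
Qed.

End smooth_function.

Section linked_taylor.
Variable R : realType.
Implicit Types (x y z q v : R * R) (k : R * R -> R).

Lemma C1_sub_quad (Omega : set (R * R)) k k1 k2 (x : R * R) (c a b p q r : R) :
  C1 Omega k k1 k2 ->
  C1 Omega (fun y => k y - (c + a * (y.1 - x.1) + b * (y.2 - x.2) +
       p / 2 * (y.1 - x.1) ^+ 2 + q * (y.1 - x.1) * (y.2 - x.2) +
       r / 2 * (y.2 - x.2) ^+ 2))
    (fun y => k1 y - (a + p * (y.1 - x.1) + q * (y.2 - x.2)))
    (fun y => k2 y - (b + q * (y.1 - x.1) + r * (y.2 - x.2))).
Proof.
move=> dk y v s Os /=; have dg := dk y v s Os.
have dp : is_derive s (1 : R) (fun t : R => c + a * (y.1 + t * v.1 - x.1) +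
   b * (y.2 + t * v.2 - x.2) + p / 2 * (y.1 + t * v.1 - x.1) ^+ 2 +
   q * (y.1 + t * v.1 - x.1) * (y.2 + t * v.2 - x.2) +
   r / 2 * (y.2 + t * v.2 - x.2) ^+ 2)
   (v.1 * (a + p * (y.1 + s * v.1 - x.1) + q * (y.2 + s * v.2 - x.2)) +
    v.2 * (b + q * (y.1 + s * v.1 - x.1) + r * (y.2 + s * v.2 - x.2))).
  by apply: is_derive_eq; rewrite /GRing.scale/=; field.
rewrite (_ : v.1 * _ + v.2 * _ = (v.1 * k1 (y.1 + s * v.1, y.2 + s * v.2) +
   v.2 * k2 (y.1 + s * v.1, y.2 + s * v.2)) -
   (v.1 * (a + p * (y.1 + s * v.1 - x.1) + q * (y.2 + s * v.2 - x.2)) +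
    v.2 * (b + q * (y.1 + s * v.1 - x.1) + r * (y.2 + s * v.2 - x.2)))).
  exact: (is_deriveB dg dp).
by ring.
Qed.

Lemma sub_quad0 (x1 x2 c a b p q r : R) :
  c - (c + a * (x1 - x1) + b * (x2 - x2) + p / 2 * (x1 - x1) ^+ 2 +
    q * (x1 - x1) * (x2 - x2) + r / 2 * (x2 - x2) ^+ 2) = 0.
Proof. by ring. Qed.

Definition on_leg z z' y : Prop := exists2 s : R, 0 <= s <= 1 &
  y = (z.1 + s * (z'.1 - z.1), z.2 + s * (z'.2 - z.2)).

Definition on_path x z1 z2 y q : Prop :=
  [\/ on_leg x z1 q, on_leg z1 z2 q | on_leg z2 y q].

Lemma on_leg_end z z' : on_leg z z' z'.
Proof.
exists 1; first by rewrite ler01 lexx.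
by rewrite !mul1r !subrKC -surjective_pairing.
Qed.

(** From the start [x], where [k] vanishes, three legs are followed in succession;
    each of them adds at most [2 * A * L]. *)
Lemma path_bound (Omega : set (R * R)) k k1 k2 (A L : R) x z1 z2 y :
  C1 Omega k k1 k2 -> leg Omega L x z1 -> leg Omega L z1 z2 -> leg Omega L z2 y ->
  0 <= A ->
  (forall q, on_path x z1 z2 y q -> `|k1 q| <= A /\ `|k2 q| <= A) ->
  k x = 0 ->
  forall q, on_path x z1 z2 y q -> `|k q| <= 6 * A * L.
Proof.
move=> dk l1 l2 l3 A0 H kx.
have L0 : 0 <= L by case: l1 => _ + _; exact: le_trans.
have AL : 0 <= 2 * A * L by rewrite !mulr_ge0.
have leg1 q : on_leg x z1 q -> `|k q| <= 2 * A * L.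
  move=> [s s01 ->]; rewrite -[k _]subr0 -kx; apply: (leg_bound dk l1 A0 _ s01).
  by move=> t t01; apply: H; apply: Or31; exists t.
have leg2 q : on_leg z1 z2 q -> `|k q| <= 2 * (2 * A * L).
  move=> [s s01 ->]; rewrite -[k _](subrK (k z1)) mulr2n mulrDl mul1r.
  apply: (le_trans (ler_normD _ _)); apply: lerD; last exact/leg1/on_leg_end.
  apply: (leg_bound dk l2 A0 _ s01).
  by move=> t t01; apply: H; apply: Or32; exists t.
have leg3 q : on_leg z2 y q -> `|k q| <= 3 * (2 * A * L).
  move=> [s s01 ->]; rewrite -[k _](subrK (k z2)).
  have -> : 3 * (2 * A * L) = 2 * A * L + 2 * (2 * A * L) by ring.
  apply: (le_trans (ler_normD _ _)); apply: lerD; last exact/leg2/on_leg_end.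
  apply: (leg_bound dk l3 A0 _ s01).
  by move=> t t01; apply: H; apply: Or33; exists t.
have -> : 6 * A * L = 3 * (2 * A * L) by ring.
move=> q [/leg1|/leg2|/leg3] => h; last exact: h; apply: (le_trans h).
  by move: (2 * A * L) AL => w w0; lra.
by move: (2 * A * L) AL => w w0; lra.
Qed.

Variables (Omega : set (R * R)) (f : R * R -> R).
Hypothesis oO : open Omega.
Hypothesis sf : smooth_up_to_boundary Omega f.
Hypothesis cf : compactly_supported Omega f.
Let D w : R * R -> R := pderiv w f.

(** The remainders of the second, first and zeroth derivatives are bounded in this
    order along the same path; each of them has the previous ones as its
    gradient. *)
Lemma linked_taylor N : 0 <= N -> exists2 K, 0 <= K &
  forall x y, Omega x -> linked Omega N x y ->
  `|f y - (f x + D [:: true] x * (y.1 - x.1) + D [:: false] x * (y.2 - x.2) +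
     D [:: true; true] x / 2 * (y.1 - x.1) ^+ 2 +
     D [:: true; false] x * (y.1 - x.1) * (y.2 - x.2) +
     D [:: false; false] x / 2 * (y.2 - x.2) ^+ 2)| <= K * enorm (y - x) ^+ 3.
Proof.
move=> N0.
have [M M0 HM] : exists2 M, 0 <= M & forall w, size w = 3%N ->
    forall y, Omega y -> `|D w y| <= M.
  have [M M0 H] := bounded_pderivs oO sf cf
    [:: [:: true; true; true]; [:: true; true; false]; [:: true; false; true];
        [:: true; false; false]; [:: false; true; true]; [:: false; true; false];
        [:: false; false; true]; [:: false; false; false]].
  exists M => // -[|[] [|[] [|[] []]]]// _; exact: H.
exists (6 * (6 * (6 * M * N) * N) * N); first by rewrite !mulr_ge0.
move=> x y Ox [z1 [z2 [l1 l2 l3]]].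
have [L LE] : exists L, L = N * enorm (y - x) by exists (N * enorm (y - x)).
have L0 : 0 <= L by rewrite LE mulr_ge0// enorm_ge0.
rewrite -LE in l1 l2 l3.
have OP q : on_path x z1 z2 y q -> Omega q.
  have [in1 _ _] := l1; have [in2 _ _] := l2; have [in3 _ _] := l3.
  by case=> -[s s01 ->]; [exact: in1|exact: in2|exact: in3].
have yP : on_path x z1 z2 y y by apply: Or33; exact: on_leg_end.
have dD w := C1_pderiv oO sf w.
have R2 w : size w = 2%N -> forall q, on_path x z1 z2 y q ->
    `|D w q - D w x| <= 6 * M * L.
  move=> sw q qP.
  have := @path_bound Omega _ _ _ M L x z1 z2 y
    (@C1_sub_quad Omega _ _ _ x (D w x) 0 0 0 0 0 (dD w)) l1 l2 l3 M0 _ _ q qP.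
  rewrite /= !mul0r !addr0; apply; last by rewrite subrr.
  by move=> q' /OP Oq; rewrite !mul0r !addr0 !subr0; split; [apply: (HM (true :: w))|apply: (HM (false :: w))] => //=; rewrite sw.
have SZ : D [:: true; false] x = D [:: false; true] x by exact: (Schwarz oO sf Ox).
have R1 i : forall q, on_path x z1 z2 y q ->
    `|D [:: i] q - (D [:: i] x + D [:: true; i] x * (q.1 - x.1) +
       D [:: false; i] x * (q.2 - x.2))| <= 6 * (6 * M * L) * L.
  move=> q qP.
  have A0 : 0 <= 6 * M * L by rewrite !mulr_ge0.
  have := @path_bound Omega _ _ _ (6 * M * L) L x z1 z2 y
    (@C1_sub_quad Omega _ _ _ x (D [:: i] x) (D [:: true; i] x) (D [:: false; i] x)
       0 0 0 (dD [:: i])) l1 l2 l3 A0 _ _ q qP.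
  rewrite /= !mul0r !addr0; apply; last first.
    by rewrite !subrr !mulr0 !addr0 subrr.
  by move=> q' q'P; rewrite !mul0r !addr0; split; [exact: (R2 [:: true; i] erefl q' q'P)|exact: (R2 [:: false; i] erefl q' q'P)].
have A0 : 0 <= 6 * (6 * M * L) * L by rewrite !mulr_ge0.
have := @path_bound Omega _ _ _ (6 * (6 * M * L) * L) L x z1 z2 y
    (@C1_sub_quad Omega _ _ _ x (f x) (D [:: true] x) (D [:: false] x)
       (D [:: true; true] x) (D [:: true; false] x) (D [:: false; false] x)
      (dD [::])) l1 l2 l3 A0 _ _ y yP.
have -> : 6 * (6 * (6 * M * L) * L) * L = 6 * (6 * (6 * M * N) * N) * N * enorm (y - x) ^+ 3.
  by rewrite LE; ring.
apply; last exact: sub_quad0.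
move=> q qP; split.
  by have := R1 true q qP; rewrite -SZ.
exact: (R1 false q qP).
Qed.

End linked_taylor.

(** * Taylor coefficients in a rotated frame *)
Section rotated_derivatives.
Variable R : realType.
Implicit Types (x n p q v : R * R) (k f : R * R -> R) (Omega : set (R * R)).

Lemma frame0 x n : frame x n (0, 0) = x.
Proof. by case: x => x1 x2; rewrite /frame /= !mul0r !addr0 subr0. Qed.

Lemma enorm_frame x n p : enorm n = 1 -> enorm (frame x n p - x) = enorm p.
Proof.
move=> /enorm1 n1; rewrite /enorm /frame /=; congr Num.sqrt.
transitivity ((p.1 ^+ 2 + p.2 ^+ 2) * (n.1 ^+ 2 + n.2 ^+ 2)); first by ring.
by rewrite n1 mulr1.
Qed.

Lemma open_enorm Omega x : open Omega -> Omega x ->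
  exists2 e : R, 0 < e & forall y, enorm (y - x) < e -> Omega y.
Proof.
move=> oO Ox; have [d d0 H] := nbhs_box (open_nbhs_nbhs (conj oO Ox)).
exists d => // y yx; apply: H; apply: le_lt_trans yx.
  exact: (normr_le_enorm1 (y - x)).
exact: (normr_le_enorm2 (y - x)).
Qed.

Lemma near_frame Omega x n : open Omega -> Omega x -> enorm n = 1 ->
  \forall p \near (0, 0), Omega (frame x n p).
Proof.
move=> oO Ox n1; have [e e0 H] := open_enorm oO Ox.
apply: filterS (nbhs_enorm (0, 0) e0) => p /= pe; apply: H.
by rewrite enorm_frame// -[p]subr0.
Qed.

Section C1.
Variables (Omega : set (R * R)) (k k1 k2 : R * R -> R) (x n : R * R).
Hypothesis dk : C1 Omega k k1 k2.

Lemma is_derive_frame p v : Omega (frame x n p) ->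
  is_derive p v (fun p => k (frame x n p))
    ((v.1 * n.2 + v.2 * n.1) * k1 (frame x n p) +
     (v.2 * n.2 - v.1 * n.1) * k2 (frame x n p)).
Proof.
move=> Op; apply/is_derive_line => /=.
set w := (v.1 * n.2 + v.2 * n.1, v.2 * n.2 - v.1 * n.1).
have := @dk (frame x n p) w 0; rewrite !mul0r !addr0 -surjective_pairing => /(_ Op).
congr is_derive; apply/funext => t; congr k; rewrite /frame /w /=.
by congr pair; ring.
Qed.

Lemma partial1_frame p : Omega (frame x n p) ->
  partial1 (fun p => k (frame x n p)) p =
  n.2 * k1 (frame x n p) - n.1 * k2 (frame x n p).
Proof.
move=> /(is_derive_frame (1, 0))/(@derive_val _ _ _ _ _ _ _) => h.
by rewrite /partial1 h /=; ring.
Qed.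

Lemma partial2_frame p : Omega (frame x n p) ->
  partial2 (fun p => k (frame x n p)) p =
  n.1 * k1 (frame x n p) + n.2 * k2 (frame x n p).
Proof.
move=> /(is_derive_frame (0, 1))/(@derive_val _ _ _ _ _ _ _) => h.
by rewrite /partial2 h /=; ring.
Qed.

End C1.

Section C2.
Variables (Omega : set (R * R)) (k k1 k2 k11 k12 k21 k22 : R * R -> R).
Variables (x n : R * R).
Hypothesis oO : open Omega.
Hypothesis Ox : Omega x.
Hypothesis n1 : enorm n = 1.
Hypothesis dk : C1 Omega k k1 k2.
Hypothesis dk1 : C1 Omega k1 k11 k21.
Hypothesis dk2 : C1 Omega k2 k12 k22.

Let derive_comb v (a b : R) :
  'D_v (fun p => a * k1 (frame x n p) + b * k2 (frame x n p)) (0, 0) =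
   a * ((v.1 * n.2 + v.2 * n.1) * k11 x + (v.2 * n.2 - v.1 * n.1) * k21 x) +
   b * ((v.1 * n.2 + v.2 * n.1) * k12 x + (v.2 * n.2 - v.1 * n.1) * k22 x).
Proof.
have Of : Omega (frame x n (0, 0)) by rewrite frame0.
have d1 := is_deriveZ a (is_derive_frame dk1 v Of).
have d2 := is_deriveZ b (is_derive_frame dk2 v Of).
have := @derive_val _ _ _ _ _ _ _ (is_deriveD d1 d2).
by rewrite frame0.
Qed.

(** The first derivative has to be known in a neighbourhood of the origin before it
    can be differentiated. *)
Lemma partial11_frame : partial1 (partial1 (fun p => k (frame x n p))) (0, 0) =
  n.2 ^+ 2 * k11 x - n.1 * n.2 * (k12 x + k21 x) + n.1 ^+ 2 * k22 x.
Proof.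
rewrite {1}/partial1.
have -> : 'D_((1, 0) : R * R) (partial1 (fun p => k (frame x n p))) (0, 0) =
  'D_((1, 0) : R * R) (fun p => n.2 * k1 (frame x n p) + (- n.1) * k2 (frame x n p)) (0, 0).
  apply: near_eq_derive; apply: filterS (near_frame oO Ox n1) => p Op.
  by rewrite (partial1_frame dk Op) mulNr.
by rewrite derive_comb /=; ring.
Qed.

Lemma partial22_frame : partial2 (partial2 (fun p => k (frame x n p))) (0, 0) =
  n.1 ^+ 2 * k11 x + n.1 * n.2 * (k12 x + k21 x) + n.2 ^+ 2 * k22 x.
Proof.
rewrite {1}/partial2.
have -> : 'D_((0, 1) : R * R) (partial2 (fun p => k (frame x n p))) (0, 0) =
  'D_((0, 1) : R * R) (fun p => n.1 * k1 (frame x n p) + n.2 * k2 (frame x n p)) (0, 0).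
  apply: near_eq_derive; apply: filterS (near_frame oO Ox n1) => p Op.
  by rewrite (partial2_frame dk Op).
by rewrite derive_comb /=; ring.
Qed.

End C2.
End rotated_derivatives.

(** * The heat integral in a rotated frame *)
Section plane_measurability.
Variable R : realType.
Local Notation mR := (measurableTypeR R).
Implicit Types (O : set (R * R)) (f : R * R -> R).

(** An open set of the plane is the union of the open boxes with rational
    bounds that it contains. *)
Lemma open_measurable_plane O : open O -> measurable (O : set (mR * mR)).
Proof.
move=> oO.
pose B (q : rat * rat * (rat * rat)) : set (mR * mR) :=
  `]ratr q.1.1, ratr q.1.2[%classic `*` `]ratr q.2.1, ratr q.2.2[%classic.
pose A q := if pselect (B q `<=` O) is left _ then B q else set0.
have -> : (O : set (mR * mR)) = \bigcup_q A q.
  apply/seteqP; split => [y Oy|y [q _]]; last first.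
    by rewrite /A; case: pselect => // BO; exact: BO.
  have [d d0 H] := nbhs_box (open_nbhs_nbhs (conj oO Oy)).
  have below (s : R) : s - d < s by rewrite ltrBlDr ltrDl.
  have above (s : R) : s < s + d by rewrite ltrDl.
  have [a] := rat_in_itvoo (below y.1); rewrite in_itv/= => /andP[a1 a2].
  have [b] := rat_in_itvoo (above y.1); rewrite in_itv/= => /andP[b1 b2].
  have [a'] := rat_in_itvoo (below y.2); rewrite in_itv/= => /andP[a'1 a'2].
  have [b'] := rat_in_itvoo (above y.2); rewrite in_itv/= => /andP[b'1 b'2].
  exists ((a, b), (a', b')) => //; rewrite /A; case: pselect => [_|[]].
    by split; rewrite /= in_itv/=; apply/andP.
  move=> q [/=]; rewrite !in_itv/= => /andP[h1 h2] /andP[h3 h4].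
  by apply: H; rewrite ltr_norml; apply/andP; split; lra.
apply: countable_bigcupT_measurable => // q.
by rewrite /A; case: pselect => // _; exact: measurableX.
Qed.

Lemma continuous_measurable_plane O f : open O ->
  (forall y, O y -> {for y, continuous f}) ->
  measurable_fun (O : set (mR * mR)) (f : mR * mR -> R).
Proof.
move=> oO cf; apply: (measurability _ (RGenOInfty.measurableE R)).
move=> /= _ [_ [a ->]] <-; apply: open_measurable_plane.
rewrite openE => y [Oy fy]; apply: filterI; first exact: open_nbhs_nbhs.
by apply: (cf y Oy); apply: open_nbhs_nbhs.
Qed.

End plane_measurability.

Section rotated_integral.
Variable R : realType.
Local Notation mR := (measurableTypeR R).
Local Notation mm := (@lebesgue_measure R \x @lebesgue_measure R)%E.
Variables (Omega : set (R * R)) (f : R * R -> R) (x n : R * R) (M : R).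
Hypotheses (n1 : enorm n = 1) (oO : open Omega).
Hypothesis cf : forall y, Omega y -> {for y, continuous f}.
Hypothesis fM : forall y, Omega y -> `|f y| <= M.
Let D : set (mR * mR) := [set p | Omega (frame x n p)].
Let F : mR * mR -> R := fun p => f (frame x n p).

Let mfr : measurable_fun setT (frame x n : mR * mR -> mR * mR).
Proof. by have [] := preserves_frame x (enorm1 n1). Qed.

Lemma measurable_frame_domain : measurable D.
Proof.
by rewrite -[D]setTI; apply: mfr => //; exact: open_measurable_plane.
Qed.

Lemma measurable_frame_fun : measurable_fun D F.
Proof.
apply: (@measurable_comp _ _ _ _ _ _ (Omega : set (mR * mR))).
- exact: open_measurable_plane.
- by move=> _ [p Dp <-].
- exact: continuous_measurable_plane.
- exact: measurable_funTS.
Qed.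

(** The inverse of a rigid motion is a rigid motion. *)
Lemma coords_frame y : coords x n y = frame (coords x n (0, 0)) (- n.1, n.2) y.
Proof. by rewrite /coords /frame /=; congr pair; ring. Qed.

(** The frame is an isometry, so that it preserves the measure and the kernel,
    which depends on the distance only. *)
Lemma heat_integral_frame t : 0 < t ->
  \int[mm]_(y in (Omega : set (mR * mR))) (heat_kernel t (x - y) * f y) =
  \int[mm]_(p in D) (gs (Num.sqrt t) p.1 * gs (Num.sqrt t) p.2 * F p).
Proof.
move=> t0; have s0 : 0 < Num.sqrt t by rewrite sqrtr_gt0.
have I := integrable_gs2_bounded measurable_frame_domain measurable_frame_fun
  (fun p Dp => fM Dp) s0.
rewrite Rintegral_mkcond [RHS]Rintegral_mkcond.
set h := (X in _ = \int[mm]_p X p).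
have Ih : mm.-integrable setT (EFin \o h).
  rewrite /h -restrict_EFin; exact: (integrable_mkcond _ measurable_frame_domain).1.
have n1' : (- n.1) ^+ 2 + n.2 ^+ 2 = 1 by rewrite sqrrN; exact: enorm1.
have [mphi inv] := preserves_frame (coords x n (0, 0)) (n := (- n.1, n.2)) n1'.
have [_ <-] := Rintegral_invariant mphi inv Ih.
apply: eq_Rintegral => y _; rewrite -coords_frame /h !patchE /D /=.
have -> : ((coords x n y : mR * mR) \in [set p | Omega (frame x n p)]) =
   ((y : mR * mR) \in (Omega : set (mR * mR))).
  by apply/idP/idP => /set_mem /=; rewrite ?coordsK// => h'; apply/mem_set; rewrite /= ?coordsK.
have nE : enorm (x - y) = enorm (coords x n y).
  rewrite -enormN opprB -(enorm_coords x y x n1) coords_self.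
  by congr enorm; exact: subr0.
have key : gs (Num.sqrt t) (coords x n y).1 * gs (Num.sqrt t) (coords x n y).2 *
   F (coords x n y) = heat_kernel t (x - y) * f y.
  by rewrite -(heat_kernelE _ t0) /F (coordsK _ _ n1) /heat_kernel nE.
by rewrite key.
Qed.

End rotated_integral.

(** * The expansion of the volume potential *)
Section expansion.
Variable R : realType.
Local Notation mR := (measurableTypeR R).
Local Notation mm := (@lebesgue_measure R \x @lebesgue_measure R)%E.
Local Notation spi := (Num.sqrt (pi : R)).

Section formula.

(** At the final time all quantities are expressed by the ratio [c] of the distance
    to the length scale [s]. *)
Lemma PsiE (c s ka f0 fy fxx fyy : R) : 0 < s ->
  Psi (c * s) ka f0 fy fxx fyy s =
  s ^+ 2 / 4 * (2 * erf (c / 2) + 2 * c * expR (- (c ^+ 2 / 4)) / spi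
           - c ^+ 2 * erfc (c / 2) + 2) * f0
  + s ^+ 3 * (((4 - 2 * c ^+ 2) * expR (- (c ^+ 2 / 4)) + spi * c ^+ 3 * erfc (c / 2))
           * (2 * fy - ka * f0) / (12 * spi))
  + (s ^+ 2) ^+ 2 / 48 *
          (erfc (c / 2) *
             (4 * c ^+ 4 * ka * fy - 3 * (c ^+ 4 + 4) * fyy
              + (c ^+ 4 - 12) * fxx - 3 * c ^+ 4 * ka ^+ 2 * f0)
           + 2 * c * (c ^+ 2 - 2) * expR (- (c ^+ 2 / 4)) *
             (- 4 * ka * fy + 3 * fyy - fxx + 3 * ka ^+ 2 * f0)
             / spi
           + 24 * (fxx + fyy)).
Proof.
move=> s0; have sN0 : s != 0 by rewrite gt_eqF.
have spi0 : spi != 0 by rewrite gt_eqF// sqrtr_gt0 pi_gt0.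
have -> : erf (c / 2) = erf (c * s / (2 * s)) by congr erf; field.
rewrite /Psi /gs /erfc.
have -> : (c * s) ^+ 2 / (4 * s ^+ 2) = c ^+ 2 / 4 by field.
have -> : erf (c / 2) = erf (c * s / (2 * s)) by congr erf; field.
move: (erf _) (expR _) => e E; by field; apply/andP.
Qed.

Lemma powR_half_sqrt (d : R) (m : nat) : 0 <= d -> d `^ (m%:R / 2) = Num.sqrt d ^+ m.
Proof. by move=> d0; rewrite mulrC powRrM powR12_sqrt// powR_mulrn// sqrtr_ge0. Qed.

End formula.

Variables (Omega : set (R * R)) (f : R * R -> R).
Hypothesis oO : open Omega.
Hypothesis sf : smooth_up_to_boundary Omega f.
Hypothesis cf : compactly_supported Omega f.
Let D w : R * R -> R := pderiv w f.

(** Both sides are the second-order Taylor polynomial of [f] at [x], in the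
    coordinates of the frame and in the original ones. *)
Lemma frame_jet (x n p : R * R) : Omega x -> enorm n = 1 ->
  let F := fun p => f (frame x n p) in
  jet (F (0, 0)) (n.2 * D [:: true] x - n.1 * D [:: false] x) (partial2 F (0, 0))
    (partial1 (partial1 F) (0, 0))
    (n.1 * n.2 * D [:: true; true] x + (n.2 ^+ 2 - n.1 ^+ 2) * D [:: true; false] x
      - n.1 * n.2 * D [:: false; false] x)
    (partial2 (partial2 F) (0, 0)) p.1 p.2 =
  f x + D [:: true] x * ((frame x n p).1 - x.1) + D [:: false] x * ((frame x n p).2 - x.2) +
     D [:: true; true] x / 2 * ((frame x n p).1 - x.1) ^+ 2 +
     D [:: true; false] x * ((frame x n p).1 - x.1) * ((frame x n p).2 - x.2) +
     D [:: false; false] x / 2 * ((frame x n p).2 - x.2) ^+ 2.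
Proof.
move=> Ox n1 F.
have dD w := C1_pderiv oO sf w.
have Of : Omega (frame x n (0, 0)) by rewrite frame0.
have e2 := partial2_frame (dD [::]) Of.
have e11 := partial11_frame oO Ox n1 (dD [::]) (dD [:: true]) (dD [:: false]).
have e22 := partial22_frame oO Ox n1 (dD [::]) (dD [:: true]) (dD [:: false]).
rewrite -(Schwarz oO sf Ox) in e11 e22.
rewrite frame0 in e2.
have F0 : F (0, 0) = f x by rewrite /F frame0.
move: e2 e11 e22 F0.
rewrite -/F => -> -> -> ->.
rewrite /jet /frame /D /pderiv /=.
move: (partial1 f x) (partial2 f x) (partial1 (partial1 f) x)
  (partial1 (partial2 f) x) (partial2 (partial2 f) x) (f x) => d1 d2 d11 d12 d22 fx.
by field.
Qed.


Hypothesis rO : interior_or_exterior_domain Omega.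
Hypothesis sO : smooth_boundary Omega.

(** The expansion at a fixed time, with a constant that depends on [Omega] and [f]
    only. *)
Lemma uniform_expansion : exists (N M K : R), [/\ 0 < N, 0 <= K,
    forall y, Omega y -> `|f y| <= M &
  forall (x b n : R * R) (gamma : R -> R), Omega x -> frontier Omega b ->
    adapted_coordinates Omega x b n gamma -> enorm (b - x) < N^-1 ->
  let F := fun p : R * R => f (frame x n p) in
  forall u, 0 < u <= 1 ->
  `|\int[mm]_(p in [set p : mR * mR | Omega (frame x n p)])
      (gs u p.1 * gs u p.2 * F p) -
    plane_main u (enorm (b - x)) (derive1n 2 gamma 0 / 2) (F (0, 0))
      (partial2 F (0, 0)) (partial1 (partial1 F) (0, 0))
      (partial2 (partial2 F) (0, 0))| <= K * u ^+ 3].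
Proof.
have [N [N0 HN]] := regular_boundary rO sO.
have [T T0 HT] := linked_taylor oO sf cf (ltW N0).
have [M M0 HM] : exists2 M, 0 <= M & forall w, (size w <= 2)%N ->
    forall y, Omega y -> `|D w y| <= M.
  have [M M0 H] := bounded_pderivs oO sf cf
    [:: [::]; [:: true]; [:: false]; [:: true; true]; [:: true; false];
        [:: false; true]; [:: false; false]].
  exists M => // -[|[] [|[] []]]// _; exact: H.
have [Q QE] : exists Q, Q = N + T + 4 * M by exists (N + T + 4 * M).
have Q0 : 0 <= Q by rewrite QE; lra.
have [rho [rho0 rho1 rhoN]] : exists rho, [/\ 0 < rho, rho <= 1 & rho <= N^-1].
  exists (1 + N)^-1; split; first by rewrite invr_gt0; lra.
    by rewrite invf_le1; lra.
  by rewrite lef_pV2 ?posrE; lra.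
exists N, M, `|Kregion rho Q|; split => //.
- by move=> y Oy; exact: (HM [::]).
move=> x b n gamma Ox fb ac bN F u u01.
have [n1 _ _ _ _] := ac.
have [HA HB] := HN b fb.
have [be [kN beN HP]] := HA x n gamma bN ac.
have Mn w : (size w <= 2)%N -> `|D w x| <= M by move=> sw; exact: HM.
have n1' := enorm1 n1.
have nn1 : `|n.1| <= 1 by have := normr_le_enorm1 n; rewrite n1.
have nn2 : `|n.2| <= 1 by have := normr_le_enorm2 n; rewrite n1.
have comb2 (a b' d1 d2 : R) : `|a| <= 1 -> `|b'| <= 1 -> `|d1| <= M -> `|d2| <= M ->
    `|a * d1 + b' * d2| <= Q.
  move=> a1 b1 h1 h2; apply: (le_trans (ler_normD _ _)).
  have := le_normM a1 h1; have := le_normM b1 h2; rewrite QE; lra.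
have comb3 (a b' c' d1 d2 d3 : R) : `|a| <= 1 -> `|b'| <= 2 -> `|c'| <= 1 ->
    `|d1| <= M -> `|d2| <= M -> `|d3| <= M ->
    `|a * d1 + b' * d2 + c' * d3| <= Q.
  move=> a1 b1 c1 h1 h2 h3; apply: (le_trans (ler_normD _ _)).
  have h12 := ler_normD (a * d1) (b' * d2).
  have := le_normM a1 h1; have := le_normM b1 h2; have := le_normM c1 h3; rewrite QE; lra.
have MQ : M <= Q by rewrite QE; lra.
have NQ : N <= Q by rewrite QE; lra.
have TQ : T <= Q by rewrite QE; lra.
have cD y : Omega y -> {for y, continuous f} := @continuous_pderiv _ _ _ oO sf [::] y.
have fM y : Omega y -> `|f y| <= M := HM [::] isT y.
have dD w := C1_pderiv oO sf w.
have Of : Omega (frame x n (0, 0)) by rewrite frame0.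
have le1 (a b' : R) : `|a| <= 1 -> `|b'| <= 1 -> `|a * b'| <= 1.
  by move=> a1 b1; rewrite -[1]mul1r; exact: le_normM.
have sq1 (a : R) : `|a| <= 1 -> `|a ^+ 2| <= 1 by move=> a1; rewrite expr2; exact: le1.
have F0M : `|F (0, 0)| <= Q by apply: le_trans MQ; apply: fM.
have FyM : `|partial2 F (0, 0)| <= Q.
  rewrite (partial2_frame (dD [::]) Of) frame0.
  by apply: comb2 => //; [exact: (Mn [:: true])|exact: (Mn [:: false])].
have FxxM : `|partial1 (partial1 F) (0, 0)| <= Q.
  rewrite (partial11_frame oO Ox n1 (dD [::]) (dD [:: true]) (dD [:: false])).
  rewrite -(Schwarz oO sf Ox).
  have -> (d1 d2 d3 : R) : n.2 ^+ 2 * d1 - n.1 * n.2 * (d2 + d2) + n.1 ^+ 2 * d3 =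
    n.2 ^+ 2 * d1 + (2 * (- (n.1 * n.2))) * d2 + n.1 ^+ 2 * d3 by ring.
  apply: comb3; [exact: sq1| |exact: sq1|exact: (Mn [:: true; true])|
    exact: (Mn [:: true; false])|exact: (Mn [:: false; false])].
  by rewrite normrM normrN ger0_norm// ler_piMr// le1.
have FyyM : `|partial2 (partial2 F) (0, 0)| <= Q.
  rewrite (partial22_frame oO Ox n1 (dD [::]) (dD [:: true]) (dD [:: false])).
  rewrite -(Schwarz oO sf Ox).
  have -> (d1 d2 d3 : R) : n.1 ^+ 2 * d1 + n.1 * n.2 * (d2 + d2) + n.2 ^+ 2 * d3 =
    n.1 ^+ 2 * d1 + (2 * (n.1 * n.2)) * d2 + n.2 ^+ 2 * d3 by ring.
  apply: comb3; [exact: sq1| |exact: sq1|exact: (Mn [:: true; true])|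
    exact: (Mn [:: true; false])|exact: (Mn [:: false; false])].
  by rewrite normrM ger0_norm// ler_piMr// le1.
have FxM : `|n.2 * D [:: true] x - n.1 * D [:: false] x| <= Q.
  rewrite -mulNr; apply: comb2; rewrite ?normrN//.
    exact: (Mn [:: true]).
  exact: (Mn [:: false]).
have FxyM : `|n.1 * n.2 * D [:: true; true] x + (n.2 ^+ 2 - n.1 ^+ 2) * D [:: true; false] x
      - n.1 * n.2 * D [:: false; false] x| <= Q.
  rewrite -[- (_ * D [:: false; false] x)]mulNr; apply: comb3; rewrite ?normrN.
  - exact: le1.
  - apply: (le_trans (ler_normB _ _)); exact: (lerD (sq1 _ nn2) (sq1 _ nn1)).
  - exact: le1.
  - exact: (Mn [:: true; true]).
  - exact: (Mn [:: true; false]).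
  - exact: (Mn [:: false; false]).
have alQ : `|derive1n 2 gamma 0 / 2| <= Q.
  rewrite normrM [`|2^-1|]ger0_norm ?invr_ge0//.
  by apply: le_trans (le_trans kN NQ); rewrite ler_piMr// invf_le1// ler1n.
have u3 : 0 <= u ^+ 3 by rewrite exprn_ge0//; case/andP: u01 => /ltW.
have := region_expansion rho0 rho1 Q0 (u := u) (r := enorm (b - x)) (be := be)
  (fx := n.2 * D [:: true] x - n.1 * D [:: false] x)
  (fxy := n.1 * n.2 * D [:: true; true] x + (n.2 ^+ 2 - n.1 ^+ 2) * D [:: true; false] x
      - n.1 * n.2 * D [:: false; false] x)
  u01 alQ (le_trans beN NQ) F0M FxM FyM FxxM FxyM FyyM
  (@measurable_frame_domain _ Omega x n n1 oO) (@measurable_frame_fun _ Omega f x n n1 oO cD) _ _ _.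
move=> H; apply: (le_trans (H _ _ _)); last by rewrite ler_wpM2r// ler_norm.
- move=> p pr pQ; apply: HP; first exact: lt_le_trans rhoN.
  by apply: le_lt_trans pQ; rewrite ler_wpM2r// -[4%N]/(2 * 2)%N exprM sqr_ge0.
- move=> p Dp pr; rewrite (frame_jet p Ox n1).
  have pN : enorm (frame x n p - x) < N^-1.
    by rewrite enorm_frame//; exact: lt_le_trans rhoN.
  apply: (le_trans (HT x _ Ox (HB x _ Ox Dp bN pN))).
  by rewrite enorm_frame// ler_wpM2r// exprn_ge0// enorm_ge0.
- by move=> p Dp; apply: le_trans MQ; exact: fM.
Qed.

End expansion.

Lemma cvg_sqrt_right (R : realType) : Num.sqrt t @[t --> (0 : R)^'+] --> (0 : R)^'+.
Proof.
have c0 : Num.sqrt t @[t --> (0 : R)^'+] --> (0 : R).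
  by rewrite -[X in _ --> X]sqrtr0; apply: cvg_at_right_filter; exact: sqrt_continuous.
move=> A A0; have {}A0 := c0 _ A0.
rewrite /nbhs /= /fmap /=; near=> t.
have t0 : 0 < t by near: t; exact: nbhs_right_gt.
have h : 0 < Num.sqrt t by rewrite sqrtr_gt0.
move: h; near: t; exact: A0.
Unshelve. all: by end_near. Qed.

(** The condition [enorm (b - x) < N^-1] keeps the expansion inside the charts of
    the boundary. *)
Lemma VL_expansion (R : realType) (Omega : set (R * R)) (f : R * R -> R) :
  interior_or_exterior_domain Omega -> smooth_boundary Omega ->
  smooth_up_to_boundary Omega f -> compactly_supported Omega f ->
  exists N K : R, 0 < N /\
  forall (de : R) (x b n : R * R) (gamma : R -> R), 0 < de <= 1 ->
    Omega x -> frontier Omega b -> adapted_coordinates Omega x b n gamma ->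
    enorm (b - x) < N^-1 ->
  let F := fun p : R * R => f (frame x n p) in
  `|VL Omega f de x - Psi (enorm (b - x)) (derive1n 2 gamma 0) (F (0, 0))
      (partial2 F (0, 0)) (partial1 (partial1 F) (0, 0))
      (partial2 (partial2 F) (0, 0)) (Num.sqrt de)| <= K * Num.sqrt de ^+ 5.
Proof.
move=> rO sO sf cf; have [oO _ _ _] := rO.
have [N [M [K [N0 K0 fM H]]]] := uniform_expansion oO sf cf rO sO.
exists N, K; split => // de x b n gamma /andP[de0 de1] Ox fb ac rN /=.
set F := fun p : R * R => f (frame x n p).
have s0 : 0 < Num.sqrt de by rewrite sqrtr_gt0.
have r0 : 0 < enorm (b - x).
  rewrite lt_def enorm_ge0 andbT; apply/negP => /eqP r00.
  have xb : x = b by have [_ fr _ _ _] := ac; move: fr; rewrite r00 oppr0 frame0.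
  by have [_] := fb; apply; rewrite -xb; move: oO; rewrite openE; exact.
have [n1 _ _ _ _] := ac.
have cD y : Omega y -> {for y, continuous f} := @continuous_pderiv _ _ _ oO sf [::] y.
have mD := @measurable_frame_domain _ Omega x n n1 oO.
have mF := @measurable_frame_fun _ Omega f x n n1 oO cD.
have FM p : Omega (frame x n p) -> `|F p| <= M by exact: fM.
pose I u := \int[(@lebesgue_measure R \x @lebesgue_measure R)%E]_(p in
    [set p : measurableTypeR R * measurableTypeR R | Omega (frame x n p)])
  (gs u p.1 * gs u p.2 * F p).
have -> : VL Omega f de x = \int[@lebesgue_measure R]_(t in `]0, de[) I (Num.sqrt t).
  rewrite /VL; apply: eq_Rintegral => t tde.
  have t0 : 0 < t by move: tde; rewrite inE/= in_itv/= => /andP[].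
  exact: (heat_integral_frame x n1 oO cD fM t0).
have sqrt_in t : t \in `]0, de[ -> 0 < Num.sqrt t <= Num.sqrt de.
  rewrite in_itv/= => /andP[t0 td]; rewrite sqrtr_gt0 t0/=.
  by rewrite ler_wsqrtr// ltW.
have s1 : Num.sqrt de <= 1 by rewrite -sqrtr1 ler_wsqrtr.
have -> : K * Num.sqrt de ^+ 5 = K * Num.sqrt de ^+ 3 * de.
  by rewrite -mulrA -[X in _ * (_ * X)](sqr_sqrtr (ltW de0)) -exprD.
apply: (@time_integral R (fun t => I (Num.sqrt t))
  (fun t => plane_main (Num.sqrt t) (enorm (b - x)) (derive1n 2 gamma 0 / 2) (F (0, 0))
      (partial2 F (0, 0)) (partial1 (partial1 F) (0, 0)) (partial2 (partial2 F) (0, 0)))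
  (fun t => Psi (enorm (b - x)) (derive1n 2 gamma 0) (F (0, 0))
      (partial2 F (0, 0)) (partial1 (partial1 F) (0, 0))
      (partial2 (partial2 F) (0, 0)) (Num.sqrt t)) de (K * Num.sqrt de ^+ 3) M de0
  (measurable_heat_integral mD mF FM (de := de))).
- move=> t /sqrt_in /andP[t0 ts].
  apply: (le_trans (H x b n gamma Ox fb ac rN (Num.sqrt t) _)).
    by rewrite t0 (le_trans ts).
  by rewrite ler_wpM2l// lerXn2r ?nnegrE ?(ltW t0) ?(ltW s0).
- move=> t /sqrt_in /andP[t0 _].
  by apply: (Rintegral_gs2_bounded mD mF FM) => //; exact: le_trans (fM x Ox).
- by move=> t t0; exact: is_derive_Psi_sqrt.
- by move=> t t0; exact: continuous_pm_sqrt.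
- have P0 := cvg_Psi0 (derive1n 2 gamma 0) (F (0, 0)) (partial2 F (0, 0))
    (partial1 (partial1 F) (0, 0)) (partial2 (partial2 F) (0, 0)) r0.
  exact: (cvg_comp _ _ (@cvg_sqrt_right R) P0).
Qed.

Theorem lemma4p5 (R : realType) (Omega : set (R * R)) (f : R * R -> R) :
  interior_or_exterior_domain Omega ->
  smooth_boundary Omega ->
  smooth_up_to_boundary Omega f ->
  compactly_supported Omega f ->
  forall C : R, exists K : R, \forall delta \near (0 : R)^'+,
  forall (x b n : R * R) (gamma : R -> R),
    Omega x ->
    unique_closest_point Omega x b ->
    adapted_coordinates Omega x b n gamma ->
    let r := enorm (b - x) in
    let c := r / Num.sqrt delta in
    let kappa := derive1n 2 gamma 0 in
    let F := fun p : R * R => f (frame x n p) in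
    let F0 := F (0, 0) in
    let Feta := partial2 F (0, 0) in
    let Fxixi := partial1 (partial1 F) (0, 0) in
    let Fetaeta := partial2 (partial2 F) (0, 0) in
    let E := expR (- (c ^+ 2 / 4)) in
    c <= C ->
    `| VL Omega f delta x -
       (delta / 4 *
          (2 * erf (c / 2) + 2 * c * E / Num.sqrt pi
           - c ^+ 2 * erfc (c / 2) + 2) * F0
        + delta `^ (3 / 2) *
          (((4 - 2 * c ^+ 2) * E + Num.sqrt pi * c ^+ 3 * erfc (c / 2))
           * (2 * Feta - kappa * F0) / (12 * Num.sqrt pi))
        + delta ^+ 2 / 48 *
          (erfc (c / 2) *
             (4 * c ^+ 4 * kappa * Feta - 3 * (c ^+ 4 + 4) * Fetaeta
              + (c ^+ 4 - 12) * Fxixi - 3 * c ^+ 4 * kappa ^+ 2 * F0)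
           + 2 * c * (c ^+ 2 - 2) * E *
             (- 4 * kappa * Feta + 3 * Fetaeta - Fxixi + 3 * kappa ^+ 2 * F0)
             / Num.sqrt pi
           + 24 * (Fxixi + Fetaeta))) |
    <= K * delta `^ (5 / 2).
Proof.
move=> rO sO sf cf C.
have [N [K [N0 H]]] := VL_expansion rO sO sf cf.
exists K.
have C0 : 0 < `|C| + 1 by rewrite ltr_wpDl.
(* With [r <= C * sqrt delta], the bound on [sqrt delta] gives [r < 1 / N]. *)
have e0 : 0 < (N * (`|C| + 1))^-1 by rewrite invr_gt0 mulr_gt0.
have small : \forall de \near (0 : R)^'+,
    [/\ 0 < de, de <= 1 & de < (N * (`|C| + 1))^-1 ^+ 2].
  by near=> de; split; near: de;
    [exact: nbhs_right_gt|exact/nbhs_right_le/ltr01|apply: nbhs_right_lt; rewrite exprn_gt0].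
apply: filterS small => de [de0 de1 dee] x b n gamma Ox ub ac cC.
have [fb _] := ub.
have s0 : 0 < Num.sqrt de by rewrite sqrtr_gt0.
have se : Num.sqrt de < (N * (`|C| + 1))^-1.
  rewrite -(ltr_pXn2r (n := 2)) ?nnegrE ?(ltW s0) ?(ltW e0)//.
  by rewrite sqr_sqrtr// ltW.
have rE : enorm (b - x) = enorm (b - x) / Num.sqrt de * Num.sqrt de.
  by rewrite divfK// gt_eqF.
have rN : enorm (b - x) < N^-1.
  rewrite rE; apply: (@le_lt_trans _ _ (`|C| * Num.sqrt de)).
    by rewrite ler_wpM2r ?(ltW s0)// (le_trans cC)// ler_norm.
  apply: (@lt_trans _ _ ((`|C| + 1) * Num.sqrt de)); first by rewrite ltr_pM2r// ltrDl.
  by rewrite -ltr_pdivlMl// -invfM mulrC.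
have d01 : 0 < de <= 1 by rewrite de0.
have := H de x b n gamma d01 Ox fb ac rN.
rewrite /= [X in Psi X]rE PsiE// sqr_sqrtr ?(ltW de0)//.
by rewrite !powR_half_sqrt ?(ltW de0).
Unshelve. all: by end_near. Qed.
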